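(* Let $(U,A)$ be a left bialgebroid. (i) Let $(U,A)$ be additionally a left Hopf algebroid such that $U_{\triangleleft}$ is a projective $A$-module. Then there is a (strict) monoidal functor $\mathbf{Comod}\text{-}U\to U\text{-}\mathbf{Comod}$: if $M$ is a right $U$-comodule with coaction $m\mapsto m_{(0)}\otimes_A m_{(1)}$, then $$M\to U_{\triangleleft}\otimes_A M,\qquad m\mapsto m_{(1)-}\otimes_A m_{(0)}\,\epsilon(m_{(1)+}),$$ defines a left $U$-comodule structure on $M$. (ii) Let $(U,A)$ be a right Hopf algebroid such that ${}_{\triangleright}U$ is a projective $A$-module. Then there is a (strict) monoidal functor $U\text{-}\mathbf{Comod}\to\mathbf{Comod}\text{-}U$: if $N$ is a left $U$-comodule with coaction $n\mapsto n_{(-1)}\otimes_A n_{(0)}$, then $$N\to N\otimes_A{}_{\triangleright}U,\qquad n\mapsto \epsilon(n_{(-1)[+]})\,n_{(0)}\otimes_A n_{(-1)[-]},$$ defines a right $U$-comodule structure on $N$. (iii) If $U$ is both a left and a right Hopf algebroid and if both $U_{\triangleleft}$ and ${}_{\triangleright}U$ are $A$-projective, then the functors in (i) and (ii) are quasi-inverse to each other, and we have an equivalence $U\text{-}\mathbf{Comod}\simeq\mathbf{Comod}\text{-}U$ of monoidal categories.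
   Context: $k$ is a commutative ring, unadorned $\otimes$ is over $k$, $A$ is an associative unital $k$-algebra, $A^e=A\otimes A^{\rm op}$. An $A^e$-ring $U$ is a $k$-algebra with a $k$-algebra map $\eta:A^e\to U$; put $s^\ell(a)=\eta(a\otimes1)$ (source), $t^\ell(a)=\eta(1\otimes a)$ (target). Write $$a\triangleright u\triangleleft b:=s^\ell(a)t^\ell(b)u,\qquad a\blacktriangleright u\blacktriangleleft b:=u\,t^\ell(a)s^\ell(b),$$ and ${}_{\triangleright}U,\ U_{\triangleleft},\ {}_{\blacktriangleright}U,\ U_{\blacktriangleleft}$ for $U$ with the corresponding $A$-action. Thus in $U_{\triangleleft}\otimes_A{}_{\triangleright}U$ one has $t^\ell(a)u\otimes u'=u\otimes s^\ell(a)u'$. Its Takeuchi product $U_{\triangleleft}\times_A{}_{\triangleright}U$ consists of the $\sum_i u_i\otimes u_i'$ with $\sum_i u_it^\ell(a)\otimes u_i'=\sum_i u_i\otimes u_i's^\ell(a)$ for all $a\in A$; it is an algebra under factorwise multiplication. A left bialgebroid $(U,A)$ is an $A^e$-ring $U$ with an $A$-coring structure (coassociative coproduct $\Delta_\ell:U\to U_{\triangleleft}\otimes_A{}_{\triangleright}U$, $u\mapsto u_{(1)}\otimes_A u_{(2)}$, and counit $\epsilon:U\to A$, both bimodule maps for the $(A,A)$-bimodule ${}_{\triangleright}U_{\triangleleft}$) such that $\Delta_\ell$ is a unital $k$-algebra map into $U_{\triangleleft}\times_A{}_{\triangleright}U$, and $\epsilon(1)=1$, $\epsilon(uu')=\epsilon(u\,s^\ell(\epsilon(u')))=\epsilon(u\,t^\ell(\epsilon(u')))$.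 Hopf–Galois maps: $$\alpha_\ell:{}_{\blacktriangleright}U\otimes_{A^{\rm op}}U_{\triangleleft}\to U_{\triangleleft}\otimes_A{}_{\triangleright}U,\ u\otimes v\mapsto u_{(1)}\otimes u_{(2)}v,$$ $$\alpha_r:U_{\blacktriangleleft}\otimes^A{}_{\triangleright}U\to U_{\triangleleft}\otimes_A{}_{\triangleright}U,\ u\otimes v\mapsto u_{(1)}v\otimes u_{(2)},$$ where in the first domain $ut^\ell(a)\otimes v=u\otimes t^\ell(a)v$ and in the second $us^\ell(a)\otimes v=u\otimes s^\ell(a)v$. $U$ is a left (right) Hopf algebroid if $\alpha_\ell$ ($\alpha_r$) is bijective; then $u_+\otimes_{A^{\rm op}}u_-:=\alpha_\ell^{-1}(u\otimes_A1)$, respectively $u_{[+]}\otimes^Au_{[-]}:=\alpha_r^{-1}(1\otimes_Au)$. A right $U$-comodule is a right $A$-module $M$ with a right $A$-linear, coassociative, counital coaction $M\to M\otimes_A{}_{\triangleright}U$, $m\mapsto m_{(0)}\otimes_Am_{(1)}$ (the right $A$-action on the target is $(m\otimes u)a=m\otimes t^\ell(a)u$); it carries the induced left $A$-action $am:=m_{(0)}\epsilon(m_{(1)}t^\ell(a))$, is an $A^e$-module, and satisfies $am_{(0)}\otimes_Am_{(1)}=m_{(0)}\otimes_Am_{(1)}s^\ell(a)$. Symmetrically, a left $U$-comodule is a left $A$-module $N$ with a left $A$-linear, coassociative, counital coaction $N\to U_{\triangleleft}\otimes_AN$, with induced right $A$-action $na:=\epsilon(n_{(-1)}s^\ell(a))n_{(0)}$,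 satisfying $n_{(-1)}t^\ell(a)\otimes_An_{(0)}=n_{(-1)}\otimes_An_{(0)}a$. $\mathbf{Comod}\text{-}U$ and $U\text{-}\mathbf{Comod}$ are the categories of right and left $U$-comodules. They are monoidal under $\otimes_A$ with coactions $m\otimes m'\mapsto(m_{(0)}\otimes m'_{(0)})\otimes m'_{(1)}m_{(1)}$ (right comodules) and $n\otimes n'\mapsto n_{(-1)}n'_{(-1)}\otimes(n_{(0)}\otimes n'_{(0)})$ (left comodules), and unit object $A$ with coaction $a\mapsto 1\otimes_At^\ell(a)$, respectively $a\mapsto s^\ell(a)\otimes_A1$. The functors in the claim keep the underlying $A^e$-modules and are the identity on morphisms. *)

(* Defs.v *)
From HB Require Import structures.
From mathcomp Require Import all_boot all_algebra.
From mathcomp Require Import boolp classical_sets.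

Set Implicit Arguments.
Unset Strict Implicit.
Unset Printing Implicit Defensive.

Import GRing.Theory.
Local Open Scope ring_scope.
Local Open Scope quotient_scope.

Lemma morphD0 (V W : zmodType) (h : V -> W) :
  {morph h : x y / x + y} -> h 0 = 0.
Proof. by move=> hD; apply: (addrI (h 0)); rewrite -hD !addr0. Qed.

Lemma morphDN (V W : zmodType) (h : V -> W) :
  {morph h : x y / x + y} -> {morph h : x / - x}.
Proof.
by move=> hD x; apply: (addrI (h x)); rewrite -hD !subrr (morphD0 hD).
Qed.

Lemma morphD_sum (V W : zmodType) (h : V -> W) (I : Type) (s : seq I)
    (F : I -> V) :
  {morph h : x y / x + y} -> h (\sum_(i <- s) F i) = \sum_(i <- s) h (F i).
Proof. by move=> hD; exact: (big_morph h hD (morphD0 hD)). Qed.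

(* $M \otimes_S N$ for an arbitrary family of endomaps [r] of $M$ and [l] of $N$
   indexed by $S$: formal sums of pairs modulo biadditivity and
   $m s \otimes n = m \otimes s n$. *)
Section Tensor.
Variables (S : Type) (M N : zmodType) (r : M -> S -> M) (l : S -> N -> N).

Inductive tensor_rel : seq (M * N) -> seq (M * N) -> Prop :=
| tensor_rel_refl a : tensor_rel a a
| tensor_rel_sym a b : tensor_rel a b -> tensor_rel b a
| tensor_rel_trans a b c : tensor_rel a b -> tensor_rel b c -> tensor_rel a c
| tensor_rel_cat a b c d :
    tensor_rel a b -> tensor_rel c d -> tensor_rel (a ++ c) (b ++ d)
| tensor_rel_comm a b : tensor_rel (a ++ b) (b ++ a)
| tensor_rel_0l n : tensor_rel [:: (0, n)] [::]
| tensor_rel_0r m : tensor_rel [:: (m, 0)] [::]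
| tensor_rel_Dl m m' n : tensor_rel [:: (m + m', n)] [:: (m, n); (m', n)]
| tensor_rel_Dr m n n' : tensor_rel [:: (m, n + n')] [:: (m, n); (m, n')]
| tensor_rel_bal m s n : tensor_rel [:: (r m s, n)] [:: (m, l s n)].

Definition tensor_relb (a b : seq (M * N)) : bool := `[< tensor_rel a b >].

Lemma tensor_relb_refl : reflexive tensor_relb.
Proof. by move=> a; apply/asboolP/tensor_rel_refl. Qed.

Lemma tensor_relb_sym : symmetric tensor_relb.
Proof. by move=> a b; apply/asboolP/asboolP; exact: tensor_rel_sym. Qed.

Lemma tensor_relb_trans : transitive tensor_relb.
Proof.
by move=> b a c /asboolP ab /asboolP bc; apply/asboolP/(tensor_rel_trans ab bc).
Qed.

Canonical tensor_equiv :=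
  EquivRel tensor_relb tensor_relb_refl tensor_relb_sym tensor_relb_trans.

Definition tensor : Type := {eq_quot tensor_equiv}.
HB.instance Definition _ := Choice.on tensor.
HB.instance Definition _ := EqQuotient.on tensor.

Definition fsum (a : seq (M * N)) : tensor := \pi_tensor a.

Lemma fsumP a b : fsum a = fsum b <-> tensor_rel a b.
Proof. by split=> [/eqmodP/asboolP|ab]; [|apply/eqmodP/asboolP]. Qed.

Lemma fsum_repr x : fsum (repr x) = x. Proof. exact: reprK. Qed.

Definition tensor_add (x y : tensor) : tensor := fsum (repr x ++ repr y).
Definition tensor_opp (x : tensor) : tensor :=
  fsum [seq (- p.1, p.2) | p <- repr x].

Let repr_fsum a : tensor_rel (repr (fsum a)) a.
Proof. by apply/fsumP; rewrite fsum_repr. Qed.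

Let fsum_cat a b : tensor_add (fsum a) (fsum b) = fsum (a ++ b).
Proof. by apply/fsumP/tensor_rel_cat; exact: repr_fsum. Qed.

Let tensor_addA : associative tensor_add.
Proof.
move=> x y z; rewrite -[x]fsum_repr -[y]fsum_repr -[z]fsum_repr.
by rewrite !fsum_cat catA.
Qed.

Let tensor_addC : commutative tensor_add.
Proof. by move=> x y; apply/fsumP/tensor_rel_comm. Qed.

Let tensor_add0 : left_id (fsum [::]) tensor_add.
Proof. by move=> x; rewrite -[x]fsum_repr fsum_cat. Qed.

Let tensor_addN : left_inverse (fsum [::]) tensor_opp tensor_add.
Proof.
move=> x; rewrite -[in X in tensor_add _ X](fsum_repr x) fsum_cat.
apply/fsumP; elim: (repr x) => [|p a IHa] /=; first exact: tensor_rel_refl.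
set b := map _ a in IHa *.
apply: (@tensor_rel_trans _ ([:: (- p.1, p.2); p] ++ (b ++ a))).
  rewrite -cat1s -[p :: a]cat1s -[[:: _; p]]cat1s -!catA.
  apply: tensor_rel_cat (tensor_rel_refl _) _; rewrite !catA.
  by apply: tensor_rel_cat (tensor_rel_comm _ _) (tensor_rel_refl _).
rewrite -[[::]]cats0; apply: tensor_rel_cat IHa.
apply: (tensor_rel_trans _ (tensor_rel_0l p.2)).
by apply: tensor_rel_sym; rewrite -(addNr p.1); case: p => m n; exact: tensor_rel_Dl.
Qed.

HB.instance Definition _ :=
  GRing.isZmodule.Build tensor tensor_addA tensor_addC tensor_add0 tensor_addN.

Definition tens (m : M) (n : N) : tensor := fsum [:: (m, n)].

Lemma fsumE a : fsum a = \sum_(p <- a) tens p.1 p.2.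
Proof.
elim: a => [|[m n] a IHa]; first by rewrite big_nil.
by rewrite big_cons -IHa /= [tens m n + _]fsum_cat.
Qed.

Lemma tensor_sumE x : x = \sum_(p <- repr x) tens p.1 p.2.
Proof. by rewrite -fsumE fsum_repr. Qed.

Lemma tensDl n : {morph tens^~ n : m m' / m + m'}.
Proof.
move=> m m'; rewrite [RHS]fsum_cat; apply/fsumP; exact: tensor_rel_Dl.
Qed.

Lemma tensDr m : {morph tens m : n n' / n + n'}.
Proof.
move=> n n'; rewrite [RHS]fsum_cat; apply/fsumP; exact: tensor_rel_Dr.
Qed.

Lemma tens_bal m s n : tens (r m s) n = tens m (l s n).
Proof. by apply/fsumP; exact: tensor_rel_bal. Qed.

Lemma tensor_ind (P : tensor -> Prop) :
  (forall m n, P (tens m n)) -> (forall x y, P x -> P y -> P (x + y)) ->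
  forall x, P x.
Proof.
move=> Pt PD x; rewrite (tensor_sumE x); elim: (repr x) => [|p a IHa].
  rewrite big_nil -(morphD0 (tensDl 0)); exact: Pt.
by rewrite big_cons; apply: PD.
Qed.

Definition balanced (G : zmodType) (f : M -> N -> G) : Prop :=
  [/\ forall n, {morph f^~ n : m m' / m + m'},
      forall m, {morph f m : n n' / n + n'} &
      forall m s n, f (r m s) n = f m (l s n)].

(* Sweedler notation: [tlift f x] is the sum of the $f(x', x'')$ over a representative
   $\sum x' \otimes x''$ of [x]. It depends on the representative unless [f] is
   balanced, in which case it is the induced additive map (see [tlift_fsum]). *)
Definition tlift (G : zmodType) (f : M -> N -> G) (x : tensor) : G :=
  \sum_(p <- repr x) f p.1 p.2.

Lemma tlift_fsum (G : zmodType) (f : M -> N -> G) a :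
  balanced f -> tlift f (fsum a) = \sum_(p <- a) f p.1 p.2.
Proof.
case=> fDl fDr fb.
suff H b c : tensor_rel b c -> \sum_(p <- b) f p.1 p.2 = \sum_(p <- c) f p.1 p.2.
  exact/H/repr_fsum.
elim=> {b c} // [b c d _ -> _ -> //|b c d e _ IH1 _ IH2|b c|n|m|m m' n|m n n'|m s n].
- by rewrite !big_cat /= IH1 IH2.
- by rewrite !big_cat /= addrC.
- by rewrite big_seq1 big_nil (morphD0 (fDl n)).
- by rewrite big_seq1 big_nil (morphD0 (fDr m)).
- by rewrite !big_cons !big_nil /= fDl !addr0.
- by rewrite !big_cons !big_nil /= fDr !addr0.
- by rewrite !big_seq1 /= fb.
Qed.

Lemma tliftE (G : zmodType) (f : M -> N -> G) m n :
  balanced f -> tlift f (tens m n) = f m n.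
Proof. by move=> fb; rewrite tlift_fsum // big_seq1. Qed.

Lemma tliftD (G : zmodType) (f : M -> N -> G) :
  balanced f -> {morph tlift f : x y / x + y}.
Proof.
move=> fb x y; rewrite -[x]fsum_repr -[y]fsum_repr [_ + _]fsum_cat.
by rewrite !tlift_fsum // big_cat.
Qed.

Lemma balanced_tens : balanced tens.
Proof. by split; [exact: tensDl | exact: tensDr | exact: tens_bal]. Qed.

Lemma tlift_tens x : tlift tens x = x.
Proof. by rewrite [RHS]tensor_sumE. Qed.

Lemma eq_tlift (G : zmodType) (f g : M -> N -> G) x :
  (forall m n, f m n = g m n) -> tlift f x = tlift g x.
Proof. by move=> fg; apply: eq_bigr => p _; exact: fg. Qed.

Lemma tlift_sumf (G : zmodType) (f g : M -> N -> G) x :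
  tlift (fun m n => f m n + g m n) x = tlift f x + tlift g x.
Proof. exact: big_split. Qed.

Lemma morph_tlift (G H : zmodType) (h : G -> H) (f : M -> N -> G) x :
  {morph h : y z / y + z} -> h (tlift f x) = tlift (fun m n => h (f m n)) x.
Proof. by move=> hD; rewrite /tlift morphD_sum. Qed.

Lemma tens_ext (G : zmodType) (f g : tensor -> G) :
  {morph f : x y / x + y} -> {morph g : x y / x + y} ->
  (forall m n, f (tens m n) = g (tens m n)) -> f =1 g.
Proof.
move=> fD gD fg; apply: tensor_ind => // x y fgx fgy.
by rewrite fD gD fgx fgy.
Qed.

End Tensor.

Arguments tensor {S M N} r l.
Arguments tens {S M N r l} m n.
Arguments fsum {S M N r l} a.
Arguments tlift {S M N r l G} f x.
Arguments balanced {S M N} r l {G} f.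
Arguments tens_ext {S M N r l G} f g.
Arguments tensDl {S M N r l}.
Arguments tensDr {S M N r l}.
Arguments tens_bal {S M N r l}.

Lemma tlift_exch (S S' : Type) (M N M' N' G : zmodType)
    (r : M -> S -> M) (l : S -> N -> N) (r' : M' -> S' -> M') (l' : S' -> N' -> N')
    (f : M -> N -> M' -> N' -> G) (x : tensor r l) (y : tensor r' l') :
  tlift (fun m n => tlift (fun m' n' => f m n m' n') y) x =
  tlift (fun m' n' => tlift (fun m n => f m n m' n') x) y.
Proof. exact: exchange_big. Qed.

(* [algType k] would exclude the zero algebra *)
Record kalgebra (k : comPzRingType) := KAlgebra {
  kalg_ring :> pzRingType;
  kunit : {rmorphism k -> kalg_ring};
  kunit_central : forall c a, kunit c * a = a * kunit c }.

Arguments kunit {k} k0 : rename.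

(* $A^e = A \otimes_k A^{op}$ *)
Section Enveloping.
Variables (k : comPzRingType) (A : kalgebra k).

Definition enveloping : Type :=
  tensor (fun (a : A) (c : k) => a * kunit A c)
         (fun (c : k) (b : A) => kunit A c * b).
HB.instance Definition _ := GRing.Zmodule.on enveloping.

Definition env_tens (a b : A) : enveloping := tens a b.

Definition env_mul (x y : enveloping) : enveloping :=
  tlift (fun a b => tlift (fun a' b' => env_tens (a * a') (b' * b)) y) x.

Lemma env_tensDl b : {morph env_tens^~ b : a a' / a + a'}.
Proof. exact: tensDl. Qed.

Lemma env_tensDr a : {morph env_tens a : b b' / b + b'}.
Proof. exact: tensDr. Qed.

Lemma env_tens_bal a c b : env_tens (a * kunit A c) b = env_tens a (kunit A c * b).
Proof. exact: (tens_bal a c b). Qed.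

Let mul_balr a b : balanced (fun (a : A) (c : k) => a * kunit A c)
  (fun (c : k) (b : A) => kunit A c * b)
  (fun a' b' => env_tens (a * a') (b' * b)).
Proof.
split=> [b' x y|a' x y|a' c b'] /=.
- by rewrite mulrDr env_tensDl.
- by rewrite mulrDl env_tensDr.
- by rewrite mulrA env_tens_bal mulrA.
Qed.

Lemma env_tensM a b a' b' :
  env_mul (env_tens a b) (env_tens a' b') = env_tens (a * a') (b' * b).
Proof.
rewrite /env_mul tliftE ?tliftE //; split=> [c x y|c x y|c d e] /=.
- by rewrite -tlift_sumf; apply: eq_tlift => u v; rewrite mulrDl env_tensDl.
- by rewrite -tlift_sumf; apply: eq_tlift => u v; rewrite mulrDr env_tensDr.
- apply: eq_tlift => u v; rewrite -mulrA kunit_central mulrA env_tens_bal.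
  by rewrite !mulrA kunit_central.
Qed.

Lemma env_mulDl : left_distributive env_mul +%R.
Proof.
move=> x y z; apply: tliftD; split=> [c u v|c u v|c d e] /=.
- by rewrite -tlift_sumf; apply: eq_tlift => a b; rewrite mulrDl env_tensDl.
- by rewrite -tlift_sumf; apply: eq_tlift => a b; rewrite mulrDr env_tensDr.
- apply: eq_tlift => u v; rewrite -mulrA kunit_central mulrA env_tens_bal.
  by rewrite !mulrA kunit_central.
Qed.

Lemma env_mulDr : right_distributive env_mul +%R.
Proof.
move=> x y z; rewrite /env_mul -tlift_sumf; apply: eq_tlift => a b.
exact/tliftD/mul_balr.
Qed.

Lemma env_mulA : associative env_mul.
Proof.
move=> x y z; elim/tensor_ind: x => [a b|u v IHu IHv]; last first.
  by rewrite !env_mulDl IHu IHv.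
elim/tensor_ind: y => [c d|u v IHu IHv]; last first.
  by rewrite env_mulDr !env_mulDl env_mulDr IHu IHv.
elim/tensor_ind: z => [e f|u v IHu IHv]; last by rewrite !env_mulDr IHu IHv.
by rewrite -!/(env_tens _ _) !env_tensM !mulrA.
Qed.

Lemma env_mul1 : left_id (env_tens 1 1) env_mul.
Proof.
move=> x; elim/tensor_ind: x => [a b|u v IHu IHv]; last first.
  by rewrite env_mulDr IHu IHv.
by rewrite -!/(env_tens _ _) env_tensM mul1r mulr1.
Qed.

Lemma env_mulr1 : right_id (env_tens 1 1) env_mul.
Proof.
move=> x; elim/tensor_ind: x => [a b|u v IHu IHv]; last first.
  by rewrite env_mulDl IHu IHv.
by rewrite -!/(env_tens _ _) env_tensM mul1r mulr1.
Qed.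

HB.instance Definition _ := GRing.Zmodule_isPzRing.Build enveloping
  env_mulA env_mul1 env_mulr1 env_mulDl env_mulDr.

Lemma env_tens_mul a b a' b' :
  env_tens a b * env_tens a' b' = env_tens (a * a') (b' * b).
Proof. exact: env_tensM. Qed.

Definition env_unit (c : k) : enveloping := env_tens (kunit A c) 1.

Lemma env_unit_zmod : GRing.zmod_morphism env_unit.
Proof.
move=> c d; apply: (addIr (env_unit d)).
by rewrite -addrA addNr addr0 /env_unit -env_tensDl rmorphB addrNK.
Qed.

Lemma env_unit_monoid : GRing.monoid_morphism env_unit.
Proof.
split=> [|c d]; first by rewrite /env_unit rmorph1.
by rewrite /env_unit env_tens_mul mul1r rmorphM.
Qed.

HB.instance Definition _ :=
  GRing.isZmodMorphism.Build k enveloping env_unit env_unit_zmod.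
HB.instance Definition _ :=
  GRing.isMonoidMorphism.Build k enveloping env_unit env_unit_monoid.

Lemma env_unit_central c (x : enveloping) : env_unit c * x = x * env_unit c.
Proof.
elim/tensor_ind: x => [a b|u v IHu IHv]; last by rewrite mulrDr mulrDl IHu IHv.
by rewrite -!/(env_tens _ _) !env_tens_mul mul1r mulr1 kunit_central.
Qed.

Definition Aenv : kalgebra k := @KAlgebra k enveloping env_unit env_unit_central.

End Enveloping.

Section Bimodule.
Variables (k : comPzRingType) (A : kalgebra k).

Section Build.
Variables (V : zmodType) (L : A -> V -> V) (R : V -> A -> V).
Hypotheses (LDr : forall a, {morph L a : v w / v + w})
  (LDl : forall v, {morph L^~ v : a b / a + b})
  (L1 : forall v, L 1 v = v) (LM : forall a b v, L (a * b) v = L a (L b v))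
  (RDl : forall a, {morph R^~ a : v w / v + w})
  (RDr : forall v, {morph R v : a b / a + b})
  (R1 : forall v, R v 1 = v) (RM : forall a b v, R v (a * b) = R (R v a) b)
  (LR : forall a v b, L a (R v b) = R (L a v) b)
  (LRk : forall c v, L (kunit A c) v = R v (kunit A c)).

Definition env_scale (x : Aenv A) (v : V) : V := tlift (fun a b => L a (R v b)) x.

Let bal v : balanced (fun (a : A) (c : k) => a * kunit A c)
  (fun (c : k) (b : A) => kunit A c * b) (fun a b => L a (R v b)).
Proof.
split=> [b x y|a x y|a c b] /=; first by rewrite LDl.
- by rewrite RDr LDr.
- by rewrite LM LRk -RM kunit_central.
Qed.

Lemma env_scaleE a b v : env_scale (env_tens a b) v = L a (R v b).
Proof. exact: tliftE. Qed.

Lemma env_scaleDl v : {morph env_scale^~ v : x y / x + y}.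
Proof. exact: tliftD. Qed.

Lemma env_scaleDr : right_distributive env_scale +%R.
Proof.
move=> x v w; rewrite /env_scale -tlift_sumf.
by apply: eq_tlift => a b; rewrite RDl LDr.
Qed.

Lemma env_scaleA x y v : env_scale x (env_scale y v) = env_scale (x * y) v.
Proof.
elim/tensor_ind: x => [a b|u w IHu IHw]; last by rewrite mulrDl !env_scaleDl IHu IHw.
elim/tensor_ind: y => [c d|u w IHu IHw]; last first.
  by rewrite mulrDr !env_scaleDl env_scaleDr IHu IHw.
by rewrite -!/(env_tens _ _) env_tens_mul !env_scaleE LM RM -LR.
Qed.

Lemma env_scale1 : left_id 1 env_scale.
Proof. by move=> v; rewrite [LHS]env_scaleE L1 R1. Qed.

End Build.

(* Bimodules with symmetric $k$-action are left $A^e$-modules: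
   $(a \otimes b) m = a m b$. *)
Definition lact (M : lmodType (Aenv A)) (a : A) (m : M) : M := env_tens a 1 *: m.
Definition ract (M : lmodType (Aenv A)) (m : M) (a : A) : M := env_tens 1 a *: m.
Arguments lact {M} a m.
Arguments ract {M} m a.

Section Theory.
Variable M : lmodType (Aenv A).
Implicit Types (m : M) (a b : A).

Lemma env_tensE a b m : env_tens a b *: m = lact a (ract m b).
Proof. by rewrite /lact /ract scalerA env_tens_mul !mulr1. Qed.
Lemma lactDr a : {morph lact a : m m' / m + m' :> M}. Proof. exact: scalerDr. Qed.
Lemma lactDl m : {morph lact^~ m : a b / a + b}.
Proof. by move=> a b; rewrite /lact env_tensDl scalerDl. Qed.
Lemma lact1 m : lact 1 m = m. Proof. exact: scale1r. Qed.
Lemma lactM a b m : lact (a * b) m = lact a (lact b m).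
Proof. by rewrite /lact scalerA env_tens_mul mulr1. Qed.
Lemma ractDl a : {morph (@ract M)^~ a : m m' / m + m'}.
Proof. exact: scalerDr. Qed.
Lemma ractDr m : {morph ract m : a b / a + b}.
Proof. by move=> a b; rewrite /ract env_tensDr scalerDl. Qed.
Lemma ract1 m : ract m 1 = m. Proof. exact: scale1r. Qed.
Lemma ractM a b m : ract m (a * b) = ract (ract m a) b.
Proof. by rewrite /ract scalerA env_tens_mul mulr1. Qed.
Lemma lact_ract a m b : lact a (ract m b) = ract (lact a m) b.
Proof. by rewrite /lact /ract !scalerA !env_tens_mul !mulr1 !mul1r. Qed.
Lemma lact_kunit c m : lact (kunit A c) m = ract m (kunit A c).
Proof.
by rewrite /lact /ract -[kunit A c in LHS]mul1r env_tens_bal mulr1.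
Qed.

(* restriction of scalars along $A \to A^e$ and $A^{op} \to A^e$ *)
Definition lmodule_of : Type := M.
HB.instance Definition _ := GRing.Zmodule.on lmodule_of.
HB.instance Definition _ := GRing.Zmodule_isLmodule.Build A lmodule_of
  (fun a b m => esym (lactM a b m)) lact1 lactDr lactDl.

Definition rmodule_of : Type := M.
HB.instance Definition _ := GRing.Zmodule.on rmodule_of.
HB.instance Definition _ := GRing.Zmodule_isLmodule.Build (A : pzRingType)^c rmodule_of
  (fun a b m => esym (ractM b a m)) ract1 ractDl ractDr.
End Theory.

(* $M \otimes_A N$, with outer actions $a (m \otimes n) b = a m \otimes n b$ *)
Section TensorA.
Variables M N : lmodType (Aenv A).

Definition tensorA : Type := tensor (@ract M) (@lact N).
HB.instance Definition _ := GRing.Zmodule.on tensorA.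

Definition tensA (m : M) (n : N) : tensorA := tens m n.

Lemma tensADl n : {morph tensA^~ n : m m' / m + m'}. Proof. exact: tensDl. Qed.
Lemma tensADr m : {morph tensA m : n n' / n + n'}. Proof. exact: tensDr. Qed.
Lemma tensA_bal m a n : tensA (ract m a) n = tensA m (lact a n).
Proof. exact: tens_bal. Qed.

Let L (a : A) (x : tensorA) : tensorA := tlift (fun m n => tensA (lact a m) n) x.
Let R (x : tensorA) (a : A) : tensorA := tlift (fun m n => tensA m (ract n a)) x.

Let L_bal a : balanced (@ract M) (@lact N) (fun m n => tensA (lact a m) n).
Proof.
split=> [n x y|m x y|m b n] /=; first by rewrite lactDr tensADl.
- by rewrite tensADr.
- by rewrite lact_ract tensA_bal.
Qed.
Let R_bal a : balanced (@ract M) (@lact N) (fun m n => tensA m (ract n a)).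
Proof.
split=> [n x y|m x y|m b n] /=; first by rewrite tensADl.
- by rewrite ractDl tensADr.
- by rewrite tensA_bal lact_ract.
Qed.
Let LE a m n : L a (tensA m n) = tensA (lact a m) n. Proof. exact: tliftE. Qed.
Let RE m n a : R (tensA m n) a = tensA m (ract n a). Proof. exact: tliftE. Qed.
Let LDr a : {morph L a : v w / v + w}. Proof. exact: tliftD. Qed.
Let RDl a : {morph R^~ a : v w / v + w}. Proof. exact: tliftD. Qed.
Let LDl x : {morph L^~ x : a b / a + b}.
Proof.
by move=> a b; rewrite /L -tlift_sumf; apply: eq_tlift => m n; rewrite lactDl tensADl.
Qed.
Let RDr x : {morph R x : a b / a + b}.
Proof.
by move=> a b; rewrite /R -tlift_sumf; apply: eq_tlift => m n; rewrite ractDr tensADr.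
Qed.
Let L1 x : L 1 x = x.
Proof. by rewrite -[RHS]tlift_tens; apply: eq_tlift => m n; rewrite lact1. Qed.
Let R1 x : R x 1 = x.
Proof. by rewrite -[RHS]tlift_tens; apply: eq_tlift => m n; rewrite ract1. Qed.
Let LM a b x : L (a * b) x = L a (L b x).
Proof.
elim/tensor_ind: x => [m n|u v IHu IHv]; last by rewrite !LDr IHu IHv.
by rewrite -!/(tensA _ _) !LE lactM.
Qed.
Let RM a b x : R x (a * b) = R (R x a) b.
Proof.
elim/tensor_ind: x => [m n|u v IHu IHv]; last by rewrite !RDl IHu IHv.
by rewrite -!/(tensA _ _) !RE ractM.
Qed.
Let LR a x b : L a (R x b) = R (L a x) b.
Proof.
elim/tensor_ind: x => [m n|u v IHu IHv]; last by rewrite !(RDl, LDr) IHu IHv.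
by rewrite -!/(tensA _ _) !(RE, LE).
Qed.
Let LRk c x : L (kunit A c) x = R x (kunit A c).
Proof.
elim/tensor_ind: x => [m n|u v IHu IHv]; last by rewrite !(RDl, LDr) IHu IHv.
by rewrite -!/(tensA _ _) !(RE, LE) lact_kunit tensA_bal lact_kunit.
Qed.

HB.instance Definition _ := GRing.Zmodule_isLmodule.Build (Aenv A) tensorA
  (env_scaleA LDr LDl LM RDl RDr RM LR LRk) (env_scale1 LDr LDl L1 LM RDr R1 RM LRk)
  (env_scaleDr LDr RDl) (env_scaleDl LDr LDl LM RDr RM LRk).

Lemma lact_tensA a m n : lact a (tensA m n) = tensA (lact a m) n.
Proof.
by rewrite [LHS](env_scaleE LDr LDl LM RDr RM LRk) R1 LE.
Qed.

Lemma ract_tensA m n a : ract (tensA m n) a = tensA m (ract n a).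
Proof.
by rewrite [LHS](env_scaleE LDr LDl LM RDr RM LRk) L1 RE.
Qed.

Lemma lact_tensorA a (x : tensorA) : lact a x = tlift (fun m n => tensA (lact a m) n) x.
Proof.
by rewrite [LHS](env_scaleE LDr LDl LM RDr RM LRk) R1.
Qed.

Lemma ract_tensorA a (x : tensorA) : ract x a = tlift (fun m n => tensA m (ract n a)) x.
Proof.
by rewrite [LHS](env_scaleE LDr LDl LM RDr RM LRk) L1.
Qed.

Lemma tensorA_ind (P : tensorA -> Prop) :
  (forall m n, P (tensA m n)) -> (forall x y, P x -> P y -> P (x + y)) ->
  forall x, P x.
Proof. exact: tensor_ind. Qed.

Lemma tensA_ext (G : zmodType) (f g : tensorA -> G) :
  {morph f : x y / x + y} -> {morph g : x y / x + y} ->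
  (forall m n, f (tensA m n) = g (tensA m n)) -> f =1 g.
Proof. exact: tens_ext. Qed.

Lemma tliftAE (G : zmodType) (f : M -> N -> G) m n :
  balanced (@ract M) (@lact N) f -> tlift f (tensA m n) = f m n.
Proof. exact: tliftE. Qed.

Lemma tliftAD (G : zmodType) (f : M -> N -> G) :
  balanced (@ract M) (@lact N) f ->
  {morph (fun x : tensorA => tlift f x) : x y / x + y}.
Proof. exact: tliftD. Qed.

Lemma tliftA_lift (S : Type) (M' N' G : zmodType) (r : M' -> S -> M')
    (l : S -> N' -> N') (f : M -> N -> G) (g : M' -> N' -> tensorA) (x : tensor r l) :
  balanced (@ract M) (@lact N) f ->
  tlift f (tlift g x) = tlift (fun m n => tlift f (g m n)) x.
Proof. by move=> fb; rewrite (morph_tlift _ _ (tliftAD fb)). Qed.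

Lemma tliftA_tens (S : Type) (M' N' G : zmodType) (r : M' -> S -> M')
    (l : S -> N' -> N') (f : M -> N -> G) (g : M' -> N' -> M) (h : M' -> N' -> N)
    (x : tensor r l) :
  balanced (@ract M) (@lact N) f ->
  tlift f (tlift (fun m n => tensA (g m n) (h m n)) x)
  = tlift (fun m n => f (g m n) (h m n)) x.
Proof.
by move=> fb; rewrite tliftA_lift //; apply: eq_tlift => m n; rewrite tliftAE.
Qed.

End TensorA.

Definition regular_bimod : Type := A.
HB.instance Definition _ := GRing.Zmodule.on regular_bimod.

Section Regular.
Let L (a : A) (x : regular_bimod) : regular_bimod := (a * x : A).
Let R (x : regular_bimod) (a : A) : regular_bimod := (x * a : A).
Let LDr a : {morph L a : v w / v + w}. Proof. by move=> v w; exact: mulrDr. Qed.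
Let RDl a : {morph R^~ a : v w / v + w}. Proof. by move=> v w; exact: mulrDl. Qed.
Let LDl x : {morph L^~ x : a b / a + b}. Proof. by move=> v w; exact: mulrDl. Qed.
Let RDr x : {morph R x : a b / a + b}. Proof. by move=> v w; exact: mulrDr. Qed.
Let L1 x : L 1 x = x. Proof. exact: mul1r. Qed.
Let R1 x : R x 1 = x. Proof. exact: mulr1. Qed.
Let LM a b x : L (a * b) x = L a (L b x). Proof. exact/esym/mulrA. Qed.
Let RM a b x : R x (a * b) = R (R x a) b. Proof. exact/mulrA. Qed.
Let LR a x b : L a (R x b) = R (L a x) b. Proof. exact/mulrA. Qed.
Let LRk c x : L (kunit A c) x = R x (kunit A c). Proof. exact: kunit_central. Qed.

HB.instance Definition _ := GRing.Zmodule_isLmodule.Build (Aenv A) regular_bimod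
  (env_scaleA LDr LDl LM RDl RDr RM LR LRk) (env_scale1 LDr LDl L1 LM RDr R1 RM LRk)
  (env_scaleDr LDr RDl) (env_scaleDl LDr LDl LM RDr RM LRk).

Lemma lact_regular a (x : regular_bimod) : lact a x = (a * x : A).
Proof. by rewrite [LHS](env_scaleE LDr LDl LM RDr RM LRk) R1. Qed.
Lemma ract_regular (x : regular_bimod) a : ract x a = (x * a : A).
Proof. by rewrite [LHS](env_scaleE LDr LDl LM RDr RM LRk) L1. Qed.
End Regular.

End Bimodule.

Arguments lact {k A M} a m.
Arguments ract {k A M} m a.
Arguments tensorA {k A} M N.
Arguments tensA {k A M N} m n.

Record Ae_ring (k : comPzRingType) (A : kalgebra k) := AeRing {
  aer_alg :> kalgebra k;
  aer_eta : {rmorphism Aenv A -> aer_alg};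
  aer_eta_unit : forall c, aer_eta (kunit (Aenv A) c) = kunit aer_alg c }.

Section AeRing.
Variables (k : comPzRingType) (A : kalgebra k) (U : Ae_ring A).

Definition src (a : A) : U := aer_eta U (env_tens a 1).
Definition tgt (a : A) : U := aer_eta U (env_tens 1 a).

Lemma srcD : {morph src : a b / a + b}.
Proof. by move=> a b; rewrite /src env_tensDl rmorphD. Qed.
Lemma tgtD : {morph tgt : a b / a + b}.
Proof. by move=> a b; rewrite /tgt env_tensDr rmorphD. Qed.
Lemma src1 : src 1 = 1. Proof. exact: rmorph1. Qed.
Lemma tgt1 : tgt 1 = 1. Proof. exact: rmorph1. Qed.
Lemma srcM a b : src (a * b) = src a * src b.
Proof. by rewrite /src -rmorphM env_tens_mul mulr1. Qed.
Lemma tgtM a b : tgt (a * b) = tgt b * tgt a.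
Proof. by rewrite /tgt -rmorphM env_tens_mul mulr1. Qed.
Lemma src_tgt a b : src a * tgt b = tgt b * src a.
Proof. by rewrite /tgt /src -!rmorphM !env_tens_mul !mulr1 !mul1r. Qed.

(* ${}_\triangleright U_\triangleleft$: [lact a u = src a * u], [ract u a = tgt a * u] *)
Definition tri : Type := U.
HB.instance Definition _ := GRing.PzRing.on tri.
Definition tri_scale (x : Aenv A) (u : tri) : tri := (aer_eta U x : tri) * u.
Lemma tri_scaleA x y u : tri_scale x (tri_scale y u) = tri_scale (x * y) u.
Proof. by rewrite /tri_scale rmorphM; exact: mulrA. Qed.
Lemma tri_scale1 : left_id 1 tri_scale.
Proof. by move=> u; rewrite /tri_scale rmorph1 mul1r. Qed.
Lemma tri_scaleDr : right_distributive tri_scale +%R.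
Proof. by move=> x u v; exact: mulrDr. Qed.
Lemma tri_scaleDl u : {morph tri_scale^~ u : x y / x + y}.
Proof. by move=> x y; rewrite /tri_scale rmorphD mulrDl. Qed.
HB.instance Definition _ := GRing.Zmodule_isLmodule.Build (Aenv A) tri
  tri_scaleA tri_scale1 tri_scaleDr tri_scaleDl.

Lemma lact_tri a (u : tri) : lact a u = (src a : tri) * u. Proof. by []. Qed.
Lemma ract_tri a (u : tri) : ract u a = (tgt a : tri) * u. Proof. by []. Qed.

(* For $x$ in the Takeuchi product, [fact_mul x y] does not depend on the chosen
   representative of $y$, see [fact_mulE]; it never depends on that of $x$. *)
Definition takeuchi (x : tensorA tri tri) : Prop :=
  forall a, tlift (fun u v : tri => tensA (u * tgt a) v) x
          = tlift (fun u v : tri => tensA u (v * src a)) x.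

Definition fact_mul (x y : tensorA tri tri) : tensorA tri tri :=
  tlift (fun u v : tri => tlift (fun u' v' : tri => tensA (u * u') (v * v')) y) x.

Lemma mulr_bal (p q : tri) : balanced (@ract k A tri) (@lact k A tri)
  (fun u v : tri => tensA (u * p) (v * q)).
Proof.
split=> [v x y|u x y|u a v] /=; first by rewrite mulrDl tensADl.
- by rewrite mulrDl tensADr.
- by rewrite ract_tri lact_tri -!mulrA -ract_tri -lact_tri tensA_bal.
Qed.

Lemma fact_mulE (x : tensorA tri tri) (b : seq (tri * tri)) : takeuchi x ->
  fact_mul x (fsum b) =
  \sum_(q <- b) tlift (fun u v : tri => tensA (u * q.1) (v * q.2)) x.
Proof.
move=> xT; rewrite /fact_mul [LHS]tlift_exch tlift_fsum //.
split=> [v' u' w'|u' v' w'|u' a v'] /=.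
- by rewrite -tlift_sumf; apply: eq_tlift => u v; rewrite mulrDr tensADl.
- by rewrite -tlift_sumf; apply: eq_tlift => u v; rewrite mulrDr tensADr.
- pose h : tensorA tri tri -> _ := tlift (fun u v : tri => tensA (u * u') (v * v')).
  have hE u v : h (tensA u v) = tensA (u * u') (v * v') by exact/tliftE/mulr_bal.
  have hD : {morph h : x y / x + y} by exact/tliftD/mulr_bal.
  have := congr1 h (xT a); rewrite !morph_tlift // => hx.
  transitivity (tlift (fun u v : tri => h (tensA (u * tgt a) v)) x).
    by apply: eq_tlift => u v; rewrite hE ract_tri mulrA.
  by rewrite hx; apply: eq_tlift => u v; rewrite hE lact_tri mulrA.
Qed.

End AeRing.

Arguments src {k A U} a.
Arguments tgt {k A U} a.
Arguments tri {k A} U.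

(* Linearity of [Delta] and [eps] over $A^e$ is the bimodule condition; it contains
   $k$-linearity. *)
Record left_bialgebroid (k : comPzRingType) (A : kalgebra k) := LeftBialgebroid {
  lb_ring :> Ae_ring A;
  Delta : {linear tri lb_ring -> tensorA (tri lb_ring) (tri lb_ring)};
  eps : {linear tri lb_ring -> regular_bimod A};
  Delta_coassoc : forall w,
    tlift (fun u v => tensA (Delta u) v) (Delta w) =
    tlift (fun u v => tlift (fun v1 v2 => tensA (tensA u v1) v2) (Delta v)) (Delta w);
  eps_counitl : forall w, tlift (fun u v => lact (eps u) v) (Delta w) = w;
  eps_counitr : forall w, tlift (fun u v => ract u (eps v)) (Delta w) = w;
  Delta_takeuchi : forall w, takeuchi (Delta w);
  Delta1 : Delta 1 = tensA (1 : tri lb_ring) (1 : tri lb_ring);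
  DeltaM : forall u v, Delta (u * v) = fact_mul (Delta u) (Delta v);
  eps1 : eps 1 = (1 : A);
  eps_src : forall u v, eps (u * v) = eps (u * src (eps v));
  eps_tgt : forall u v, eps (u * v) = eps (u * tgt (eps v)) }.

Arguments Delta {k A} l.
Arguments eps {k A} l.

Section BimoduleMaps.
Variables (k : comPzRingType) (A : kalgebra k).
Implicit Types M N P : lmodType (Aenv A).

Definition bimod_map M N (f : M -> N) : Prop :=
  [/\ {morph f : x y / x + y}, forall a m, f (lact a m) = lact a (f m) &
      forall m a, f (ract m a) = ract (f m) a].

Definition tmap M N M' N' (f : M -> M') (g : N -> N') (x : tensorA M N) :
  tensorA M' N' := tlift (fun m n => tensA (f m) (g n)) x.

Definition assocA M N P (x : tensorA (tensorA M N) P) : tensorA M (tensorA N P) :=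
  tlift (fun y p => tlift (fun m n => tensA m (tensA n p)) y) x.

Definition assocV M N P (x : tensorA M (tensorA N P)) : tensorA (tensorA M N) P :=
  tlift (fun m y => tlift (fun n p => tensA (tensA m n) p) y) x.

Definition lunitA M (x : tensorA (regular_bimod A) M) : M :=
  tlift (fun a m => lact (a : A) m) x.

Definition lunitV M (m : M) : tensorA (regular_bimod A) M :=
  tensA ((1 : A) : regular_bimod A) m.

Definition runitA M (x : tensorA M (regular_bimod A)) : M :=
  tlift (fun m a => ract m (a : A)) x.

Definition runitV M (m : M) : tensorA M (regular_bimod A) :=
  tensA m ((1 : A) : regular_bimod A).

Lemma tmap_bal M N M' N' (f : M -> M') (g : N -> N') : bimod_map f -> bimod_map g ->
  balanced (@ract _ _ M) (@lact _ _ N) (fun m n => tensA (f m) (g n)).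
Proof.
case=> fD fl fr [gD gl gr]; split=> [n x y|m x y|m a n] /=.
- by rewrite fD tensADl.
- by rewrite gD tensADr.
- by rewrite fr gl tensA_bal.
Qed.

Lemma tmapE M N M' N' (f : M -> M') (g : N -> N') m n : bimod_map f -> bimod_map g ->
  tmap f g (tensA m n) = tensA (f m) (g n).
Proof. by move=> fb gb; exact/tliftE/tmap_bal. Qed.

Lemma tmap_bimod M N M' N' (f : M -> M') (g : N -> N') :
  bimod_map f -> bimod_map g -> bimod_map (tmap f g).
Proof.
move=> fb gb; have tD : {morph tmap f g : x y / x + y} by exact/tliftD/tmap_bal.
split=> // [a x|x a].
  elim/tensorA_ind: x => [m n|u v IHu IHv].
    by rewrite lact_tensA !tmapE // lact_tensA; case: fb => _ ->.
  by rewrite lactDr !tD IHu IHv lactDr.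
elim/tensorA_ind: x => [m n|u v IHu IHv].
  by rewrite ract_tensA !tmapE // ract_tensA; case: gb => _ _ ->.
by rewrite ractDl !tD IHu IHv ractDl.
Qed.

Lemma assocA_bal1 M N P (p : P) : balanced (@ract _ _ M) (@lact _ _ N)
  (fun m n => tensA m (tensA n p)).
Proof.
split=> [n x y|m x y|m a n] /=; first by rewrite tensADl.
- by rewrite tensADl tensADr.
- by rewrite tensA_bal lact_tensA.
Qed.

Lemma assocA_bal M N P : balanced (@ract _ _ (tensorA M N)) (@lact _ _ P)
  (fun y p => tlift (fun m n => tensA m (tensA n p)) y).
Proof.
have D := fun p => tliftD (@assocA_bal1 M N P p).
have E := fun (p : P) m n => tliftE m n (@assocA_bal1 M N P p).
split=> [p x y|y p q|y a p] /=; first exact: D.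
- by rewrite -tlift_sumf; apply: eq_tlift => m n; rewrite !tensADr.
- elim/tensorA_ind: y => [m n|u v IHu IHv]; last by rewrite ractDl !D IHu IHv.
  by rewrite ract_tensA !E tensA_bal.
Qed.

Lemma assocAE M N P (m : M) (n : N) (p : P) :
  assocA (tensA (tensA m n) p) = tensA m (tensA n p).
Proof.
rewrite /assocA tliftE ?tliftE //; [exact: assocA_bal1 | exact: assocA_bal].
Qed.

Lemma assocAD M N P : {morph @assocA M N P : x y / x + y}.
Proof. exact/tliftD/assocA_bal. Qed.

Lemma assocV_bal1 M N P (m : M) : balanced (@ract _ _ N) (@lact _ _ P)
  (fun n p => tensA (tensA m n) p).
Proof.
split=> [n x y|m' x y|m' a n] /=; first by rewrite tensADr tensADl.
- by rewrite tensADr.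
- by rewrite -tensA_bal ract_tensA.
Qed.

Lemma assocV_bal M N P : balanced (@ract _ _ M) (@lact _ _ (tensorA N P))
  (fun m y => tlift (fun n p => tensA (tensA m n) p) y).
Proof.
have D := fun m : M => tliftD (@assocV_bal1 M N P m).
have E := fun (m : M) n p => tliftE n p (@assocV_bal1 M N P m).
split=> [y m m'|m x y|m a y] /=; last 2 [exact: D].
- by rewrite -tlift_sumf; apply: eq_tlift => n p; rewrite !tensADl.
- elim/tensorA_ind: y => [n p|u v IHu IHv]; last by rewrite lactDr !D IHu IHv.
  by rewrite lact_tensA !E tensA_bal.
Qed.

Lemma assocVE M N P (m : M) (n : N) (p : P) :
  assocV (tensA m (tensA n p)) = tensA (tensA m n) p.
Proof.
rewrite /assocV tliftE ?tliftE //; [exact: assocV_bal1 | exact: assocV_bal].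
Qed.

Lemma assocVD M N P : {morph @assocV M N P : x y / x + y}.
Proof. exact/tliftD/assocV_bal. Qed.

Lemma tensA3l_ext M N P (G : zmodType) (f g : tensorA (tensorA M N) P -> G) :
  {morph f : x y / x + y} -> {morph g : x y / x + y} ->
  (forall m n p, f (tensA (tensA m n) p) = g (tensA (tensA m n) p)) -> f =1 g.
Proof.
move=> fD gD fg; apply: tensA_ext => // x p.
elim/tensorA_ind: x => [m n|u v IHu IHv]; first exact: fg.
by rewrite tensADl fD gD IHu IHv.
Qed.

Lemma tensA3r_ext M N P (G : zmodType) (f g : tensorA M (tensorA N P) -> G) :
  {morph f : x y / x + y} -> {morph g : x y / x + y} ->
  (forall m n p, f (tensA m (tensA n p)) = g (tensA m (tensA n p))) -> f =1 g.
Proof.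
move=> fD gD fg; apply: tensA_ext => // m x.
elim/tensorA_ind: x => [n p|u v IHu IHv]; first exact: fg.
by rewrite tensADr fD gD IHu IHv.
Qed.

Lemma tensA4l_ext M N P Q (G : zmodType) (f g : tensorA (tensorA (tensorA M N) P) Q -> G) :
  {morph f : x y / x + y} -> {morph g : x y / x + y} ->
  (forall m n p q, f (tensA (tensA (tensA m n) p) q) =
                   g (tensA (tensA (tensA m n) p) q)) -> f =1 g.
Proof.
move=> fD gD fg; apply: tensA3l_ext => // x p q.
elim/tensorA_ind: x => [m n|u v IHu IHv]; first exact: fg.
by rewrite !tensADl fD gD IHu IHv.
Qed.

Lemma assocA_bimod M N P : bimod_map (@assocA M N P).
Proof.
have aD := @assocAD M N P; split=> // [a x|x a].
  move: x; apply: tensA3l_ext => [x y|x y|m n p] /=.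
  - by rewrite lactDr aD.
  - by rewrite aD lactDr.
  - by rewrite !(lact_tensA, assocAE).
move: x; apply: tensA3l_ext => [x y|x y|m n p] /=.
- by rewrite ractDl aD.
- by rewrite aD ractDl.
- by rewrite !(ract_tensA, assocAE).
Qed.

Lemma assocV_bimod M N P : bimod_map (@assocV M N P).
Proof.
have aD := @assocVD M N P; split=> // [a x|x a].
  move: x; apply: tensA3r_ext => [x y|x y|m n p] /=.
  - by rewrite lactDr aD.
  - by rewrite aD lactDr.
  - by rewrite !(lact_tensA, assocVE).
move: x; apply: tensA3r_ext => [x y|x y|m n p] /=.
- by rewrite ractDl aD.
- by rewrite aD ractDl.
- by rewrite !(ract_tensA, assocVE).
Qed.

Lemma assocAK M N P : cancel (@assocA M N P) (@assocV M N P).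
Proof.
have aD := @assocAD M N P; have vD := @assocVD M N P.
move=> x; elim/tensorA_ind: x => [y p|u v IHu IHv]; last first.
  by rewrite aD vD IHu IHv.
elim/tensorA_ind: y => [m n|u v IHu IHv]; first by rewrite assocAE assocVE.
by rewrite tensADl aD vD IHu IHv.
Qed.

Lemma assocVK M N P : cancel (@assocV M N P) (@assocA M N P).
Proof.
have aD := @assocAD M N P; have vD := @assocVD M N P.
move=> x; elim/tensorA_ind: x => [m y|u v IHu IHv]; last first.
  by rewrite vD aD IHu IHv.
elim/tensorA_ind: y => [n p|u v IHu IHv]; first by rewrite assocVE assocAE.
by rewrite tensADr vD aD IHu IHv.
Qed.

Lemma lunitA_bal M : balanced (@ract _ _ (regular_bimod A)) (@lact _ _ M)
  (fun a m => lact (a : A) m).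
Proof.
split=> [m a b|a m n|a b m] /=; first exact: lactDl.
- exact: lactDr.
- by rewrite ract_regular lactM.
Qed.

Lemma lunitAE M (a : A) (m : M) : lunitA (tensA (a : regular_bimod A) m) = lact a m.
Proof. exact: (tliftE _ _ (lunitA_bal M)). Qed.

Lemma lunitAD M : {morph @lunitA M : x y / x + y}.
Proof. exact/tliftD/lunitA_bal. Qed.

Lemma lunitA_bimod M : bimod_map (@lunitA M).
Proof.
have aD := @lunitAD M; split=> // [a x|x a].
  move: x; apply: tensA_ext => [x y|x y|b m] /=.
  - by rewrite lactDr aD.
  - by rewrite aD lactDr.
  - by rewrite lact_tensA !lunitAE lact_regular lactM.
move: x; apply: tensA_ext => [x y|x y|b m] /=.
- by rewrite ractDl aD.
- by rewrite aD ractDl.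
- by rewrite ract_tensA !lunitAE lact_ract.
Qed.

Lemma lunitV_bimod M : bimod_map (@lunitV M).
Proof.
split=> [m n|a m|m a]; first exact: tensADr.
- by rewrite /lunitV lact_tensA -tensA_bal ract_regular lact_regular mul1r mulr1.
- by rewrite /lunitV ract_tensA.
Qed.

Lemma lunitVK M : cancel (@lunitV M) (@lunitA M).
Proof. by move=> m; rewrite [LHS]lunitAE lact1. Qed.

Lemma lunitAK M : cancel (@lunitA M) (@lunitV M).
Proof.
move=> x; elim/tensorA_ind: x => [a m|u v IHu IHv]; last first.
  by rewrite lunitAD /lunitV tensADr -!/(lunitV _) IHu IHv.
by rewrite lunitAE /lunitV -tensA_bal ract_regular mul1r.
Qed.

Lemma runitA_bal M : balanced (@ract _ _ M) (@lact _ _ (regular_bimod A))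
  (fun m a => ract m (a : A)).
Proof.
split=> [a m n|m a b|m a b] /=; first exact: ractDl.
- exact: ractDr.
- by rewrite lact_regular ractM.
Qed.

Lemma runitAE M (a : A) (m : M) : runitA (tensA m (a : regular_bimod A)) = ract m a.
Proof. exact: (tliftE _ _ (runitA_bal M)). Qed.

Lemma runitAD M : {morph @runitA M : x y / x + y}.
Proof. exact/tliftD/runitA_bal. Qed.

Lemma runitA_bimod M : bimod_map (@runitA M).
Proof.
have aD := @runitAD M; split=> // [a x|x a].
  move: x; apply: tensA_ext => [x y|x y|m b] /=.
  - by rewrite lactDr aD.
  - by rewrite aD lactDr.
  - by rewrite lact_tensA !runitAE lact_ract.
move: x; apply: tensA_ext => [x y|x y|m b] /=.
- by rewrite ractDl aD.
- by rewrite aD ractDl.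
- by rewrite ract_tensA !runitAE ract_regular ractM.
Qed.

Lemma runitV_bimod M : bimod_map (@runitV M).
Proof.
split=> [m n|a m|m a]; first exact: tensADl.
- by rewrite /runitV lact_tensA.
- by rewrite /runitV ract_tensA tensA_bal ract_regular lact_regular mul1r mulr1.
Qed.

Lemma runitVK M : cancel (@runitV M) (@runitA M).
Proof. by move=> m; rewrite [LHS]runitAE ract1. Qed.

Lemma runitAK M : cancel (@runitA M) (@runitV M).
Proof.
move=> x; elim/tensorA_ind: x => [m a|u v IHu IHv]; last first.
  by rewrite runitAD /runitV tensADl -!/(runitV _) IHu IHv.
by rewrite runitAE /runitV tensA_bal lact_regular mulr1.
Qed.

Lemma bimod_id M : bimod_map (@id M).
Proof. by []. Qed.

Lemma tmap_id M N (x : tensorA M N) : tmap id id x = x.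
Proof. exact: tlift_tens. Qed.

Lemma tmap_comp M N M' N' M'' N'' (f' : M' -> M'') (f : M -> M') (g' : N' -> N'')
    (g : N -> N') (x : tensorA M N) :
  bimod_map f -> bimod_map f' -> bimod_map g -> bimod_map g' ->
  tmap (f' \o f) (g' \o g) x = tmap f' g' (tmap f g x).
Proof.
by move=> fb fb' gb gb'; rewrite /tmap tliftA_tens //; exact: tmap_bal.
Qed.

Lemma assocA_nat M N P M' N' P' (f : M -> M') (g : N -> N') (h : P -> P') x :
  bimod_map f -> bimod_map g -> bimod_map h ->
  assocA (tmap (tmap f g) h x) = tmap f (tmap g h) (assocA x).
Proof.
move=> fb gb hb; have fgb := tmap_bimod fb gb; have ghb := tmap_bimod gb hb.
have aD := @assocAD M N P; have aD' := @assocAD M' N' P'.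
have [lD _ _] := tmap_bimod fgb hb; have [rD _ _] := tmap_bimod fb ghb.
elim/tensorA_ind: x => [x p|x y IHx IHy]; last by rewrite lD aD' aD rD IHx IHy.
elim/tensorA_ind: x => [m n|x y IHx IHy]; last first.
  by rewrite tensADl lD aD' aD rD IHx IHy.
by rewrite !(tmapE, assocAE).
Qed.

Lemma lunitA_nat M N (f : M -> N) x : bimod_map f ->
  lunitA (tmap id f x) = f (lunitA x).
Proof.
move=> fb; have ib := bimod_id (regular_bimod A).
have [tD _ _] := tmap_bimod ib fb; have lM := @lunitAD M; have lN := @lunitAD N.
case: (fb) => fD fl _.
elim/tensorA_ind: x => [a m|x y IHx IHy]; last by rewrite tD lN lM fD IHx IHy.
by rewrite tmapE // !lunitAE fl.
Qed.

Lemma runitA_nat M N (f : M -> N) x : bimod_map f ->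
  runitA (tmap f id x) = f (runitA x).
Proof.
move=> fb; have ib := bimod_id (regular_bimod A).
have [tD _ _] := tmap_bimod fb ib; have lM := @runitAD M; have lN := @runitAD N.
case: (fb) => fD _ fr.
elim/tensorA_ind: x => [m a|x y IHx IHy]; last by rewrite tD lN lM fD IHx IHy.
by rewrite tmapE // !runitAE fr.
Qed.

Lemma assocA_pentagon M N P Q (x : tensorA (tensorA (tensorA M N) P) Q) :
  assocA (assocA x) = tmap id (@assocA N P Q) (assocA (tmap (@assocA M N P) id x)).
Proof.
have a1 := @assocA_bimod M N P; have a2 := @assocA_bimod N P Q.
have iQ := bimod_id Q; have iM := bimod_id M.
have [t1 _ _] := tmap_bimod a1 iQ; have [t2 _ _] := tmap_bimod iM a2.
have D1 := @assocAD (tensorA M N) P Q; have D2 := @assocAD M N (tensorA P Q).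
have D3 := @assocAD M (tensorA N P) Q; have D4 := @assocAD M N P.
elim/tensorA_ind: x => [x q|x y IHx IHy]; last first.
  by rewrite D1 D2 t1 D3 t2 IHx IHy.
elim/tensorA_ind: x => [x p|x y IHx IHy]; last first.
  by rewrite tensADl D1 D2 t1 D3 t2 IHx IHy.
elim/tensorA_ind: x => [m n|x y IHx IHy]; last first.
  by rewrite !tensADl D1 D2 t1 D3 t2 IHx IHy.
by rewrite !(tmapE, assocAE).
Qed.

Lemma assocA_triangle M N (x : tensorA (tensorA M (regular_bimod A)) N) :
  tmap id (@lunitA N) (assocA x) = tmap (@runitA M) id x.
Proof.
have iM := bimod_id M; have iN := bimod_id N.
have lb := @lunitA_bimod N; have rb := @runitA_bimod M.
have [t1 _ _] := tmap_bimod rb iN; have [t2 _ _] := tmap_bimod iM lb.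
have D1 := @assocAD M (regular_bimod A) N.
elim/tensorA_ind: x => [x p|x y IHx IHy]; last by rewrite D1 t1 t2 IHx IHy.
elim/tensorA_ind: x => [m a|x y IHx IHy]; last first.
  by rewrite tensADl D1 t1 t2 IHx IHy.
by rewrite !(tmapE, assocAE) // lunitAE runitAE tensA_bal.
Qed.

End BimoduleMaps.

Section BialgebroidTheory.
Variables (k : comPzRingType) (A : kalgebra k) (B : left_bialgebroid A).
Implicit Types (u v w : tri B) (a b : A).

Lemma Delta_lact a u : Delta B (lact a u) = lact a (Delta B u).
Proof. exact: linearZ. Qed.
Lemma Delta_ract u a : Delta B (ract u a) = ract (Delta B u) a.
Proof. exact: linearZ. Qed.
Lemma eps_lact a u : eps B (lact a u) = (a * (eps B u : A) : A).
Proof. by rewrite -lact_regular; exact: linearZ. Qed.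
Lemma eps_ract u a : eps B (ract u a) = ((eps B u : A) * a : A).
Proof. by rewrite -ract_regular; exact: linearZ. Qed.

Lemma src_lact a : (src a : tri B) = lact a (1 : tri B).
Proof. by rewrite lact_tri mulr1. Qed.
Lemma tgt_ract a : (tgt a : tri B) = ract (1 : tri B) a.
Proof. by rewrite ract_tri mulr1. Qed.

Lemma eps_s a : eps B (src a) = a.
Proof. by rewrite src_lact eps_lact eps1 mulr1. Qed.
Lemma eps_t a : eps B (tgt a) = a.
Proof. by rewrite tgt_ract eps_ract eps1 mul1r. Qed.
Lemma eps_mul_src u a : eps B (u * src a) = eps B (u * tgt a).
Proof. by rewrite [RHS]eps_src eps_t. Qed.

Lemma lact_mul a u v : lact a (u * v) = lact a u * v.
Proof. by rewrite !lact_tri mulrA. Qed.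
Lemma ract_mul u v a : ract (u * v) a = ract u a * v.
Proof. by rewrite !ract_tri mulrA. Qed.

Lemma DeltaM_pure u (b c : tri B) v : Delta B v = tensA b c ->
  Delta B (u * v) = tlift (fun u1 u2 : tri B => tensA (u1 * b) (u2 * c)) (Delta B u).
Proof.
move=> Dv; rewrite DeltaM Dv.
by rewrite [LHS](fact_mulE [:: (b, c)] (Delta_takeuchi u)) big_seq1.
Qed.

Lemma Delta_mul_src u a : Delta B (u * src a) =
  tlift (fun u1 u2 : tri B => tensA (u1 * src a) u2) (Delta B u).
Proof.
rewrite (@DeltaM_pure u (src a) 1); first by apply: eq_tlift => v w; rewrite mulr1.
by rewrite src_lact Delta_lact Delta1 lact_tensA.
Qed.

Lemma Delta_mul_tgt u a : Delta B (u * tgt a) =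
  tlift (fun u1 u2 : tri B => tensA u1 (u2 * tgt a)) (Delta B u).
Proof.
rewrite (@DeltaM_pure u 1 (tgt a)); first by apply: eq_tlift => v w; rewrite mulr1.
by rewrite tgt_ract Delta_ract Delta1 ract_tensA.
Qed.

Lemma Delta_takeuchiE (G : zmodType) (f : tri B -> tri B -> G) a w :
  balanced (@ract _ _ (tri B)) (@lact _ _ (tri B)) f ->
  tlift (fun u v : tri B => f (u * tgt a) v) (Delta B w) =
  tlift (fun u v : tri B => f u (v * src a)) (Delta B w).
Proof.
move=> fb; have := congr1 (fun x => tlift f x) (Delta_takeuchi w a).
by rewrite !tliftA_tens.
Qed.

Lemma Delta_mulE (G : zmodType) (f : tri B -> tri B -> G) w w' :
  balanced (@ract _ _ (tri B)) (@lact _ _ (tri B)) f ->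
  tlift f (Delta B (w * w')) =
  tlift (fun p q : tri B => tlift (fun u v : tri B => f (p * u) (q * v)) (Delta B w'))
    (Delta B w).
Proof.
move=> fb; rewrite DeltaM /fact_mul tliftA_lift //; apply: eq_tlift => p q.
exact: (tliftA_tens _ _ _ fb).
Qed.

Lemma Delta_mul_srcE (G : zmodType) (f : tri B -> tri B -> G) w a :
  balanced (@ract _ _ (tri B)) (@lact _ _ (tri B)) f ->
  tlift f (Delta B (w * src a)) = tlift (fun u v : tri B => f (u * src a) v) (Delta B w).
Proof. by move=> fb; rewrite Delta_mul_src tliftA_tens. Qed.

Lemma Delta_mul_tgtE (G : zmodType) (f : tri B -> tri B -> G) w a :
  balanced (@ract _ _ (tri B)) (@lact _ _ (tri B)) f ->
  tlift f (Delta B (w * tgt a)) = tlift (fun u v : tri B => f u (v * tgt a)) (Delta B w).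
Proof. by move=> fb; rewrite Delta_mul_tgt tliftA_tens. Qed.

Lemma ract_eps_bal0 : balanced (@ract _ _ (tri B)) (@lact _ _ (tri B))
  (fun u v => ract u (eps B v)).
Proof.
split=> [u v w|u v w|u b v] /=; first exact: ractDl.
- by rewrite raddfD ractDr.
- by rewrite eps_lact ractM.
Qed.

Lemma lact_eps_bal0 : balanced (@ract _ _ (tri B)) (@lact _ _ (tri B))
  (fun u v => lact (eps B u) v).
Proof.
split=> [u v w|u v w|u b v] /=; last by rewrite eps_ract lactM.
- by rewrite raddfD lactDl.
- exact: lactDr.
Qed.

End BialgebroidTheory.

Section RightComodule.
Variables (k : comPzRingType) (A : kalgebra k) (B : left_bialgebroid A).

(* A right comodule is a right $A$-module with a coaction; its left $A$-action is
   determined by the coaction. The whole $A^e$-module is taken as underlying object,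
   [rco_lact] forcing the left action to be the induced one, so that passing between
   left and right comodules can keep the $A^e$-module on the nose. On
   $M \otimes_A {}_\triangleright U$, [ract] is $(m \otimes u) a = m \otimes t(a) u$. *)
Record right_comodule_axioms (M : lmodType (Aenv A)) (rho : M -> tensorA M (tri B)) :
    Prop := RightComoduleAxioms {
  rco_add : {morph rho : x y / x + y};
  rco_ract : forall m a, rho (ract m a) = ract (rho m) a;
  rco_coassoc : forall m,
    tlift (fun m0 m1 => tensA (rho m0) m1) (rho m) =
    tlift (fun m0 m1 => tlift (fun u v => tensA (tensA m0 u) v) (Delta B m1)) (rho m);
  rco_counit : forall m, tlift (fun m0 m1 => ract m0 (eps B m1)) (rho m) = m;
  rco_lact : forall a m,
    lact a m = tlift (fun m0 (m1 : tri B) => ract m0 (eps B (m1 * tgt a))) (rho m) }.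

Section Theory.
Variables (M : lmodType (Aenv A)) (rho : M -> tensorA M (tri B)).
Hypothesis rhoP : right_comodule_axioms rho.

Section Coassoc.
Variables (G : zmodType) (F : M -> tri B -> tri B -> G).
Hypotheses (F12 : forall v, balanced (@ract _ _ M) (@lact _ _ (tri B)) (fun m u => F m u v))
  (F3 : forall m u, {morph F m u : v w / v + w})
  (F23 : forall m u a v, F m (ract u a) v = F m u (lact a v)).

Lemma rco_coassocE m :
  tlift (fun m0 m1 => tlift (fun m00 m01 => F m00 m01 m1) (rho m0)) (rho m) =
  tlift (fun m0 m1 => tlift (fun u v => F m0 u v) (Delta B m1)) (rho m).
Proof.
pose h (x : tensorA M (tri B)) (v : tri B) : G := tlift (fun m u => F m u v) x.
have hDl v : {morph h^~ v : x y / x + y} by exact/tliftD/F12.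
have hE m0 u v : h (tensA m0 u) v = F m0 u v by exact: (tliftE _ _ (F12 v)).
have hb : balanced (@ract _ _ (tensorA M (tri B))) (@lact _ _ (tri B)) h.
  split=> [|x v w|x a v] //; first by rewrite /h -tlift_sumf; apply: eq_tlift => m0 u; rewrite F3.
  elim/tensorA_ind: x => [m0 u|x y IHx IHy]; first by rewrite ract_tensA !hE F23.
  by rewrite ractDl !hDl IHx IHy.
pose g (x : tensorA (tensorA M (tri B)) (tri B)) : G := tlift h x.
have gD : {morph g : x y / x + y} by exact: tliftD.
have gE x v : g (tensA x v) = h x v by exact: (tliftE _ _ hb).
have := congr1 g (rco_coassoc rhoP m).
rewrite !morph_tlift // => H.
transitivity (tlift (fun m0 m1 => g (tensA (rho m0) m1)) (rho m)).
  by apply: eq_tlift => m0 m1; rewrite gE.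
rewrite H; apply: eq_tlift => m0 m1; rewrite morph_tlift //.
by apply: eq_tlift => u v; rewrite gE hE.
Qed.
End Coassoc.

Lemma ract_eps_bal (p : tri B) : balanced (@ract _ _ M) (@lact _ _ (tri B))
  (fun m0 (m1 : tri B) => ract m0 (eps B (m1 * p))).
Proof.
split=> [u m n|m u v|m a u] /=; first exact: ractDl.
- by rewrite mulrDl raddfD ractDr.
- by rewrite -ractM -lact_mul eps_lact.
Qed.

Lemma mul_bal2 (p : tri B) : balanced (@ract _ _ M) (@lact _ _ (tri B))
  (fun m0 (m1 : tri B) => tensA m0 (m1 * p)).
Proof.
split=> [u m n|m u v|m a u] /=; first exact: tensADl.
- by rewrite mulrDl tensADr.
- by rewrite -lact_mul tensA_bal.
Qed.

Lemma lact_bal1 (a : A) : balanced (@ract _ _ M) (@lact _ _ (tri B))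
  (fun m0 m1 => tensA (lact a m0) m1).
Proof.
split=> [u m n|m u v|m b u] /=; first by rewrite lactDr tensADl.
- by rewrite tensADr.
- by rewrite lact_ract tensA_bal.
Qed.


Lemma rco_rho_lact a m :
  rho (lact a m) = tlift (fun m0 (m1 : tri B) => tensA m0 (m1 * tgt a)) (rho m).
Proof.
have rhoD := rco_add rhoP.
pose F m0 (u v : tri B) := tensA (m0 : M) (ract u (eps B (v * tgt a))).
rewrite (rco_lact rhoP) morph_tlift //.
transitivity (tlift (fun m0 m1 => tlift (fun m00 m01 => F m00 m01 m1) (rho m0)) (rho m)).
  by apply: eq_tlift => m0 m1; rewrite rco_ract // ract_tensorA.
rewrite rco_coassocE /F => [|v|m0 u v w|m0 u b v].
- apply: eq_tlift => m0 m1; rewrite -(eps_counitr (m1 * tgt a)) Delta_mul_tgt.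
  rewrite -[LHS]morph_tlift; last exact: tensADr.
  by congr tensA; rewrite tliftA_tens //; exact: ract_eps_bal0.
- split=> [u m0 n|m0 u w|m0 b u] /=; first exact: tensADl.
  + by rewrite ractDl tensADr.
  + by rewrite tensA_bal lact_ract.
- by rewrite mulrDl raddfD ractDr tensADr.
- by rewrite -lact_mul eps_lact ractM.
Qed.

Lemma rco_takeuchi a m :
  tlift (fun m0 m1 => tensA (lact a m0) m1) (rho m) =
  tlift (fun m0 (m1 : tri B) => tensA m0 (m1 * src a)) (rho m).
Proof.
pose F m0 (u v : tri B) := tensA (ract (m0 : M) (eps B (u * tgt a))) v.
transitivity (tlift (fun m0 m1 => tlift (fun m00 m01 => F m00 m01 m1) (rho m0)) (rho m)).
  apply: eq_tlift => m0 m1; rewrite (rco_lact rhoP).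
  exact: (morph_tlift _ _ (tensADl m1)).
rewrite rco_coassocE /F => [|v|m0 u v w|m0 u b v].
- apply: eq_tlift => m0 m1; rewrite -(eps_counitl (m1 * src a)) Delta_mul_src.
  rewrite tliftA_tens; last exact: lact_eps_bal0.
  rewrite (morph_tlift _ _ (tensADr m0)).
  by apply: eq_tlift => u v; rewrite eps_mul_src tensA_bal.
- split=> [u m0 n|m0 u w|m0 b u] /=; first by rewrite ractDl tensADl.
  + by rewrite mulrDl raddfD ractDr tensADl.
  + by rewrite -lact_mul eps_lact ractM.
- exact: tensADr.
- by rewrite -ract_mul eps_ract ractM tensA_bal.
Qed.

Lemma rco_takeuchiE (G : zmodType) (f : M -> tri B -> G) a m :
  balanced (@ract _ _ M) (@lact _ _ (tri B)) f ->
  tlift (fun m0 m1 => f (lact a m0) m1) (rho m) =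
  tlift (fun m0 m1 => f m0 (m1 * src a)) (rho m).
Proof.
move=> fb; have := congr1 (tlift f) (rco_takeuchi a m).
rewrite !morph_tlift; try exact: tliftD.
move=> H; transitivity (tlift (fun m0 m1 => tlift f (tensA (lact a m0) m1)) (rho m)).
  by apply: eq_tlift => m0 m1; rewrite [RHS](tliftE _ _ fb).
by rewrite H; apply: eq_tlift => m0 m1; rewrite [LHS](tliftE _ _ fb).
Qed.

Lemma rco_rho_lactE (G : zmodType) (f : M -> tri B -> G) a m :
  balanced (@ract _ _ M) (@lact _ _ (tri B)) f ->
  tlift f (rho (lact a m)) = tlift (fun m0 m1 => f m0 (m1 * tgt a)) (rho m).
Proof.
move=> fb; rewrite rco_rho_lact morph_tlift; last exact: tliftD.
by apply: eq_tlift => m0 m1; rewrite [LHS](tliftE _ _ fb).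
Qed.

Lemma rco_rho_ractE (G : zmodType) (f : M -> tri B -> G) a m :
  balanced (@ract _ _ M) (@lact _ _ (tri B)) f ->
  tlift f (rho (ract m a)) = tlift (fun m0 m1 => f m0 (ract m1 a)) (rho m).
Proof.
move=> fb; rewrite rco_ract // ract_tensorA morph_tlift; last exact: tliftD.
by apply: eq_tlift => m0 m1; rewrite [LHS](tliftE _ _ fb).
Qed.

End Theory.

Record right_comodule := RightComodule {
  rcm_mod :> lmodType (Aenv A);
  rcoact : rcm_mod -> tensorA rcm_mod (tri B);
  rcm_ax : right_comodule_axioms rcoact }.

Arguments rcoact : clear implicits.

Definition is_rcomod_hom (M N : right_comodule) (f : M -> N) : Prop :=
  [/\ {morph f : x y / x + y}, forall m a, f (ract m a) = ract (f m) a &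
      forall m, rcoact N (f m) = tlift (fun m0 m1 => tensA (f m0) m1) (rcoact M m)].

Record rcomod_hom (M N : right_comodule) := RcomodHom {
  rch_fun :> M -> N;
  rch_ax : is_rcomod_hom rch_fun }.

Lemma rcomod_hom_eq (M N : right_comodule) (f g : rcomod_hom M N) : f =1 g -> f = g.
Proof.
case: f g => f fP [g gP] /= /funext fg; case: _ / fg gP => gP.
by congr RcomodHom; exact: Prop_irrelevance.
Qed.

Lemma rcomod_hom_bimod (M N : right_comodule) (f : M -> N) :
  is_rcomod_hom f -> bimod_map f.
Proof.
case=> fD fr fc; split=> // a m.
rewrite (rco_lact (rcm_ax M)) (rco_lact (rcm_ax N)) fc.
rewrite (morph_tlift _ _ fD) tliftA_tens; last exact: ract_eps_bal.
by apply: eq_tlift => m0 m1; rewrite fr.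
Qed.

Section Tensor.
Variables (M N : right_comodule).
Local Notation T := (tensorA M N).

Definition rtens_pre (m0 : M) (m1 : tri B) (n0 : N) (n1 : tri B) : tensorA T (tri B) :=
  tensA (tensA m0 n0) (n1 * m1).

Definition rtens_coact (x : T) : tensorA T (tri B) :=
  tlift (fun m n => tlift (fun m0 (m1 : tri B) => tlift (fun n0 (n1 : tri B) =>
    tensA (tensA m0 n0) (n1 * m1)) (rcoact N n)) (rcoact M m)) x.

Lemma rtens_pre_bal2 m0 m1 : balanced (@ract _ _ N) (@lact _ _ (tri B)) (rtens_pre m0 m1).
Proof.
rewrite /rtens_pre; split=> [n1 x y|n0 x y|n0 a n1].
- by rewrite tensADr tensADl.
- by rewrite mulrDl tensADr.
- by rewrite -lact_mul -tensA_bal ract_tensA.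
Qed.

Lemma rtens_pre_bal1 n : balanced (@ract _ _ M) (@lact _ _ (tri B))
  (fun m0 m1 => tlift (rtens_pre m0 m1) (rcoact N n)).
Proof.
split=> [m1 x y|m0 x y|m0 a m1].
- by rewrite -tlift_sumf; apply: eq_tlift => n0 n1; rewrite /rtens_pre !tensADl.
- by rewrite -tlift_sumf; apply: eq_tlift => n0 n1; rewrite /rtens_pre mulrDr tensADr.
transitivity (tlift (fun n0 n1 => rtens_pre m0 m1 (lact a n0) n1) (rcoact N n)).
  by apply: eq_tlift => n0 n1; rewrite /rtens_pre tensA_bal.
rewrite (rco_takeuchiE (rcm_ax N)); last exact: rtens_pre_bal2.
by apply: eq_tlift => n0 n1; rewrite /rtens_pre lact_tri mulrA.
Qed.

Lemma rtens_coact_bal : balanced (@ract _ _ M) (@lact _ _ N)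
  (fun m n => tlift (fun m0 m1 => tlift (rtens_pre m0 m1) (rcoact N n)) (rcoact M m)).
Proof.
split=> [n x y|m x y|m a n].
- rewrite (rco_add (rcm_ax M)); exact/tliftAD/rtens_pre_bal1.
- rewrite -tlift_sumf; apply: eq_tlift => m0 m1.
  rewrite (rco_add (rcm_ax N)); exact/tliftAD/rtens_pre_bal2.
- rewrite (rco_rho_ractE (rcm_ax M)); last exact: rtens_pre_bal1.
  apply: eq_tlift => m0 m1; rewrite (rco_rho_lactE (rcm_ax N)); last exact: rtens_pre_bal2.
  by apply: eq_tlift => n0 n1; rewrite /rtens_pre ract_tri mulrA.
Qed.

Lemma rtens_coactE m n : rtens_coact (tensA m n) =
  tlift (fun m0 m1 => tlift (rtens_pre m0 m1) (rcoact N n)) (rcoact M m).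
Proof. exact: (tliftAE _ _ rtens_coact_bal). Qed.

Lemma rtens_coactD : {morph rtens_coact : x y / x + y}.
Proof. exact: (tliftAD rtens_coact_bal). Qed.

Lemma rtens_coact_lift (G : zmodType) (f : T -> tri B -> G) m n :
  balanced (@ract _ _ T) (@lact _ _ (tri B)) f ->
  tlift f (rtens_coact (tensA m n)) =
  tlift (fun m0 (m1 : tri B) => tlift (fun n0 (n1 : tri B) =>
    f (tensA m0 n0) (n1 * m1)) (rcoact N n))
    (rcoact M m).
Proof.
move=> fb; rewrite rtens_coactE tliftA_lift //; apply: eq_tlift => m0 m1.
exact: (tliftA_tens _ _ _ fb).
Qed.

Lemma rtens_ract_eps (p : tri B) m n :
  tlift (fun x (u : tri B) => ract x (eps B (u * p))) (rtens_coact (tensA m n)) =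
  tensA (tlift (fun m0 (m1 : tri B) => ract m0 (eps B (m1 * p))) (rcoact M m)) n.
Proof.
rewrite rtens_coact_lift; last exact: ract_eps_bal.
rewrite (morph_tlift _ _ (tensADl n)); apply: eq_tlift => m0 m1.
rewrite tensA_bal (rco_lact (rcm_ax N)) (morph_tlift _ _ (tensADr m0)).
by apply: eq_tlift => n0 n1; rewrite ract_tensA -mulrA -eps_tgt.
Qed.

Lemma rtens_ract x a : rtens_coact (ract x a) = ract (rtens_coact x) a.
Proof.
have D := rtens_coactD.
elim/tensorA_ind: x => [m n|x y IHx IHy]; last by rewrite !(ractDl, D) IHx IHy.
rewrite ract_tensA !rtens_coactE (morph_tlift _ _ (@ractDl _ _ _ a)).
apply: eq_tlift => m0 m1; rewrite (rco_rho_ractE (rcm_ax N)); last first.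
  exact: rtens_pre_bal2.
rewrite (morph_tlift _ _ (@ractDl _ _ _ a)); apply: eq_tlift => n0 n1.
by rewrite /rtens_pre ract_tensA ract_mul.
Qed.

Section Coassoc.
Local Notation W := (tensorA (tensorA T (tri B)) (tri B)).
Let E (y : T) (p q : tri B) : W := tensA (tensA y p) q.

Let E_bal y : balanced (@ract _ _ (tri B)) (@lact _ _ (tri B)) (E y).
Proof. exact: assocV_bal1. Qed.

Let ED p q : {morph (fun y => E y p q) : x y / x + y}.
Proof. by move=> x y; rewrite /E !tensADl. Qed.

Let F n (m : M) (u v : tri B) : W :=
  tlift (fun n0 n1 => tlift (fun p q : tri B => E (tensA m n0) (p * u) (q * v))
    (Delta B n1)) (rcoact N n).

Let Emul_bal y (u v : tri B) : balanced (@ract _ _ (tri B)) (@lact _ _ (tri B))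
  (fun p q : tri B => E y (p * u) (q * v)).
Proof.
case: (E_bal y) => El Er Eb; split=> [q p p'|p q q'|p a q] /=.
- by rewrite mulrDl El.
- by rewrite mulrDl Er.
- by rewrite -ract_mul -lact_mul Eb.
Qed.

Let FN n m u v :
  tlift (fun n0 n1 => tlift (fun n00 (n01 : tri B) => E (tensA m n00) (n01 * u) (n1 * v))
    (rcoact N n0)) (rcoact N n) = F n m u v.
Proof.
apply: (rco_coassocE (rcm_ax N) (F := fun n p q => E (tensA m n) (p * u) (q * v))).
- move=> q; split=> [p x y|n0 p p'|n0 a p].
  + by rewrite tensADr ED.
  + by case: (E_bal (tensA m n0)) => El _ _; rewrite mulrDl El.
  + by rewrite -lact_mul /E -[in RHS]tensA_bal ract_tensA.
- by move=> n0 p; case: (Emul_bal (tensA m n0) u v).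
- by move=> n0 p a q; case: (Emul_bal (tensA m n0) u v).
Qed.

Let F12 n v : balanced (@ract _ _ M) (@lact _ _ (tri B)) (fun m u => F n m u v).
Proof.
split=> [u x y|m u u'|m a u].
- rewrite -tlift_sumf; apply: eq_tlift => n0 n1.
  by rewrite -tlift_sumf; apply: eq_tlift => p q; rewrite tensADl ED.
- rewrite -tlift_sumf; apply: eq_tlift => n0 n1.
  rewrite -tlift_sumf; apply: eq_tlift => p q.
  by rewrite mulrDr /E tensADr tensADl.
pose f n0 n1 := tlift (fun p q : tri B => E (tensA m n0) (p * u) (q * v)) (Delta B n1).
have fb : balanced (@ract _ _ N) (@lact _ _ (tri B)) f.
  rewrite /f; split=> [n1 x y|n0 x y|n0 b n1].
  - by rewrite -tlift_sumf; apply: eq_tlift => p q; rewrite tensADr ED.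
  - by rewrite raddfD; exact: (tliftAD (Emul_bal _ _ _)).
  - rewrite Delta_lact lact_tensorA tliftA_tens //.
    by apply: eq_tlift => p q; rewrite -lact_mul /E -[in RHS]tensA_bal ract_tensA.
transitivity (tlift (fun n0 n1 => f (lact a n0) n1) (rcoact N n)).
  by apply: eq_tlift => n0 n1; apply: eq_tlift => p q; rewrite tensA_bal.
rewrite (rco_takeuchiE (rcm_ax N)) //; apply: eq_tlift => n0 n1.
rewrite /f Delta_mul_srcE //; apply: eq_tlift => p q.
by rewrite lact_tri mulrA.
Qed.

Let F3 n m u : {morph F n m u : v w / v + w}.
Proof.
move=> v w; rewrite -tlift_sumf; apply: eq_tlift => n0 n1.
rewrite -tlift_sumf; apply: eq_tlift => p q; rewrite mulrDr.
by case: (E_bal (tensA m n0)) => _ Er _; rewrite Er.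
Qed.

Let F23 n m u a v : F n m (ract u a) v = F n m u (lact a v).
Proof.
apply: eq_tlift => n0 n1.
pose f p q := E (tensA m n0) (p * u) (q * v).
transitivity (tlift (fun p q : tri B => f (p * tgt a) q) (Delta B n1)).
  by apply: eq_tlift => p q; rewrite /f ract_tri mulrA.
rewrite Delta_takeuchiE; last exact: Emul_bal.
by apply: eq_tlift => p q; rewrite /f lact_tri mulrA.
Qed.

Lemma rtens_coassoc x :
  tlift (fun y u => tensA (rtens_coact y) u) (rtens_coact x) =
  tlift (fun y w => tlift (fun u v => tensA (tensA y u) v) (Delta B w)) (rtens_coact x).
Proof.
have D := rtens_coactD.
have lb : balanced (@ract _ _ T) (@lact _ _ (tri B))
    (fun y u => tensA (rtens_coact y) u : W).
  split=> [u y z|y u v|y a u]; first by rewrite D tensADl.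
  - by rewrite tensADr.
  - by rewrite rtens_ract tensA_bal.
have rb : balanced (@ract _ _ T) (@lact _ _ (tri B))
    (fun y w => tlift (E y) (Delta B w)).
  split=> [u y z|y u v|y a u].
  - by rewrite -tlift_sumf; apply: eq_tlift => p q; exact: ED.
  - by rewrite raddfD; exact/tliftAD/E_bal.
  - rewrite Delta_lact lact_tensorA tliftA_tens //.
    by apply: eq_tlift => p q; rewrite /E tensA_bal.
elim/tensorA_ind: x => [m n|x y IHx IHy]; last first.
  have lD := tliftAD lb; have rD := tliftAD rb.
  by rewrite D [LHS]lD [RHS]rD IHx IHy.
rewrite (rtens_coact_lift _ _ lb) (rtens_coact_lift _ _ rb).
transitivity (tlift (fun m0 m1 => tlift (fun m00 m01 => F n m00 m01 m1) (rcoact M m0))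
    (rcoact M m)).
  apply: eq_tlift => m0 m1; rewrite (eq_tlift _ (fun m00 m01 => esym (FN n m00 m01 m1))).
  rewrite [RHS]tlift_exch; apply: eq_tlift => n0 n1; rewrite rtens_coactE.
  rewrite (morph_tlift _ _ (tensADl (n1 * m1))); apply: eq_tlift => m00 m01.
  by rewrite (morph_tlift _ _ (tensADl (n1 * m1))).
rewrite (rco_coassocE (rcm_ax M) (F12 n) (F3 n) (F23 n)).
apply: eq_tlift => m0 m1; rewrite [LHS]tlift_exch; apply: eq_tlift => n0 n1.
by rewrite [LHS]tlift_exch (Delta_mulE _ _ (E_bal _)).
Qed.
End Coassoc.

Lemma rtens_counit x : tlift (fun y u => ract y (eps B u)) (rtens_coact x) = x.
Proof.
have D := rtens_coactD; have bal := @ract_eps_bal T 1.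
have e : (fun (y : T) (u : tri B) => ract y (eps B u)) =
    (fun y (u : tri B) => ract y (eps B (u * 1))).
  by apply/funext => y; apply/funext => u; rewrite mulr1.
rewrite e; elim/tensorA_ind: x => [m n|x y IHx IHy]; last first.
  by rewrite D (tliftAD bal) IHx IHy.
rewrite rtens_ract_eps; congr tensA; rewrite -[RHS](rco_counit (rcm_ax M)).
by apply: eq_tlift => m0 m1; rewrite mulr1.
Qed.

Lemma rtens_lact a x :
  lact a x = tlift (fun y (u : tri B) => ract y (eps B (u * tgt a))) (rtens_coact x).
Proof.
have D := rtens_coactD; have bal := @ract_eps_bal T (tgt a).
elim/tensorA_ind: x => [m n|x y IHx IHy]; last first.
  by rewrite D lactDr (tliftAD bal) IHx IHy.
by rewrite rtens_ract_eps lact_tensA (rco_lact (rcm_ax M)).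
Qed.

Lemma rtens_ax : right_comodule_axioms rtens_coact.
Proof.
split; [exact: rtens_coactD | exact: rtens_ract | exact: rtens_coassoc |
        exact: rtens_counit | exact: rtens_lact].
Qed.

Definition rcomod_tens : right_comodule := RightComodule rtens_ax.
End Tensor.

Lemma rcoactD (M : right_comodule) : {morph rcoact M : x y / x + y}.
Proof. exact: rco_add (rcm_ax M). Qed.

Lemma rhom_id (M : right_comodule) : is_rcomod_hom (@id M).
Proof. by split=> // m; rewrite -[LHS]tlift_tens. Qed.

Lemma rhom_bal (M N : right_comodule) (f : M -> N) : bimod_map f ->
  balanced (@ract _ _ M) (@lact _ _ (tri B)) (fun m0 (m1 : tri B) => tensA (f m0) m1).
Proof.
case=> fD _ fr; split=> [u x y|m u v|m a u]; first by rewrite fD tensADl.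
- by rewrite tensADr.
- by rewrite fr tensA_bal.
Qed.

Lemma rhom_comp (M N P : right_comodule) (g : N -> P) (f : M -> N) :
  is_rcomod_hom g -> is_rcomod_hom f -> is_rcomod_hom (g \o f).
Proof.
move=> gP fP; have gb := rcomod_hom_bimod gP.
case: gP fP => gD gr gc [fD fr fc]; split=> [x y|m a|m] /=.
- by rewrite fD gD.
- by rewrite fr gr.
- by rewrite gc fc tliftA_tens //; exact: rhom_bal.
Qed.

Lemma rhom_tens (M N P : right_comodule) (f : tensorA M N -> P) :
  bimod_map f ->
  (forall m n, rcoact P (f (tensA m n)) =
    tlift (fun m0 (m1 : tri B) => tlift (fun n0 (n1 : tri B) =>
      tensA (f (tensA m0 n0)) (n1 * m1)) (rcoact N n)) (rcoact M m)) ->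
  is_rcomod_hom (M := rcomod_tens M N) (N := P) f.
Proof.
move=> fb fc; have bal := @rhom_bal (rcomod_tens M N) P f fb.
case: (fb) => fD _ fr; split=> // x.
have D := @rtens_coactD M N.
elim/tensorA_ind: x => [m n|x y IHx IHy].
  by rewrite fc /= (rtens_coact_lift _ _ bal).
by rewrite fD rcoactD IHx IHy /= D (tliftAD bal).
Qed.

Lemma rhom_pre_bal (M N : right_comodule) (P : lmodType (Aenv A))
    (f : tensorA M N -> P) n : bimod_map f ->
  balanced (@ract _ _ M) (@lact _ _ (tri B)) (fun m0 (m1 : tri B) =>
    tlift (fun n0 (n1 : tri B) => tensA (f (tensA m0 n0)) (n1 * m1)) (rcoact N n)).
Proof.
case=> fD fl fr.
have hb : balanced (@ract _ _ (tensorA M N)) (@lact _ _ (tri B))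
    (fun y u => tensA (f y) u).
  split=> [u x y|m u v|m a u]; first by rewrite fD tensADl.
  - by rewrite tensADr.
  - by rewrite fr tensA_bal.
have hE m0 m1 : tlift (fun n0 (n1 : tri B) => tensA (f (tensA m0 n0)) (n1 * m1))
    (rcoact N n) =
    tlift (fun y u => tensA (f y) u) (tlift (@rtens_pre M N m0 m1) (rcoact N n)).
  by rewrite tliftA_tens.
have [Dl Dr bal] := @rtens_pre_bal1 M N n; have hD := tliftAD hb.
split=> [m1 x y|m0 x y|m0 a m1]; rewrite !hE ?Dl ?Dr ?bal //; exact: hD.
Qed.

Lemma rhom_tmap (M N M' N' : right_comodule) (f : M -> M') (g : N -> N') :
  is_rcomod_hom f -> is_rcomod_hom g ->
  is_rcomod_hom (M := rcomod_tens M N) (N := rcomod_tens M' N') (tmap f g).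
Proof.
move=> fP gP; have fb := rcomod_hom_bimod fP; have gb := rcomod_hom_bimod gP.
apply: rhom_tens => [|m n]; first exact: tmap_bimod.
rewrite tmapE // [LHS]rtens_coactE; case: fP gP => _ _ fc [_ _ gc].
rewrite fc tliftA_tens; last exact: rtens_pre_bal1.
apply: eq_tlift => m0 m1; rewrite gc tliftA_tens; last exact: rtens_pre_bal2.
by apply: eq_tlift => n0 n1; rewrite tmapE.
Qed.

Definition runit_coact (a : regular_bimod A) : tensorA (regular_bimod A) (tri B) :=
  tensA ((1 : A) : regular_bimod A) (tgt (a : A) : tri B).

Lemma runit_ax : right_comodule_axioms runit_coact.
Proof.
have one_ract a (u : tri B) : tensA (a : regular_bimod A) u =
    tensA ((1 : A) : regular_bimod A) (lact (a : A) u).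
  by rewrite -tensA_bal ract_regular mul1r.
split=> [a b|a b|a|a|b a]; rewrite /runit_coact.
- by rewrite tgtD tensADr.
- by rewrite ract_regular ract_tensA tgtM ract_tri.
- rewrite tliftAE; last first.
    split=> [u x y|x u v|x b u]; first by rewrite tgtD tensADr tensADl.
    + by rewrite tensADr.
    + by rewrite ract_regular tgtM -ract_tri -[in LHS]ract_tensA tensA_bal.
  rewrite tliftAE; last first.
    split=> [u x y|x u v|x b u].
    + by rewrite -tlift_sumf; apply: eq_tlift => v w; rewrite !tensADl.
    + rewrite raddfD; exact/tliftAD/assocV_bal1.
    + rewrite Delta_lact lact_tensorA tliftA_tens; last exact: assocV_bal1.
      by apply: eq_tlift => v w; rewrite tensA_bal.
  rewrite tgt1 (tgt_ract B a) Delta_ract Delta1 ract_tensA tliftAE //.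
  exact: assocV_bal1.
- rewrite tliftAE ?ract_regular ?eps_t ?mul1r //.
  split=> [u x y|x u v|x b u]; first exact: ractDl.
  + by rewrite raddfD ractDr.
  + by rewrite eps_lact ractM.
- rewrite tliftAE; last exact: ract_eps_bal.
  by rewrite -tgtM eps_t ract_regular lact_regular mul1r.
Qed.

Definition rcomod_unit : right_comodule := RightComodule runit_ax.

Lemma rhom_lunitA (M : right_comodule) :
  is_rcomod_hom (M := rcomod_tens rcomod_unit M) (@lunitA _ _ M).
Proof.
apply: (@rhom_tens rcomod_unit M M); first exact: lunitA_bimod.
move=> a m; rewrite lunitAE (rco_rho_lact (rcm_ax M)).
have bal := @rhom_pre_bal rcomod_unit M M _ m (lunitA_bimod M).
rewrite /= (tliftAE _ _ bal).
by apply: eq_tlift => n0 n1; rewrite lunitAE lact1.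
Qed.

Lemma rhom_runitA (M : right_comodule) :
  is_rcomod_hom (M := rcomod_tens M rcomod_unit) (@runitA _ _ M).
Proof.
apply: (@rhom_tens M rcomod_unit M); first exact: runitA_bimod.
move=> m a; rewrite runitAE (rco_ract (rcm_ax M)) ract_tensorA.
apply: eq_tlift => m0 m1; rewrite /= tliftAE; first by rewrite runitAE ract1.
split=> [u x y|x u v|x b u].
- by rewrite !runitAE ractDr tensADl.
- by rewrite mulrDl tensADr.
- by rewrite !runitAE ract_regular ractM tensA_bal lact_mul.
Qed.

Lemma rhom_inv (M N : right_comodule) (f : M -> N) (g : N -> M) :
  cancel f g -> cancel g f -> is_rcomod_hom f -> is_rcomod_hom g.
Proof.
move=> fK gK fP; have [fD fl fr] := rcomod_hom_bimod fP; case: fP => _ _ fc.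
have gb : bimod_map g.
  split=> [x y|a m|m a]; apply: (can_inj fK); rewrite gK.
  - by rewrite fD !gK.
  - by rewrite fl gK.
  - by rewrite fr gK.
case: (gb) => gD gl gr; split=> // m.
rewrite -{2}(gK m) fc tliftA_tens; last exact: rhom_bal.
by rewrite -[LHS]tlift_tens; apply: eq_tlift => m0 m1; rewrite fK.
Qed.

Lemma rhom_assocA (M N P : right_comodule) :
  is_rcomod_hom (M := rcomod_tens (rcomod_tens M N) P)
    (N := rcomod_tens M (rcomod_tens N P)) (@assocA _ _ M N P).
Proof.
apply: (@rhom_tens (rcomod_tens M N) P (rcomod_tens M (rcomod_tens N P))).
  exact: assocA_bimod.
move=> x p; have ab := @assocA_bimod _ _ M N P.
have Kb := @rhom_pre_bal (rcomod_tens M N) P _ _ p ab.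
have [aD _ _] := ab; have D := @rtens_coactD M N.
elim/tensorA_ind: x => [m n|x y IHx IHy]; last first.
  by rewrite tensADl aD rcoactD IHx IHy /= D (tliftAD Kb).
rewrite assocAE [RHS](rtens_coact_lift _ _ Kb) [LHS]rtens_coactE.
apply: eq_tlift => m0 m1.
rewrite [LHS](rtens_coact_lift _ _ (@rtens_pre_bal2 M (rcomod_tens N P) m0 m1)).
apply: eq_tlift => n0 n1; apply: eq_tlift => p0 p1.
by rewrite /rtens_pre assocAE mulrA.
Qed.

End RightComodule.

Arguments rcoact {k A B} M m : rename.

Record category := Category {
  ob :> Type;
  hom : ob -> ob -> Type;
  idc : forall X, hom X X;
  compc : forall X Y Z, hom Y Z -> hom X Y -> hom X Z;
  comp1c : forall X Y (f : hom X Y), compc (idc Y) f = f;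
  compc1 : forall X Y (f : hom X Y), compc f (idc X) = f;
  compcA : forall X Y Z T (h : hom Z T) (g : hom Y Z) (f : hom X Y),
    compc h (compc g f) = compc (compc h g) f }.

Arguments hom {c} X Y.
Arguments idc {c} X.
Arguments compc {c X Y Z} g f.

Declare Scope cat_scope.
Local Open Scope cat_scope.
Notation "g \oc f" := (compc g f) (at level 50, left associativity) : cat_scope.

Record functor (C D : category) := Functor {
  fob :> C -> D;
  fhom : forall X Y, hom X Y -> hom (fob X) (fob Y);
  fhom1 : forall X, fhom (idc X) = idc (fob X);
  fhomM : forall X Y Z (g : hom Y Z) (f : hom X Y), fhom (g \oc f) = fhom g \oc fhom f }.

Arguments fhom {C D} F {X Y} f : rename.

Definition functor_id (C : category) : functor C C :=
  @Functor C C id (fun _ _ f => f) (fun _ => erefl) (fun _ _ _ _ _ => erefl).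

Lemma functor_comp1 (C D E : category) (G : functor D E) (F : functor C D) X :
  fhom G (fhom F (idc X)) = idc (G (F X)).
Proof. by rewrite !fhom1. Qed.

Lemma functor_compM (C D E : category) (G : functor D E) (F : functor C D)
    X Y Z (g : hom Y Z) (f : hom X Y) :
  fhom G (fhom F (g \oc f)) = fhom G (fhom F g) \oc fhom G (fhom F f).
Proof. by rewrite !fhomM. Qed.

Definition functor_comp (C D E : category) (G : functor D E) (F : functor C D) :
  functor C E :=
  @Functor C E (fun X => G (F X)) (fun X Y f => fhom G (fhom F f))
    (functor_comp1 G F) (functor_compM G F).

Record iso (C : category) (X Y : C) := Iso {
  iso_fun :> hom X Y;
  iso_inv : hom Y X;
  iso_funK : iso_inv \oc iso_fun = idc X;
  iso_invK : iso_fun \oc iso_inv = idc Y }.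

Arguments iso_inv {C X Y} i.

Definition iso_id (C : category) (X : C) : iso X X :=
  Iso (comp1c (idc X)) (comp1c (idc X)).

Lemma iso_comp_funK (C : category) (X Y Z : C) (g : iso Y Z) (f : iso X Y) :
  (iso_inv f \oc iso_inv g) \oc (g \oc f) = idc X.
Proof. by rewrite -compcA (compcA _ g f) iso_funK comp1c iso_funK. Qed.

Lemma iso_comp_invK (C : category) (X Y Z : C) (g : iso Y Z) (f : iso X Y) :
  (g \oc f) \oc (iso_inv f \oc iso_inv g) = idc Z.
Proof. by rewrite -compcA (compcA _ _ (iso_inv g)) iso_invK comp1c iso_invK. Qed.

Definition iso_comp (C : category) (X Y Z : C) (g : iso Y Z) (f : iso X Y) : iso X Z :=
  Iso (iso_comp_funK g f) (iso_comp_invK g f).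

Lemma iso_map_funK (C D : category) (F : functor C D) (X Y : C) (f : iso X Y) :
  fhom F (iso_inv f) \oc fhom F f = idc (F X).
Proof. by rewrite -fhomM iso_funK fhom1. Qed.

Lemma iso_map_invK (C D : category) (F : functor C D) (X Y : C) (f : iso X Y) :
  fhom F f \oc fhom F (iso_inv f) = idc (F Y).
Proof. by rewrite -fhomM iso_invK fhom1. Qed.

Definition iso_map (C D : category) (F : functor C D) (X Y : C) (f : iso X Y) :
  iso (F X) (F Y) := Iso (iso_map_funK F f) (iso_map_invK F f).

Definition eq_hom (C : category) (X Y : C) (e : X = Y) : hom X Y :=
  match e in _ = Z return hom X Z with erefl => idc X end.

Record monoidal_category := MonoidalCategory {
  mcat :> category;
  mtens : mcat -> mcat -> mcat;
  mtensh : forall X X' Y Y' : mcat,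
    hom X X' -> hom Y Y' -> hom (mtens X Y) (mtens X' Y');
  munit : mcat;
  massoc : forall X Y Z : mcat, iso (mtens (mtens X Y) Z) (mtens X (mtens Y Z));
  mlunit : forall X : mcat, iso (mtens munit X) X;
  mrunit : forall X : mcat, iso (mtens X munit) X;
  mtensh1 : forall X Y : mcat, mtensh (idc X) (idc Y) = idc (mtens X Y);
  mtenshM : forall (X X' X'' Y Y' Y'' : mcat) (f' : hom X' X'') (f : hom X X')
      (g' : hom Y' Y'') (g : hom Y Y'),
    mtensh (f' \oc f) (g' \oc g) = mtensh f' g' \oc mtensh f g;
  massoc_nat : forall (X X' Y Y' Z Z' : mcat) (f : hom X X') (g : hom Y Y')
      (h : hom Z Z'),
    massoc X' Y' Z' \oc mtensh (mtensh f g) h =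
    mtensh f (mtensh g h) \oc massoc X Y Z;
  mlunit_nat : forall (X Y : mcat) (f : hom X Y),
    mlunit Y \oc mtensh (idc munit) f = f \oc mlunit X;
  mrunit_nat : forall (X Y : mcat) (f : hom X Y),
    mrunit Y \oc mtensh f (idc munit) = f \oc mrunit X;
  mpentagon : forall X Y Z T : mcat,
    massoc X Y (mtens Z T) \oc massoc (mtens X Y) Z T =
    mtensh (idc X) (massoc Y Z T) \oc massoc X (mtens Y Z) T
      \oc mtensh (massoc X Y Z) (idc T);
  mtriangle : forall X Y : mcat,
    mtensh (idc X) (mlunit Y) \oc massoc X munit Y = mtensh (mrunit X) (idc Y) }.

Arguments mtens {m} X Y.
Arguments mtensh {m X X' Y Y'} f g.
Arguments munit {m}.
Arguments massoc {m} X Y Z.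
Arguments mlunit {m} X.
Arguments mrunit {m} X.

Record monoidal_structure (C D : monoidal_category) (F : functor C D) :=
  MonoidalStructure {
  mf_tens : forall X Y : C, iso (mtens (F X) (F Y)) (F (mtens X Y));
  mf_unit : iso munit (F munit);
  mf_nat : forall (X X' Y Y' : C) (f : hom X X') (g : hom Y Y'),
    fhom F (mtensh f g) \oc mf_tens X Y = mf_tens X' Y' \oc mtensh (fhom F f) (fhom F g);
  mf_assoc : forall X Y Z : C,
    fhom F (massoc X Y Z) \oc mf_tens (mtens X Y) Z
      \oc mtensh (mf_tens X Y) (idc (F Z)) =
    mf_tens X (mtens Y Z) \oc mtensh (idc (F X)) (mf_tens Y Z)
      \oc massoc (F X) (F Y) (F Z);
  mf_lunit : forall X : C,
    fhom F (mlunit X) \oc mf_tens munit X \oc mtensh mf_unit (idc (F X)) = mlunit (F X);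
  mf_runit : forall X : C,
    fhom F (mrunit X) \oc mf_tens X munit \oc mtensh (idc (F X)) mf_unit = mrunit (F X) }.

(* the structure isomorphisms are identities *)
Definition strict (C D : monoidal_category) (F : functor C D)
    (phi : monoidal_structure F) : Prop :=
  (forall X Y : C, exists e : mtens (F X) (F Y) = F (mtens X Y),
     mf_tens phi X Y = eq_hom e :> hom _ _) /\
  (exists e : munit = F munit, mf_unit phi = eq_hom e :> hom _ _).

Section MonoidalId.
Variable C : monoidal_category.
Let F := functor_id C.
Program Definition monoidal_id : monoidal_structure F :=
  @MonoidalStructure C C F (fun X Y => iso_id (mtens X Y)) (iso_id munit) _ _ _ _.
Next Obligation. by rewrite compc1 comp1c. Qed.
Next Obligation. by rewrite !compc1 !mtensh1 compc1 !comp1c. Qed.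
Next Obligation. by rewrite !mtensh1 !compc1. Qed.
Next Obligation. by rewrite !mtensh1 !compc1. Qed.
End MonoidalId.

Section MonoidalComp.
Variables (C D E : monoidal_category) (G : functor D E) (F : functor C D).
Variables (psi : monoidal_structure G) (phi : monoidal_structure F).

Let t X Y : iso (mtens (G (F X)) (G (F Y))) (G (F (mtens X Y))) :=
  iso_comp (iso_map G (mf_tens phi X Y)) (mf_tens psi (F X) (F Y)).
Let u : iso munit (G (F munit)) := iso_comp (iso_map G (mf_unit phi)) (mf_unit psi).

Let t_nat (X X' Y Y' : C) (f : hom X X') (g : hom Y Y') :
  fhom G (fhom F (mtensh f g)) \oc t X Y =
  t X' Y' \oc mtensh (fhom G (fhom F f)) (fhom G (fhom F g)).
Proof. by rewrite /= compcA -fhomM mf_nat fhomM -!compcA mf_nat. Qed.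

Let t_assoc (X Y Z : C) :
  fhom G (fhom F (massoc X Y Z)) \oc t (mtens X Y) Z \oc mtensh (t X Y) (idc _) =
  t X (mtens Y Z) \oc mtensh (idc _) (t Y Z) \oc massoc _ _ _.
Proof.
rewrite /=.
have e1 : mtensh (fhom G (mf_tens phi X Y) \oc mf_tens psi (F X) (F Y)) (idc (G (F Z))) =
  mtensh (fhom G (mf_tens phi X Y)) (fhom G (idc (F Z)))
    \oc mtensh (mf_tens psi (F X) (F Y)) (idc (G (F Z))).
  by rewrite -mtenshM fhom1 comp1c.
have e2 : mtensh (idc (G (F X))) (fhom G (mf_tens phi Y Z) \oc mf_tens psi (F Y) (F Z)) =
  mtensh (fhom G (idc (F X))) (fhom G (mf_tens phi Y Z))
    \oc mtensh (idc (G (F X))) (mf_tens psi (F Y) (F Z)).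
  by rewrite -mtenshM fhom1 comp1c.
rewrite e1 e2 !compcA.
rewrite -(compcA _ (mf_tens psi (F (mtens X Y)) (F Z))) -mf_nat !compcA -!fhomM.
rewrite mf_assoc.
rewrite -(compcA _ (mf_tens psi (F X) (F (mtens Y Z)))) -mf_nat !compcA -!fhomM.
by rewrite !fhomM -!compcA; congr (_ \oc (_ \oc _)); rewrite !compcA mf_assoc.
Qed.

Let t_lunit (X : C) :
  fhom G (fhom F (mlunit X)) \oc t munit X \oc mtensh u (idc _) = mlunit _.
Proof.
rewrite /=.
have -> : mtensh (fhom G (mf_unit phi) \oc mf_unit psi) (idc (G (F X))) =
  mtensh (fhom G (mf_unit phi)) (fhom G (idc (F X)))
    \oc mtensh (mf_unit psi) (idc (G (F X))).
  by rewrite -mtenshM fhom1 comp1c.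
rewrite !compcA -(compcA _ (mf_tens psi (F munit) (F X))) -mf_nat !compcA -!fhomM.
by rewrite mf_lunit mf_lunit.
Qed.

Let t_runit (X : C) :
  fhom G (fhom F (mrunit X)) \oc t X munit \oc mtensh (idc _) u = mrunit _.
Proof.
rewrite /=.
have -> : mtensh (idc (G (F X))) (fhom G (mf_unit phi) \oc mf_unit psi) =
  mtensh (fhom G (idc (F X))) (fhom G (mf_unit phi))
    \oc mtensh (idc (G (F X))) (mf_unit psi).
  by rewrite -mtenshM fhom1 comp1c.
rewrite !compcA -(compcA _ (mf_tens psi (F X) (F munit))) -mf_nat !compcA -!fhomM.
by rewrite mf_runit mf_runit.
Qed.

Definition monoidal_comp : monoidal_structure (functor_comp G F) :=
  @MonoidalStructure C E (functor_comp G F) t u t_nat t_assoc t_lunit t_runit.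
End MonoidalComp.

Record nat_iso (C D : category) (F G : functor C D) := NatIso {
  niso :> forall X : C, iso (F X) (G X);
  niso_nat : forall (X Y : C) (f : hom X Y), fhom G f \oc niso X = niso Y \oc fhom F f }.

Definition is_monoidal_nat (C D : monoidal_category) (F G : functor C D)
    (phi : monoidal_structure F) (psi : monoidal_structure G) (theta : nat_iso F G) :
    Prop :=
  (forall X Y : C,
     theta (mtens X Y) \oc mf_tens phi X Y =
     mf_tens psi X Y \oc mtensh (theta X) (theta Y)) /\
  theta munit \oc mf_unit phi = mf_unit psi.

Definition monoidal_quasi_inverse (C D : monoidal_category)
    (F : functor C D) (G : functor D C)
    (phi : monoidal_structure F) (psi : monoidal_structure G) : Prop :=
  (exists theta : nat_iso (functor_id C) (functor_comp G F),
     is_monoidal_nat (monoidal_id C) (monoidal_comp psi phi) theta) /\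
  (exists theta : nat_iso (functor_comp F G) (functor_id D),
     is_monoidal_nat (monoidal_comp phi psi) (monoidal_id D) theta).

Definition monoidally_equivalent (C D : monoidal_category) : Prop :=
  exists (F : functor C D) (G : functor D C)
    (phi : monoidal_structure F) (psi : monoidal_structure G),
    monoidal_quasi_inverse phi psi.

Section RightComoduleCategory.
Variables (k : comPzRingType) (A : kalgebra k) (B : left_bialgebroid A).
Local Notation rcomod := (right_comodule B).

Definition rhom_idc (M : rcomod) : rcomod_hom M M := RcomodHom (rhom_id M).
Definition rhom_compc (M N P : rcomod) (g : rcomod_hom N P) (f : rcomod_hom M N) :
  rcomod_hom M P := RcomodHom (rhom_comp (rch_ax g) (rch_ax f)).

Program Definition rcomod_cat : category :=
  @Category rcomod (@rcomod_hom _ _ B) rhom_idc rhom_compc _ _ _.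
Next Obligation. exact: rcomod_hom_eq. Qed.
Next Obligation. exact: rcomod_hom_eq. Qed.
Next Obligation. exact: rcomod_hom_eq. Qed.

Definition rhom_tensc (M M' N N' : rcomod) (f : rcomod_hom M M') (g : rcomod_hom N N') :
  rcomod_hom (rcomod_tens M N) (rcomod_tens M' N') :=
  RcomodHom (rhom_tmap (rch_ax f) (rch_ax g)).

Program Definition rcomod_iso (M N : rcomod) (f : M -> N) (g : N -> M)
    (fK : cancel f g) (gK : cancel g f) (fP : is_rcomod_hom f) :
  @iso rcomod_cat M N :=
  @Iso rcomod_cat M N (RcomodHom fP) (RcomodHom (rhom_inv fK gK fP)) _ _.
Next Obligation. exact: rcomod_hom_eq. Qed.
Next Obligation. exact: rcomod_hom_eq. Qed.

Definition rcomod_assoc (M N P : rcomod) :=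
  @rcomod_iso (rcomod_tens (rcomod_tens M N) P) (rcomod_tens M (rcomod_tens N P))
    _ _ (@assocAK _ _ M N P) (@assocVK _ _ M N P) (rhom_assocA M N P).
Definition rcomod_lunit (M : rcomod) :=
  @rcomod_iso (rcomod_tens (rcomod_unit B) M) M
    _ _ (@lunitAK _ _ M) (@lunitVK _ _ M) (rhom_lunitA M).
Definition rcomod_runit (M : rcomod) :=
  @rcomod_iso (rcomod_tens M (rcomod_unit B)) M
    _ _ (@runitAK _ _ M) (@runitVK _ _ M) (rhom_runitA M).

Program Definition RComod : monoidal_category :=
  @MonoidalCategory rcomod_cat (@rcomod_tens _ _ B) rhom_tensc (rcomod_unit B)
    rcomod_assoc rcomod_lunit rcomod_runit _ _ _ _ _ _ _.
Next Obligation.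
apply: rcomod_hom_eq => x; exact: tmap_id.
Qed.
Next Obligation.
apply: rcomod_hom_eq => x; apply: tmap_comp; exact: (rcomod_hom_bimod (rch_ax _)).
Qed.
Next Obligation.
apply: rcomod_hom_eq => x; apply: assocA_nat; exact: (rcomod_hom_bimod (rch_ax _)).
Qed.
Next Obligation.
apply: rcomod_hom_eq => x; apply: lunitA_nat; exact: (rcomod_hom_bimod (rch_ax _)).
Qed.
Next Obligation.
apply: rcomod_hom_eq => x; apply: runitA_nat; exact: (rcomod_hom_bimod (rch_ax _)).
Qed.
Next Obligation. apply: rcomod_hom_eq => x; exact: assocA_pentagon. Qed.
Next Obligation. apply: rcomod_hom_eq => x; exact: assocA_triangle. Qed.

End RightComoduleCategory.

Section LeftComodule.
Variables (k : comPzRingType) (A : kalgebra k) (B : left_bialgebroid A).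

(* As for right comodules, the right action is part of the data and is forced by
   [lco_ract] to be the induced one. *)
Record left_comodule_axioms (N : lmodType (Aenv A)) (delta : N -> tensorA (tri B) N) :
    Prop := LeftComoduleAxioms {
  lco_add : {morph delta : x y / x + y};
  lco_lact : forall a n, delta (lact a n) = lact a (delta n);
  lco_coassoc : forall n,
    tlift (fun n1 n0 => tensA n1 (delta n0)) (delta n) =
    tlift (fun n1 n0 => tlift (fun u v => tensA u (tensA v n0)) (Delta B n1)) (delta n);
  lco_counit : forall n, tlift (fun n1 n0 => lact (eps B n1) n0) (delta n) = n;
  lco_ract : forall n a,
    ract n a = tlift (fun (n1 : tri B) n0 => lact (eps B (n1 * src a)) n0) (delta n) }.

Section Theory.
Variables (N : lmodType (Aenv A)) (delta : N -> tensorA (tri B) N).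
Hypothesis deltaP : left_comodule_axioms delta.

Section Coassoc.
Variables (G : zmodType) (F : tri B -> tri B -> N -> G).
Hypotheses (F23 : forall u, balanced (@ract _ _ (tri B)) (@lact _ _ N) (F u))
  (F1 : forall v n, {morph (fun u => F u v n) : u w / u + w})
  (F12 : forall u a v n, F (ract u a) v n = F u (lact a v) n).

Lemma lco_coassocE n :
  tlift (fun n1 n0 => tlift (fun n01 n00 => F n1 n01 n00) (delta n0)) (delta n) =
  tlift (fun n1 n0 => tlift (fun u v => F u v n0) (Delta B n1)) (delta n).
Proof.
pose h (u : tri B) (x : tensorA (tri B) N) : G := tlift (F u) x.
have hDr u : {morph h u : x y / x + y} by exact/tliftD/F23.
have hE u v n0 : h u (tensA v n0) = F u v n0 by exact: (tliftE _ _ (F23 u)).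
have hb : balanced (@ract _ _ (tri B)) (@lact _ _ (tensorA (tri B) N)) h.
  split=> [x u w||u a x] //.
    by rewrite /h -tlift_sumf; apply: eq_tlift => v n0; rewrite F1.
  elim/tensorA_ind: x => [v n0|x y IHx IHy]; first by rewrite lact_tensA !hE F12.
  by rewrite lactDr !hDr IHx IHy.
pose g (x : tensorA (tri B) (tensorA (tri B) N)) : G := tlift h x.
have gD : {morph g : x y / x + y} by exact: tliftD.
have gE u x : g (tensA u x) = h u x by exact: (tliftE _ _ hb).
have := congr1 g (lco_coassoc deltaP n).
rewrite !morph_tlift // => H.
transitivity (tlift (fun n1 n0 => g (tensA n1 (delta n0))) (delta n)).
  by apply: eq_tlift => n1 n0; rewrite gE.
rewrite H; apply: eq_tlift => n1 n0; rewrite morph_tlift //.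
by apply: eq_tlift => u v; rewrite gE hE.
Qed.
End Coassoc.

Lemma lact_eps_bal (p : tri B) : balanced (@ract _ _ (tri B)) (@lact _ _ N)
  (fun (n1 : tri B) n0 => lact (eps B (n1 * p)) n0).
Proof.
split=> [n u v|u m n|u a n] /=; last by rewrite -lactM -ract_mul eps_ract.
- by rewrite mulrDl raddfD lactDl.
- exact: lactDr.
Qed.

Lemma lco_delta_ract n a :
  delta (ract n a) = tlift (fun (n1 : tri B) n0 => tensA (n1 * src a) n0) (delta n).
Proof.
have deltaD := lco_add deltaP.
pose F (u v : tri B) n0 := tensA (lact (eps B (u * src a)) v) (n0 : N).
rewrite (lco_ract deltaP) morph_tlift //.
transitivity (tlift (fun n1 n0 => tlift (fun n01 n00 => F n1 n01 n00) (delta n0)) (delta n)).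
  by apply: eq_tlift => n1 n0; rewrite lco_lact // lact_tensorA.
rewrite lco_coassocE /F => [|u|v n0 u w|u b v n0].
- apply: eq_tlift => n1 n0; rewrite -(eps_counitl (n1 * src a)) Delta_mul_src.
  rewrite tliftA_tens; last exact: lact_eps_bal0.
  by rewrite (morph_tlift _ _ (tensADl n0)).
- split=> [n0 v w|v m0 n0|v b n0] /=; first by rewrite lactDr tensADl.
  + by rewrite tensADr.
  + by rewrite lact_ract tensA_bal.
- by rewrite mulrDl raddfD lactDl tensADl.
- by rewrite -ract_mul eps_ract lactM.
Qed.

Lemma lco_takeuchi a n :
  tlift (fun (n1 : tri B) n0 => tensA (n1 * tgt a) n0) (delta n) =
  tlift (fun n1 n0 => tensA n1 (ract n0 a)) (delta n).
Proof.
pose F (u v : tri B) n0 := tensA u (lact (eps B (v * src a)) (n0 : N)).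
symmetry.
transitivity (tlift (fun n1 n0 => tlift (fun n01 n00 => F n1 n01 n00) (delta n0)) (delta n)).
  apply: eq_tlift => n1 n0; rewrite (lco_ract deltaP).
  exact: (morph_tlift _ _ (tensADr n1)).
rewrite lco_coassocE /F => [|u|v n0 u w|u b v n0].
- apply: eq_tlift => n1 n0; rewrite -(eps_counitr (n1 * tgt a)) Delta_mul_tgt.
  rewrite tliftA_tens; last exact: ract_eps_bal0.
  rewrite (morph_tlift _ _ (tensADl n0)).
  by apply: eq_tlift => u v; rewrite eps_mul_src tensA_bal.
- split=> [n0 v w|v m0 n0|v b n0] /=; first by rewrite mulrDl raddfD lactDl tensADr.
  + by rewrite lactDr tensADr.
  + by rewrite -ract_mul eps_ract lactM.
- exact: tensADl.
- by rewrite -lact_mul eps_lact lactM tensA_bal.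
Qed.

Lemma lco_takeuchiE (G : zmodType) (f : tri B -> N -> G) a n :
  balanced (@ract _ _ (tri B)) (@lact _ _ N) f ->
  tlift (fun (n1 : tri B) n0 => f (n1 * tgt a) n0) (delta n) =
  tlift (fun n1 n0 => f n1 (ract n0 a)) (delta n).
Proof.
move=> fb; have := congr1 (fun x => tlift f x) (lco_takeuchi a n).
by rewrite !tliftA_tens.
Qed.

Lemma lco_delta_ractE (G : zmodType) (f : tri B -> N -> G) a n :
  balanced (@ract _ _ (tri B)) (@lact _ _ N) f ->
  tlift f (delta (ract n a)) =
  tlift (fun (n1 : tri B) n0 => f (n1 * src a) n0) (delta n).
Proof. by move=> fb; rewrite lco_delta_ract tliftA_tens. Qed.

Lemma lco_delta_lactE (G : zmodType) (f : tri B -> N -> G) a n :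
  balanced (@ract _ _ (tri B)) (@lact _ _ N) f ->
  tlift f (delta (lact a n)) = tlift (fun n1 n0 => f (lact a n1) n0) (delta n).
Proof. by move=> fb; rewrite lco_lact // lact_tensorA tliftA_tens. Qed.

End Theory.

Record left_comodule := LeftComodule {
  lcm_mod :> lmodType (Aenv A);
  lcoact : lcm_mod -> tensorA (tri B) lcm_mod;
  lcm_ax : left_comodule_axioms lcoact }.

Arguments lcoact : clear implicits.

Definition is_lcomod_hom (M N : left_comodule) (f : M -> N) : Prop :=
  [/\ {morph f : x y / x + y}, forall a m, f (lact a m) = lact a (f m) &
      forall m, lcoact N (f m) = tlift (fun m1 m0 => tensA m1 (f m0)) (lcoact M m)].

Record lcomod_hom (M N : left_comodule) := LcomodHom {
  lch_fun :> M -> N;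
  lch_ax : is_lcomod_hom lch_fun }.

Lemma lcomod_hom_eq (M N : left_comodule) (f g : lcomod_hom M N) : f =1 g -> f = g.
Proof.
case: f g => f fP [g gP] /= /funext fg; case: _ / fg gP => gP.
by congr LcomodHom; exact: Prop_irrelevance.
Qed.

Lemma lcomod_hom_bimod (M N : left_comodule) (f : M -> N) :
  is_lcomod_hom f -> bimod_map f.
Proof.
case=> fD fl fc; split=> // m a.
rewrite (lco_ract (lcm_ax M)) (lco_ract (lcm_ax N)) fc.
rewrite (morph_tlift _ _ fD) tliftA_tens; last exact: lact_eps_bal.
by apply: eq_tlift => m1 m0; rewrite fl.
Qed.

Section Tensor.
Variables (M N : left_comodule).
Local Notation T := (tensorA M N).

Definition ltens_pre (n1 : tri B) (n0 : N) (m1 : tri B) (m0 : M) : tensorA (tri B) T :=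
  tensA (m1 * n1) (tensA m0 n0).

Definition ltens_coact (x : T) : tensorA (tri B) T :=
  tlift (fun m n => tlift (fun (n1 : tri B) n0 => tlift (fun (m1 : tri B) m0 =>
    tensA (m1 * n1) (tensA m0 n0)) (lcoact M m)) (lcoact N n)) x.

Lemma ltens_pre_bal2 n1 n0 : balanced (@ract _ _ (tri B)) (@lact _ _ M) (ltens_pre n1 n0).
Proof.
rewrite /ltens_pre; split=> [m0 x y|m1 x y|m1 a m0].
- by rewrite mulrDl tensADl.
- by rewrite tensADl tensADr.
- by rewrite -ract_mul tensA_bal lact_tensA.
Qed.

Lemma ltens_pre_bal1 m : balanced (@ract _ _ (tri B)) (@lact _ _ N)
  (fun n1 n0 => tlift (ltens_pre n1 n0) (lcoact M m)).
Proof.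
split=> [n0 x y|n1 x y|n1 a n0].
- by rewrite -tlift_sumf; apply: eq_tlift => m1 m0; rewrite /ltens_pre mulrDr tensADl.
- by rewrite -tlift_sumf; apply: eq_tlift => m1 m0; rewrite /ltens_pre !tensADr.
transitivity (tlift (fun (m1 : tri B) m0 => ltens_pre n1 n0 (m1 * tgt a) m0) (lcoact M m)).
  by apply: eq_tlift => m1 m0; rewrite /ltens_pre ract_tri mulrA.
rewrite (lco_takeuchiE (lcm_ax M)); last exact: ltens_pre_bal2.
by apply: eq_tlift => m1 m0; rewrite /ltens_pre tensA_bal.
Qed.

Lemma ltens_coact_bal : balanced (@ract _ _ M) (@lact _ _ N)
  (fun m n => tlift (fun n1 n0 => tlift (ltens_pre n1 n0) (lcoact M m)) (lcoact N n)).
Proof.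
split=> [n x y|m x y|m a n].
- rewrite -tlift_sumf; apply: eq_tlift => n1 n0.
  rewrite (lco_add (lcm_ax M)); exact/tliftAD/ltens_pre_bal2.
- rewrite (lco_add (lcm_ax N)); exact/tliftAD/ltens_pre_bal1.
- rewrite (lco_delta_lactE (lcm_ax N)); last exact: ltens_pre_bal1.
  apply: eq_tlift => n1 n0; rewrite (lco_delta_ractE (lcm_ax M)); last exact: ltens_pre_bal2.
  by apply: eq_tlift => m1 m0; rewrite /ltens_pre lact_tri mulrA.
Qed.

Lemma ltens_coactE m n : ltens_coact (tensA m n) =
  tlift (fun n1 n0 => tlift (ltens_pre n1 n0) (lcoact M m)) (lcoact N n).
Proof. exact: (tliftAE _ _ ltens_coact_bal). Qed.

Lemma ltens_coactD : {morph ltens_coact : x y / x + y}.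
Proof. exact: (tliftAD ltens_coact_bal). Qed.

Lemma ltens_coact_lift (G : zmodType) (f : tri B -> T -> G) m n :
  balanced (@ract _ _ (tri B)) (@lact _ _ T) f ->
  tlift f (ltens_coact (tensA m n)) =
  tlift (fun (n1 : tri B) n0 => tlift (fun (m1 : tri B) m0 =>
    f (m1 * n1) (tensA m0 n0)) (lcoact M m)) (lcoact N n).
Proof.
move=> fb; rewrite ltens_coactE tliftA_lift //; apply: eq_tlift => n1 n0.
exact: (tliftA_tens _ _ _ fb).
Qed.

Lemma ltens_lact_eps (p : tri B) m n :
  tlift (fun (u : tri B) x => lact (eps B (u * p)) x) (ltens_coact (tensA m n)) =
  tensA m (tlift (fun (n1 : tri B) n0 => lact (eps B (n1 * p)) n0) (lcoact N n)).
Proof.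
rewrite ltens_coact_lift; last exact: lact_eps_bal.
rewrite (morph_tlift _ _ (tensADr m)); apply: eq_tlift => n1 n0.
rewrite -tensA_bal (lco_ract (lcm_ax M)) (morph_tlift _ _ (tensADl n0)).
by apply: eq_tlift => m1 m0; rewrite lact_tensA -mulrA -eps_src.
Qed.

Lemma ltens_lact a x : ltens_coact (lact a x) = lact a (ltens_coact x).
Proof.
have D := ltens_coactD.
elim/tensorA_ind: x => [m n|x y IHx IHy]; last by rewrite !(lactDr, D) IHx IHy.
rewrite lact_tensA !ltens_coactE (morph_tlift _ _ (@lactDr _ _ _ a)).
apply: eq_tlift => n1 n0; rewrite (lco_delta_lactE (lcm_ax M)); last first.
  exact: ltens_pre_bal2.
rewrite (morph_tlift _ _ (@lactDr _ _ _ a)); apply: eq_tlift => m1 m0.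
by rewrite /ltens_pre lact_tensA lact_mul.
Qed.

Section Coassoc.
Local Notation W := (tensorA (tri B) (tensorA (tri B) T)).
Let E (y : T) (p q : tri B) : W := tensA p (tensA q y).

Let E_bal y : balanced (@ract _ _ (tri B)) (@lact _ _ (tri B)) (E y).
Proof. exact: assocA_bal1. Qed.

Let ED p q : {morph (fun y => E y p q) : x y / x + y}.
Proof. by move=> x y; rewrite /E !tensADr. Qed.

Let F m (u v : tri B) (n : N) : W :=
  tlift (fun m1 m0 => tlift (fun p q : tri B => E (tensA m0 n) (p * u) (q * v))
    (Delta B m1)) (lcoact M m).

Let Emul_bal y (u v : tri B) : balanced (@ract _ _ (tri B)) (@lact _ _ (tri B))
  (fun p q : tri B => E y (p * u) (q * v)).
Proof.
case: (E_bal y) => El Er Eb; split=> [q p p'|p q q'|p a q] /=.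
- by rewrite mulrDl El.
- by rewrite mulrDl Er.
- by rewrite -ract_mul -lact_mul Eb.
Qed.

Let FM m u v n :
  tlift (fun (m1 : tri B) m0 => tlift (fun (m01 : tri B) m00 =>
    E (tensA m00 n) (m1 * u) (m01 * v)) (lcoact M m0)) (lcoact M m) = F m u v n.
Proof.
apply: (lco_coassocE (lcm_ax M) (F := fun p q m => E (tensA m n) (p * u) (q * v))).
- move=> p; split=> [m0 q q'|q x y|q a m0].
  + by case: (E_bal (tensA m0 n)) => _ Er _; rewrite mulrDl Er.
  + by rewrite tensADl ED.
  + by rewrite -ract_mul /E tensA_bal lact_tensA.
- by move=> q m0; case: (Emul_bal (tensA m0 n) u v).
- by move=> p a q m0; case: (Emul_bal (tensA m0 n) u v).
Qed.

Let F23 m u : balanced (@ract _ _ (tri B)) (@lact _ _ N) (F m u).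
Proof.
split=> [n v v'|v x y|v a n].
- rewrite -tlift_sumf; apply: eq_tlift => m1 m0.
  rewrite -tlift_sumf; apply: eq_tlift => p q.
  by rewrite mulrDr /E tensADl tensADr.
- rewrite -tlift_sumf; apply: eq_tlift => m1 m0.
  by rewrite -tlift_sumf; apply: eq_tlift => p q; rewrite tensADr ED.
pose f m1 m0 := tlift (fun p q : tri B => E (tensA m0 n) (p * u) (q * v)) (Delta B m1).
have fb : balanced (@ract _ _ (tri B)) (@lact _ _ M) f.
  rewrite /f; split=> [m0 x y|m1 x y|m1 b m0].
  - by rewrite raddfD; exact: (tliftAD (Emul_bal _ _ _)).
  - by rewrite -tlift_sumf; apply: eq_tlift => p q; rewrite tensADl ED.
  - rewrite Delta_ract ract_tensorA tliftA_tens //.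
    by apply: eq_tlift => p q; rewrite -ract_mul /E tensA_bal lact_tensA.
transitivity (tlift (fun (m1 : tri B) m0 => f (m1 * tgt a) m0) (lcoact M m)).
  apply: eq_tlift => m1 m0; rewrite /f Delta_mul_tgtE //; apply: eq_tlift => p q.
  by rewrite ract_tri mulrA.
rewrite (lco_takeuchiE (lcm_ax M)) //; apply: eq_tlift => m1 m0.
by apply: eq_tlift => p q; rewrite tensA_bal.
Qed.

Let F1 m v n : {morph (fun u => F m u v n) : u w / u + w}.
Proof.
move=> u w; rewrite -tlift_sumf; apply: eq_tlift => m1 m0.
rewrite -tlift_sumf; apply: eq_tlift => p q; rewrite mulrDr.
by case: (E_bal (tensA m0 n)) => El _ _; rewrite El.
Qed.

Let F12 m u a v n : F m (ract u a) v n = F m u (lact a v) n.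
Proof.
apply: eq_tlift => m1 m0.
pose f p q := E (tensA m0 n) (p * u) (q * v).
transitivity (tlift (fun p q : tri B => f (p * tgt a) q) (Delta B m1)).
  by apply: eq_tlift => p q; rewrite /f ract_tri mulrA.
rewrite Delta_takeuchiE; last exact: Emul_bal.
by apply: eq_tlift => p q; rewrite /f lact_tri mulrA.
Qed.

Lemma ltens_coassoc x :
  tlift (fun u y => tensA u (ltens_coact y)) (ltens_coact x) =
  tlift (fun w y => tlift (fun u v => tensA u (tensA v y)) (Delta B w)) (ltens_coact x).
Proof.
have D := ltens_coactD.
have lb : balanced (@ract _ _ (tri B)) (@lact _ _ T)
    (fun u y => tensA u (ltens_coact y) : W).
  split=> [y u v|u y z|u a y]; first by rewrite tensADl.
  - by rewrite D tensADr.
  - by rewrite ltens_lact tensA_bal.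
have rb : balanced (@ract _ _ (tri B)) (@lact _ _ T)
    (fun w y => tlift (E y) (Delta B w)).
  split=> [y u v|u y z|u a y].
  - by rewrite raddfD; exact/tliftAD/E_bal.
  - by rewrite -tlift_sumf; apply: eq_tlift => p q; exact: ED.
  - rewrite Delta_ract ract_tensorA tliftA_tens //.
    by apply: eq_tlift => p q; rewrite /E tensA_bal.
elim/tensorA_ind: x => [m n|x y IHx IHy]; last first.
  have lD := tliftAD lb; have rD := tliftAD rb.
  by rewrite D [LHS]lD [RHS]rD IHx IHy.
rewrite (ltens_coact_lift _ _ lb) (ltens_coact_lift _ _ rb).
transitivity (tlift (fun n1 n0 => tlift (fun n01 n00 => F m n1 n01 n00) (lcoact N n0))
    (lcoact N n)).
  apply: eq_tlift => n1 n0; rewrite (eq_tlift _ (fun n01 n00 => esym (FM m n1 n01 n00))).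
  rewrite [RHS]tlift_exch; apply: eq_tlift => m1 m0; rewrite ltens_coactE.
  rewrite (morph_tlift _ _ (tensADr (m1 * n1))); apply: eq_tlift => n01 n00.
  by rewrite (morph_tlift _ _ (tensADr (m1 * n1))).
rewrite (lco_coassocE (lcm_ax N) (F23 m) (F1 m) (F12 m)).
apply: eq_tlift => n1 n0; rewrite [LHS]tlift_exch; apply: eq_tlift => m1 m0.
by rewrite [LHS]tlift_exch (Delta_mulE _ _ (E_bal _)).
Qed.
End Coassoc.

Lemma ltens_counit x : tlift (fun u y => lact (eps B u) y) (ltens_coact x) = x.
Proof.
have D := ltens_coactD; have bal := @lact_eps_bal T 1.
have e : (fun (u : tri B) (y : T) => lact (eps B u) y) =
    (fun u y => lact (eps B (u * 1)) y).
  by apply/funext => u; apply/funext => y; rewrite mulr1.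
rewrite e; elim/tensorA_ind: x => [m n|x y IHx IHy]; last first.
  by rewrite D (tliftAD bal) IHx IHy.
rewrite ltens_lact_eps; congr tensA; rewrite -[RHS](lco_counit (lcm_ax N)).
by apply: eq_tlift => n1 n0; rewrite mulr1.
Qed.

Lemma ltens_ract x a :
  ract x a = tlift (fun (u : tri B) y => lact (eps B (u * src a)) y) (ltens_coact x).
Proof.
have D := ltens_coactD; have bal := @lact_eps_bal T (src a).
elim/tensorA_ind: x => [m n|x y IHx IHy]; last first.
  by rewrite D ractDl (tliftAD bal) IHx IHy.
by rewrite ltens_lact_eps ract_tensA (lco_ract (lcm_ax N)).
Qed.

Lemma ltens_ax : left_comodule_axioms ltens_coact.
Proof.
split; [exact: ltens_coactD | exact: ltens_lact | exact: ltens_coassoc |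
        exact: ltens_counit | exact: ltens_ract].
Qed.

Definition lcomod_tens : left_comodule := LeftComodule ltens_ax.
End Tensor.

Lemma lcoactD (M : left_comodule) : {morph lcoact M : x y / x + y}.
Proof. exact: lco_add (lcm_ax M). Qed.

Lemma lhom_id (M : left_comodule) : is_lcomod_hom (@id M).
Proof. by split=> // m; rewrite -[LHS]tlift_tens. Qed.

Lemma lhom_bal (M N : left_comodule) (f : M -> N) : bimod_map f ->
  balanced (@ract _ _ (tri B)) (@lact _ _ M) (fun (m1 : tri B) m0 => tensA m1 (f m0)).
Proof.
case=> fD fl _; split=> [m u v|u x y|u a m]; first by rewrite tensADl.
- by rewrite fD tensADr.
- by rewrite fl tensA_bal.
Qed.

Lemma lhom_comp (M N P : left_comodule) (g : N -> P) (f : M -> N) :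
  is_lcomod_hom g -> is_lcomod_hom f -> is_lcomod_hom (g \o f).
Proof.
move=> gP fP; have gb := lcomod_hom_bimod gP.
case: gP fP => gD gl gc [fD fl fc]; split=> [x y|a m|m] /=.
- by rewrite fD gD.
- by rewrite fl gl.
- by rewrite gc fc tliftA_tens //; exact: lhom_bal.
Qed.

Lemma lhom_tens (M N P : left_comodule) (f : tensorA M N -> P) :
  bimod_map f ->
  (forall m n, lcoact P (f (tensA m n)) =
    tlift (fun (n1 : tri B) n0 => tlift (fun (m1 : tri B) m0 =>
      tensA (m1 * n1) (f (tensA m0 n0))) (lcoact M m)) (lcoact N n)) ->
  is_lcomod_hom (M := lcomod_tens M N) (N := P) f.
Proof.
move=> fb fc; have bal := @lhom_bal (lcomod_tens M N) P f fb.
case: (fb) => fD fl _; split=> // x.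
have D := @ltens_coactD M N.
elim/tensorA_ind: x => [m n|x y IHx IHy].
  by rewrite fc /= (ltens_coact_lift _ _ bal).
by rewrite fD lcoactD IHx IHy /= D (tliftAD bal).
Qed.

Lemma lhom_pre_bal (M N : left_comodule) (P : lmodType (Aenv A))
    (f : tensorA M N -> P) m : bimod_map f ->
  balanced (@ract _ _ (tri B)) (@lact _ _ N) (fun (n1 : tri B) n0 =>
    tlift (fun (m1 : tri B) m0 => tensA (m1 * n1) (f (tensA m0 n0))) (lcoact M m)).
Proof.
case=> fD fl fr.
have hb : balanced (@ract _ _ (tri B)) (@lact _ _ (tensorA M N))
    (fun u y => tensA u (f y)).
  split=> [y u v|u x y|u a y]; first by rewrite tensADl.
  - by rewrite fD tensADr.
  - by rewrite fl tensA_bal.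
have hE n1 n0 : tlift (fun (m1 : tri B) m0 => tensA (m1 * n1) (f (tensA m0 n0)))
    (lcoact M m) =
    tlift (fun u y => tensA u (f y)) (tlift (@ltens_pre M N n1 n0) (lcoact M m)).
  by rewrite tliftA_tens.
have [Dl Dr bal] := @ltens_pre_bal1 M N m; have hD := tliftAD hb.
split=> [n0 x y|n1 x y|n1 a n0]; rewrite !hE ?Dl ?Dr ?bal //; exact: hD.
Qed.

Lemma lhom_tmap (M N M' N' : left_comodule) (f : M -> M') (g : N -> N') :
  is_lcomod_hom f -> is_lcomod_hom g ->
  is_lcomod_hom (M := lcomod_tens M N) (N := lcomod_tens M' N') (tmap f g).
Proof.
move=> fP gP; have fb := lcomod_hom_bimod fP; have gb := lcomod_hom_bimod gP.
apply: lhom_tens => [|m n]; first exact: tmap_bimod.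
rewrite tmapE // [LHS]ltens_coactE; case: fP gP => _ _ fc [_ _ gc].
rewrite gc tliftA_tens; last exact: ltens_pre_bal1.
apply: eq_tlift => n1 n0; rewrite fc tliftA_tens; last exact: ltens_pre_bal2.
by apply: eq_tlift => m1 m0; rewrite tmapE.
Qed.

Definition lunit_coact (a : regular_bimod A) : tensorA (tri B) (regular_bimod A) :=
  tensA (src (a : A) : tri B) ((1 : A) : regular_bimod A).

Lemma lunit_ax : left_comodule_axioms lunit_coact.
Proof.
split=> [a b|b a|a|a|a b]; rewrite /lunit_coact.
- by rewrite srcD tensADl.
- by rewrite lact_regular lact_tensA srcM lact_tri.
- rewrite tliftAE; last first.
    split=> [x u v|u x y|u b x]; first by rewrite tensADl.
    + by rewrite srcD tensADl tensADr.
    + by rewrite lact_regular srcM -lact_tri -[in RHS]lact_tensA tensA_bal.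
  rewrite tliftAE; last first.
    split=> [x u v|u x y|u b x].
    + rewrite raddfD; exact/tliftAD/assocA_bal1.
    + by rewrite -tlift_sumf; apply: eq_tlift => v w; rewrite !tensADr.
    + rewrite Delta_ract ract_tensorA tliftA_tens; last exact: assocA_bal1.
      by apply: eq_tlift => v w; rewrite tensA_bal.
  rewrite src1 (src_lact B a) Delta_lact Delta1 lact_tensA tliftAE //.
  exact: assocA_bal1.
- rewrite tliftAE ?lact_regular ?eps_s ?mulr1 //.
  split=> [x u v|u x y|u b x]; last by rewrite eps_ract lactM.
  + by rewrite raddfD lactDl.
  + exact: lactDr.
- rewrite tliftAE; last exact: lact_eps_bal.
  by rewrite -srcM eps_s lact_regular ract_regular mulr1.
Qed.

Definition lcomod_unit : left_comodule := LeftComodule lunit_ax.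

Lemma lhom_runitA (M : left_comodule) :
  is_lcomod_hom (M := lcomod_tens M lcomod_unit) (@runitA _ _ M).
Proof.
apply: (@lhom_tens M lcomod_unit M); first exact: runitA_bimod.
move=> m a; rewrite runitAE (lco_delta_ract (lcm_ax M)).
have bal := @lhom_pre_bal M lcomod_unit M _ m (runitA_bimod M).
rewrite /= (tliftAE _ _ bal).
by apply: eq_tlift => n1 n0; rewrite runitAE ract1.
Qed.

Lemma lhom_lunitA (M : left_comodule) :
  is_lcomod_hom (M := lcomod_tens lcomod_unit M) (@lunitA _ _ M).
Proof.
apply: (@lhom_tens lcomod_unit M M); first exact: lunitA_bimod.
move=> a m; rewrite lunitAE (lco_lact (lcm_ax M)) lact_tensorA.
apply: eq_tlift => m1 m0; rewrite /= tliftAE; first by rewrite lunitAE lact1.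
split=> [x u v|u x y|u b x].
- by rewrite mulrDl tensADl.
- by rewrite !lunitAE lactDl tensADr.
- by rewrite !lunitAE lact_regular lactM -ract_mul tensA_bal.
Qed.

Lemma lhom_inv (M N : left_comodule) (f : M -> N) (g : N -> M) :
  cancel f g -> cancel g f -> is_lcomod_hom f -> is_lcomod_hom g.
Proof.
move=> fK gK fP; have [fD fl fr] := lcomod_hom_bimod fP; case: fP => _ _ fc.
have gb : bimod_map g.
  split=> [x y|a m|m a]; apply: (can_inj fK); rewrite gK.
  - by rewrite fD !gK.
  - by rewrite fl gK.
  - by rewrite fr gK.
case: (gb) => gD gl gr; split=> // m.
rewrite -{2}(gK m) fc tliftA_tens; last exact: lhom_bal.
by rewrite -[LHS]tlift_tens; apply: eq_tlift => m1 m0; rewrite fK.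
Qed.

Lemma lhom_assocV (M N P : left_comodule) :
  is_lcomod_hom (M := lcomod_tens M (lcomod_tens N P))
    (N := lcomod_tens (lcomod_tens M N) P) (@assocV _ _ M N P).
Proof.
apply: (@lhom_tens M (lcomod_tens N P) (lcomod_tens (lcomod_tens M N) P)).
  exact: assocV_bimod.
move=> m x; have ab := @assocV_bimod _ _ M N P.
have Kb := @lhom_pre_bal M (lcomod_tens N P) _ _ m ab.
have [aD _ _] := ab; have D := @ltens_coactD N P.
elim/tensorA_ind: x => [n p|x y IHx IHy]; last first.
  by rewrite tensADr aD lcoactD IHx IHy /= D (tliftAD Kb).
rewrite assocVE [RHS](ltens_coact_lift _ _ Kb) [LHS]ltens_coactE.
apply: eq_tlift => p1 p0.
rewrite [LHS](ltens_coact_lift _ _ (@ltens_pre_bal2 (lcomod_tens M N) P p1 p0)).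
apply: eq_tlift => n1 n0; apply: eq_tlift => m1 m0.
by rewrite /ltens_pre assocVE mulrA.
Qed.

Lemma lhom_assocA (M N P : left_comodule) :
  is_lcomod_hom (M := lcomod_tens (lcomod_tens M N) P)
    (N := lcomod_tens M (lcomod_tens N P)) (@assocA _ _ M N P).
Proof.
exact: (@lhom_inv (lcomod_tens M (lcomod_tens N P)) (lcomod_tens (lcomod_tens M N) P)
  _ _ (@assocVK _ _ M N P) (@assocAK _ _ M N P) (lhom_assocV M N P)).
Qed.

End LeftComodule.

Arguments lcoact {k A B} M m : rename.

Section LeftComoduleCategory.
Variables (k : comPzRingType) (A : kalgebra k) (B : left_bialgebroid A).
Local Notation lcomod := (left_comodule B).

Definition lhom_idc (M : lcomod) : lcomod_hom M M := LcomodHom (lhom_id M).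
Definition lhom_compc (M N P : lcomod) (g : lcomod_hom N P) (f : lcomod_hom M N) :
  lcomod_hom M P := LcomodHom (lhom_comp (lch_ax g) (lch_ax f)).

Program Definition lcomod_cat : category :=
  @Category lcomod (@lcomod_hom _ _ B) lhom_idc lhom_compc _ _ _.
Next Obligation. exact: lcomod_hom_eq. Qed.
Next Obligation. exact: lcomod_hom_eq. Qed.
Next Obligation. exact: lcomod_hom_eq. Qed.

Definition lhom_tensc (M M' N N' : lcomod) (f : lcomod_hom M M') (g : lcomod_hom N N') :
  lcomod_hom (lcomod_tens M N) (lcomod_tens M' N') :=
  LcomodHom (lhom_tmap (lch_ax f) (lch_ax g)).

Program Definition lcomod_iso (M N : lcomod) (f : M -> N) (g : N -> M)
    (fK : cancel f g) (gK : cancel g f) (fP : is_lcomod_hom f) :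
  @iso lcomod_cat M N :=
  @Iso lcomod_cat M N (LcomodHom fP) (LcomodHom (lhom_inv fK gK fP)) _ _.
Next Obligation. exact: lcomod_hom_eq. Qed.
Next Obligation. exact: lcomod_hom_eq. Qed.

Definition lcomod_assoc (M N P : lcomod) :=
  @lcomod_iso (lcomod_tens (lcomod_tens M N) P) (lcomod_tens M (lcomod_tens N P))
    _ _ (@assocAK _ _ M N P) (@assocVK _ _ M N P) (lhom_assocA M N P).
Definition lcomod_lunit (M : lcomod) :=
  @lcomod_iso (lcomod_tens (lcomod_unit B) M) M
    _ _ (@lunitAK _ _ M) (@lunitVK _ _ M) (lhom_lunitA M).
Definition lcomod_runit (M : lcomod) :=
  @lcomod_iso (lcomod_tens M (lcomod_unit B)) M
    _ _ (@runitAK _ _ M) (@runitVK _ _ M) (lhom_runitA M).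

Program Definition LComod : monoidal_category :=
  @MonoidalCategory lcomod_cat (@lcomod_tens _ _ B) lhom_tensc (lcomod_unit B)
    lcomod_assoc lcomod_lunit lcomod_runit _ _ _ _ _ _ _.
Next Obligation.
apply: lcomod_hom_eq => x; exact: tmap_id.
Qed.
Next Obligation.
apply: lcomod_hom_eq => x; apply: tmap_comp; exact: (lcomod_hom_bimod (lch_ax _)).
Qed.
Next Obligation.
apply: lcomod_hom_eq => x; apply: assocA_nat; exact: (lcomod_hom_bimod (lch_ax _)).
Qed.
Next Obligation.
apply: lcomod_hom_eq => x; apply: lunitA_nat; exact: (lcomod_hom_bimod (lch_ax _)).
Qed.
Next Obligation.
apply: lcomod_hom_eq => x; apply: runitA_nat; exact: (lcomod_hom_bimod (lch_ax _)).
Qed.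
Next Obligation. apply: lcomod_hom_eq => x; exact: assocA_pentagon. Qed.
Next Obligation. apply: lcomod_hom_eq => x; exact: assocA_triangle. Qed.

End LeftComoduleCategory.

Definition projective (R : pzRingType) (P : lmodType R) : Prop :=
  forall (X Y : lmodType R) (g : {linear X -> Y}) (f : {linear P -> Y}),
    (forall y, exists x, g x = y) -> exists h : {linear P -> X}, forall p, g (h p) = f p.

Section Hopf.
Variables (k : comPzRingType) (A : kalgebra k) (B : left_bialgebroid A).

Definition mul_tgt (u : tri B) (a : A) : tri B := u * tgt a.
Definition tgt_mul (a : A) (u : tri B) : tri B := tgt a * (u : B).
Definition mul_src (u : tri B) (a : A) : tri B := u * src a.
Definition src_mul (a : A) (u : tri B) : tri B := src a * (u : B).

Definition alpha_l (x : tensor mul_tgt tgt_mul) : tensorA (tri B) (tri B) :=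
  tlift (fun u v : tri B =>
    tlift (fun u1 u2 : tri B => tensA u1 (u2 * v)) (Delta B u)) x.

Definition alpha_r (x : tensor mul_src src_mul) : tensorA (tri B) (tri B) :=
  tlift (fun u v : tri B =>
    tlift (fun u1 u2 : tri B => tensA (u1 * v) u2) (Delta B u)) x.

Lemma alpha_lE (u v : tri B) :
  alpha_l (tens u v) = tlift (fun u1 u2 : tri B => tensA u1 (u2 * v)) (Delta B u).
Proof.
have bal w : balanced (@ract _ _ (tri B)) (@lact _ _ (tri B))
    (fun u1 u2 : tri B => tensA u1 (u2 * w)).
  split=> [u2 x y|u1 x y|u1 a u2]; first by rewrite tensADl.
  - by rewrite mulrDl tensADr.
  - by rewrite -lact_mul tensA_bal.
apply: tliftE; split=> [w x y|x w w'|x a w].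
- by rewrite raddfD; exact/tliftAD/bal.
- by rewrite -tlift_sumf; apply: eq_tlift => u1 u2; rewrite mulrDr tensADr.
- rewrite Delta_mul_tgtE //; apply: eq_tlift => u1 u2.
  by rewrite /tgt_mul mulrA.
Qed.

Lemma alpha_rE (u v : tri B) :
  alpha_r (tens u v) = tlift (fun u1 u2 : tri B => tensA (u1 * v) u2) (Delta B u).
Proof.
have bal w : balanced (@ract _ _ (tri B)) (@lact _ _ (tri B))
    (fun u1 u2 : tri B => tensA (u1 * w) u2).
  split=> [u2 x y|u1 x y|u1 a u2]; first by rewrite mulrDl tensADl.
  - by rewrite tensADr.
  - by rewrite -ract_mul tensA_bal.
apply: tliftE; split=> [w x y|x w w'|x a w].
- by rewrite raddfD; exact/tliftAD/bal.
- by rewrite -tlift_sumf; apply: eq_tlift => u1 u2; rewrite mulrDr tensADl.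
- rewrite Delta_mul_srcE //; apply: eq_tlift => u1 u2.
  by rewrite /src_mul mulrA.
Qed.

Definition left_hopf : Prop := bijective alpha_l.
Definition right_hopf : Prop := bijective alpha_r.

(* $u_+ \otimes_{A^{op}} u_- = \alpha_\ell^{-1}(u \otimes 1)$ and
   $u_{[+]} \otimes^A u_{[-]} = \alpha_r^{-1}(1 \otimes u)$; only meaningful under
   [left_hopf], resp. [right_hopf] *)
Definition trans_l (u : tri B) : tensor mul_tgt tgt_mul :=
  xget 0 [set x | alpha_l x = tensA u (1 : tri B)].
Definition trans_r (u : tri B) : tensor mul_src src_mul :=
  xget 0 [set x | alpha_r x = tensA (1 : tri B) u].

End Hopf.

(* The assignment $m \otimes u \otimes v \mapsto v \otimes m \epsilon(u)$ is not
   balanced over $A^{op}$ on $(M \otimes_A U) \otimes_{A^{op}} U_\triangleleft$; it is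
   on $(M \times_A U) \otimes_{A^{op}} U_\triangleleft$, with $M \times_A U$ the
   Takeuchi product. So $m_{(1)-} \otimes_A m_{(0)} \epsilon(m_{(1)+})$ is read off from
   a decomposition of $m_{(0)} \otimes_A m_{(1)+} \otimes_{A^{op}} m_{(1)-}$ whose
   first components lie in $M \times_A U$. *)
Section RightToLeft.
Variables (k : comPzRingType) (A : kalgebra k) (B : left_bialgebroid A).

Section Object.
Variable M : right_comodule B.

Definition rtakeuchi (x : tensorA M (tri B)) : Prop := forall a,
  tlift (fun m u => tensA (lact a m) u) x =
  tlift (fun m (u : tri B) => tensA m (u * src a)) x.

Definition id_mul_tgt (x : tensorA M (tri B)) (a : A) : tensorA M (tri B) :=
  tlift (fun m (u : tri B) => tensA m (u * tgt a)) x.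

Definition id_eps (x : tensorA M (tri B)) : M := tlift (fun m u => ract m (eps B u)) x.

Definition id_trans_l (x : tensorA M (tri B)) : tensor id_mul_tgt (@tgt_mul _ _ B) :=
  tlift (fun m u => tlift (fun p q => tens (tensA m p : tensorA M (tri B)) q)
    (trans_l u)) x.

Definition to_left_spec (m : M) (y : tensorA (tri B) M) : Prop :=
  exists c : seq (tensorA M (tri B) * tri B)%type,
    [/\ forall w, w \in c -> rtakeuchi w.1,
        fsum c = id_trans_l (rcoact M m) &
        y = \sum_(w <- c) tensA w.2 (id_eps w.1)].

Definition to_left_coact (m : M) : tensorA (tri B) M := xget 0 [set y | to_left_spec m y].
End Object.

Section Functor.
Hypothesis ob_ax : forall M : right_comodule B,
  left_comodule_axioms (N := M) (@to_left_coact M).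
Definition to_left_ob (M : RComod B) : LComod B := LeftComodule (ob_ax M).

Hypothesis hom_ax : forall (M N : right_comodule B) (f : rcomod_hom M N),
  is_lcomod_hom (M := LeftComodule (ob_ax M)) (N := LeftComodule (ob_ax N)) f.
Definition to_left_hom (M N : RComod B) (f : hom M N) :
  hom (to_left_ob M) (to_left_ob N) := LcomodHom (hom_ax f).

Lemma to_left_hom1 (M : RComod B) : to_left_hom (idc M) = idc (to_left_ob M).
Proof. exact: lcomod_hom_eq. Qed.

Lemma to_left_homM (M N P : RComod B) (g : hom N P) (f : hom M N) :
  to_left_hom (compc g f) = compc (to_left_hom g) (to_left_hom f).
Proof. exact: lcomod_hom_eq. Qed.

Definition to_left : functor (RComod B) (LComod B) :=
  Functor to_left_hom1 to_left_homM.
End Functor.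
End RightToLeft.

(* Likewise $u \otimes n \otimes v \mapsto \epsilon(u) n \otimes v$ is balanced only on
   $(U_\triangleleft \times_A N) \otimes^A {}_\triangleright U$. *)
Section LeftToRight.
Variables (k : comPzRingType) (A : kalgebra k) (B : left_bialgebroid A).

Section Object.
Variable N : left_comodule B.

Definition ltakeuchi (x : tensorA (tri B) N) : Prop := forall a,
  tlift (fun (u : tri B) n => tensA (u * tgt a) n) x =
  tlift (fun u n => tensA u (ract n a)) x.

Definition mul_src_id (x : tensorA (tri B) N) (a : A) : tensorA (tri B) N :=
  tlift (fun (u : tri B) n => tensA (u * src a) n) x.

Definition eps_id (x : tensorA (tri B) N) : N := tlift (fun u n => lact (eps B u) n) x.

Definition trans_r_id (x : tensorA (tri B) N) : tensor mul_src_id (@src_mul _ _ B) :=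
  tlift (fun u n => tlift (fun p q => tens (tensA p n : tensorA (tri B) N) q)
    (trans_r u)) x.

Definition to_right_spec (n : N) (y : tensorA N (tri B)) : Prop :=
  exists c : seq (tensorA (tri B) N * tri B)%type,
    [/\ forall w, w \in c -> ltakeuchi w.1,
        fsum c = trans_r_id (lcoact N n) &
        y = \sum_(w <- c) tensA (eps_id w.1) w.2].

Definition to_right_coact (n : N) : tensorA N (tri B) :=
  xget 0 [set y | to_right_spec n y].
End Object.

Section Functor.
Hypothesis ob_ax : forall N : left_comodule B,
  right_comodule_axioms (M := N) (@to_right_coact N).
Definition to_right_ob (N : LComod B) : RComod B := RightComodule (ob_ax N).

Hypothesis hom_ax : forall (M N : left_comodule B) (f : lcomod_hom M N),
  is_rcomod_hom (M := RightComodule (ob_ax M)) (N := RightComodule (ob_ax N)) f.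
Definition to_right_hom (M N : LComod B) (f : hom M N) :
  hom (to_right_ob M) (to_right_ob N) := RcomodHom (hom_ax f).

Lemma to_right_hom1 (M : LComod B) : to_right_hom (idc M) = idc (to_right_ob M).
Proof. exact: rcomod_hom_eq. Qed.

Lemma to_right_homM (M N P : LComod B) (g : hom N P) (f : hom M N) :
  to_right_hom (compc g f) = compc (to_right_hom g) (to_right_hom f).
Proof. exact: rcomod_hom_eq. Qed.

Definition to_right : functor (LComod B) (RComod B) :=
  Functor to_right_hom1 to_right_homM.
End Functor.
End LeftToRight.

(* Main.v *)
Require Import Defs.
From HB Require Import structures.
From mathcomp Require Import all_boot all_algebra.
From mathcomp Require Import boolp classical_sets functions.

Set Implicit Arguments.
Unset Strict Implicit.
Unset Printing Implicit Defensive.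

Import GRing.Theory.
Local Open Scope ring_scope.

(* For a right comodule $M$ the map
   $\Phi : U_\triangleleft \otimes_A M \to M \otimes_A {}_\triangleright U$,
   $u \otimes m \mapsto m_{(0)} \otimes m_{(1)} u$, is an isomorphism of bimodules, and
   the left coaction of the theorem is $m \mapsto \Phi^{-1}(m \otimes 1)$; every axiom
   and every compatibility then follows by applying $\Phi$, and the two constructions
   are inverse to each other because $\Phi'(\rho(m)) = 1 \otimes m$ for the mirrored
   map $\Phi'(n \otimes u) = n_{(-1)} u \otimes n_{(0)}$.

   Projectivity enters through dual bases $u = \sum_i t(f_i(u)) e_i$. For a right
   $A$-linear form $f$ put $g_f(v, w) = v_+ t(f(v_- w))$ and
   $\theta_f(m \otimes w) = m_{(0)} \otimes g_f(m_{(1)}, w)$. From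
   $u_{(1)+} \otimes u_{(1)-} u_{(2)} = u \otimes 1$ one gets
   $\theta_f(\Phi(u \otimes m)) = \rho(f(u) m)$, hence
   $y = \sum_i e_i \otimes (id \otimes \epsilon) \theta_{f_i}(\Phi(y))$ and $\Phi$ is
   injective. Moreover $\Delta(g_f(u, w)) = u_{(1)} \otimes g_f(u_{(2)}, w)$, so
   $\theta_f(m \otimes 1)$ lies in the image of $\rho$, which yields a preimage of
   $m \otimes 1$. *)

(** * Finite dual bases from a splitting of a free cover *)

Section FreeCover.
Variables (R : pzRingType) (P : lmodType R).

(* The pairs $(\delta_p, p)$ span a free module in which a combination carries its own
   value in [P], so that the cover of [P] is the second projection. *)
Definition basis_pair (p : P) : (P -> R^o) * P :=
  (fun q => (p == q)%:R : R^o, p).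

Definition free_span : {pred (P -> R^o) * P} :=
  fun x => `[< exists c : seq (R * P), x = \sum_(w <- c) w.1 *: basis_pair w.2 >].

Lemma free_span_submod : submod_closed free_span.
Proof.
split=> [|a x y /asboolP[c ->] /asboolP[d ->]].
  by apply/asboolP; exists [::]; rewrite big_nil.
apply/asboolP; exists ([seq (a * w.1, w.2) | w <- c] ++ d).
rewrite big_cat big_map /= scaler_sumr; congr (_ + _).
by apply: eq_bigr => w _; rewrite scalerA.
Qed.

HB.instance Definition _ :=
  GRing.isSubmodClosed.Build R _ free_span free_span_submod.

Record free_cover := FreeCover { fc_val :> (P -> R^o) * P; _ : fc_val \in free_span }.
HB.instance Definition _ := [isSub for fc_val].
HB.instance Definition _ := [Choice of free_cover by <:].
HB.instance Definition _ := [SubChoice_isSubLmodule of free_cover by <:].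

Definition free_proj (x : free_cover) : P := (val x).2.

Lemma fc_valZ a (x : free_cover) : fc_val (a *: x) = a *: fc_val x.
Proof. exact: (linearZ_LR (val : {linear free_cover -> _})). Qed.
Lemma free_proj_linear : linear free_proj. Proof. by []. Qed.

HB.instance Definition _ := GRing.isLinear.Build R free_cover P _ free_proj free_proj_linear.

(** Projectivity splits the free cover by [h], and [f q x] is the coordinate of [h x] at [q].
    Restricting to the finitely many [x] in [s] keeps [e] finite: it collects the basis elements
    occurring in their expansions. *)
Lemma projective_dual_basis (s : seq P) : projective P ->
  exists (e : seq P) (f : P -> P -> R),
    [/\ forall q, {morph f q : x y / x + y},
      forall q a x, f q (a *: x) = a * f q x &
      {in s, forall x, x = \sum_(q <- e) f q x *: q}].
Proof.
move=> Pproj.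
have [|h hK] := Pproj _ _ (free_proj : {linear free_cover -> P}) (idfun : {linear P -> P}).
  move=> p.
  have pP : basis_pair p \in free_span.
    by apply/asboolP; exists [:: (1, p)]; rewrite big_seq1 scale1r.
  by exists (Sub (basis_pair p) pP : free_cover); rewrite /= /free_proj SubK.
have hK' x : (val (h x)).2 = x by exact: hK.
pose f (q x : P) : R := (val (h x)).1 q.
have span x : exists c : seq (R * P), val (h x) = \sum_(w <- c) w.1 *: basis_pair w.2.
  exact/asboolP/(valP (h x)).
have [c cP] := choice span.
(* Duplicates are removed because [f q x] already adds up all occurrences of [q] in [c x]. *)
exists (undup (flatten [seq map snd (c x) | x <- s])), f; split=> [q x y|q a x|x xs].
- by rewrite /f linearD.
- have -> : f q (a *: x) = (val (a *: h x)).1 q.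
    by rewrite /f; congr ((val _).1 q); exact: (linearZ_LR h).
  by rewrite [val _]fc_valZ.
have xE : x = \sum_(w <- c x) w.1 *: w.2.
  rewrite -{1}(hK' x) cP.
  by rewrite (big_morph (@snd _ P) (fun _ _ => erefl) erefl).
have fE q : f q x = \sum_(w <- c x) w.1 * (w.2 == q)%:R.
  rewrite /f cP (big_morph (fun z : (P -> R^o) * P => z.1 q) (id1 := 0) (op1 := +%R)) //.
rewrite {1}xE.
transitivity (\sum_(q <- undup (flatten [seq map snd (c x) | x <- s]))
   \sum_(w <- c x) (w.1 * (w.2 == q)%:R) *: q); last first.
  by apply: eq_bigr => q _; rewrite fE scaler_suml.
rewrite exchange_big /=; apply: eq_big_seq => w wc.
rewrite (bigD1_seq w.2) ?undup_uniq //=; last first.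
  rewrite mem_undup; apply/flattenP; exists (map snd (c x)); exact: map_f.
rewrite eqxx mulr1 big1 ?addr0 // => q.
by rewrite eq_sym => /negPf->; rewrite mulr0 scale0r.
Qed.
End FreeCover.

(** * Dual bases for the two one-sided actions on an $A^e$-module *)

Section DualBases.
Variables (k : comPzRingType) (A : kalgebra k) (V : lmodType (Aenv A)) (s : seq V).

Lemma rmodule_dual_basis : projective (rmodule_of V) ->
  exists (e : seq V) (f : V -> V -> A),
    [/\ forall q, {morph f q : x y / x + y},
      forall q x a, f q (ract x a) = f q x * a &
      {in s, forall x, x = \sum_(q <- e) ract q (f q x)}].
Proof.
move=> /(projective_dual_basis (s : seq (rmodule_of V)))[e [f [fD fZ fE]]].
(* Scalars live in the converse ring, whose product of [a] and [f q x] is [f q x * a]; linearity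
   over it is right linearity over $A$. *)
exists e, f; split=> // q x a; exact: fZ.
Qed.

Lemma lmodule_dual_basis : projective (lmodule_of V) ->
  exists (e : seq V) (f : V -> V -> A),
    [/\ forall q, {morph f q : x y / x + y},
      forall q a x, f q (lact a x) = a * f q x &
      {in s, forall x, x = \sum_(q <- e) lact (f q x) q}].
Proof.
move=> /(projective_dual_basis (s : seq (lmodule_of V)))[e [f [fD fZ fE]]].
exists e, f; split=> // q x a; exact: fZ.
Qed.
End DualBases.

Section TensorExtra.
Variables (S S' : Type) (M N M' N' G : zmodType) (r : M -> S -> M) (l : S -> N -> N)
  (r' : M' -> S' -> M') (l' : S' -> N' -> N').

Lemma tlift_tlift (f : M -> N -> G) (g : M' -> N' -> tensor r l) (x : tensor r' l') :
  balanced r l f -> tlift f (tlift g x) = tlift (fun m n => tlift f (g m n)) x.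
Proof. by move=> fb; rewrite (morph_tlift _ _ (tliftD fb)). Qed.

Lemma tlift_tlift_tens (f : M -> N -> G) (g : M' -> N' -> M) (h : M' -> N' -> N)
    (x : tensor r' l') : balanced r l f ->
  tlift f (tlift (fun m n => tens (g m n) (h m n) : tensor r l) x) =
  tlift (fun m n => f (g m n) (h m n)) x.
Proof.
by move=> fb; rewrite tlift_tlift //; apply: eq_tlift => m n; rewrite tliftE.
Qed.
End TensorExtra.

(** * Coassociativity of the coproduct in Sweedler form *)

Section CoassocDelta.
Variables (k : comPzRingType) (A : kalgebra k) (B : left_bialgebroid A).
Local Notation U := (tri B).
Variables (G : zmodType) (F : U -> U -> U -> G).
Hypotheses (F12 : forall w, balanced (@ract _ _ U) (@lact _ _ U) (fun u v => F u v w))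
  (F3 : forall u v, {morph F u v : w w' / w + w'})
  (F23 : forall u v a w, F u (ract v a) w = F u v (lact a w)).

(** The hypotheses make [F] balanced across both tensor signs, so it descends to the iterated tensor
    product and can be applied to both sides of [Delta_coassoc]. *)
Lemma Delta_coassocE w :
  tlift (fun u v => tlift (fun u1 u2 => F u1 u2 v) (Delta B u)) (Delta B w) =
  tlift (fun u v => tlift (fun v1 v2 => F u v1 v2) (Delta B v)) (Delta B w).
Proof.
pose h (x : tensorA U U) (v : U) : G := tlift (fun u1 u2 => F u1 u2 v) x.
have hDl v : {morph h^~ v : x y / x + y} by exact/tliftAD/F12.
have hE u v x : h (tensA u v) x = F u v x by exact/tliftAE/F12.
have hb : balanced (@ract _ _ (tensorA U U)) (@lact _ _ U) h.
  split=> [||x a v] //.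
    by move=> x v v'; rewrite /h -tlift_sumf; apply: eq_tlift => u1 u2; rewrite F3.
  elim/tensorA_ind: x => [u1 u2|x y IHx IHy]; first by rewrite ract_tensA !hE F23.
  by rewrite ractDl !hDl IHx IHy.
have := congr1 (tlift h) (Delta_coassoc w).
rewrite tliftA_tens // tliftA_lift // => ->; apply: eq_tlift => u v.
by rewrite tliftA_tens //; apply: eq_tlift => v1 v2; rewrite hE.
Qed.
End CoassocDelta.

(** * Translation map of a left Hopf algebroid and the contractions $g_f$ *)

Section LeftHopf.
Variables (k : comPzRingType) (A : kalgebra k) (B : left_bialgebroid A).
Local Notation U := (tri B).

Local Notation UopU := (tensor (@mul_tgt _ _ B) (@tgt_mul _ _ B)).

Lemma alpha_l_bal :
  balanced (@mul_tgt _ _ B) (@tgt_mul _ _ B)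
   (fun u v : U => tlift (fun u1 u2 : U => tensA u1 (u2 * v)) (Delta B u)).
Proof.
split=> [w x y|x w w'|x a w].
- by rewrite raddfD; exact/tliftAD/mul_bal2.
- by rewrite -tlift_sumf; apply: eq_tlift => u1 u2; rewrite mulrDr tensADr.
- rewrite Delta_mul_tgtE; last exact: mul_bal2.
  by apply: eq_tlift => u1 u2; rewrite /tgt_mul mulrA.
Qed.

Lemma alpha_lD : {morph @alpha_l _ _ B : x y / x + y}.
Proof. exact/tliftD/alpha_l_bal. Qed.

Lemma alpha_l_tlift (S : Type) (M N : zmodType) (r : M -> S -> M) (l : S -> N -> N)
    (F : M -> N -> UopU) (x : tensor r l) :
  alpha_l (tlift F x) = tlift (fun m n => alpha_l (F m n)) x.
Proof. exact/morph_tlift/alpha_lD. Qed.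

Lemma alpha_l_mulr (p q w : U) :
  alpha_l (tens p (q * w)) = tlift (fun u v : U => tensA u (v * w)) (alpha_l (tens p q)).
Proof.
rewrite !alpha_lE tliftA_tens; last exact: mul_bal2.
by apply: eq_tlift => u v; rewrite mulrA.
Qed.

Hypothesis Bl : left_hopf B.

Lemma alpha_l_inj : injective (@alpha_l _ _ B).
Proof. exact: bij_inj. Qed.

(** Surjectivity of [alpha_l] provides a preimage, so [xget] does not fall back on its default value
    0. *)
Lemma trans_lK (u : U) : alpha_l (trans_l u) = tensA u (1 : U).
Proof.
have [g _ gK] := Bl.
apply: (@xgetPex _ 0 (fun x => alpha_l x = tensA u (1 : U))).
by exists (g (tensA u (1 : U))).
Qed.

Lemma trans_lD : {morph @trans_l _ _ B : u v / u + v}.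
Proof. by move=> u v; apply: alpha_l_inj; rewrite alpha_lD !trans_lK tensADl. Qed.

(** $\alpha_\ell$ commutes with right multiplication on the second factor, so $u_+ \otimes u_- w$ is
    the preimage of $u \otimes w$. The three identities that follow are proved by comparing images
    under the injective [alpha_l]. *)
Lemma alpha_l_trans (u w : U) :
  alpha_l (tlift (fun p q : U => tens p (q * w)) (trans_l u)) = tensA u w.
Proof.
rewrite alpha_l_tlift.
transitivity (tlift (fun u v : U => tensA u (v * w)) (alpha_l (trans_l u))).
  rewrite -[in RHS](tlift_tens (trans_l u)) alpha_l_tlift tliftA_lift; last exact: mul_bal2.
  by apply: eq_tlift => p q; rewrite alpha_l_mulr.
by rewrite trans_lK (tliftAE _ _ (mul_bal2 U w)) mul1r.
Qed.

(** The image of both sides is $t(a) u \otimes 1 = u \otimes s(a)$. *)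
Lemma trans_l_ract (u : U) a :
  trans_l (ract u a) = tlift (fun p q : U => tens p (q * src a)) (trans_l u).
Proof.
by apply: alpha_l_inj; rewrite alpha_l_trans trans_lK tensA_bal -src_lact.
Qed.

Lemma trans_l_lact a (u : U) :
  trans_l (lact a u) = tlift (fun p q : U => tens (lact a p : U) q) (trans_l u).
Proof.
apply: alpha_l_inj; rewrite trans_lK -lact_tensA -trans_lK.
rewrite -[in LHS](tlift_tens (trans_l u)) !alpha_l_tlift (morph_tlift _ _ (@lactDr _ _ _ a)).
apply: eq_tlift => p q; rewrite !alpha_lE Delta_lact !lact_tensorA.
rewrite (tliftA_tens _ _ _ (mul_bal2 U q)) (tliftA_tens _ _ _ (lact_bal1 B U a)) //.
Qed.

(** Both sides have image $\Delta(u)$ under $\alpha_\ell$. *)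
Lemma trans_l_Delta (u : U) :
  tlift (fun u1 u2 => tlift (fun p q : U => tens p (q * u2) : UopU) (trans_l u1)) (Delta B u) =
  tens u (1 : U).
Proof.
apply: alpha_l_inj; rewrite alpha_l_tlift alpha_lE.
by apply: eq_tlift => u1 u2; rewrite alpha_l_trans mulr1.
Qed.

(** Apply $u \otimes v \mapsto s(\epsilon(u)) v$ to $\alpha_\ell(u_+ \otimes u_-) = u \otimes 1$;
    the counit contracts $s(\epsilon(p_{(1)})) p_{(2)} q$ to $p q$. *)
Lemma trans_l_mul (u : U) : tlift (fun p q : U => p * q) (trans_l u) = src (eps B u).
Proof.
have bal := lact_eps_bal0 B.
transitivity (tlift (fun u v : U => lact (eps B u) v) (alpha_l (trans_l u))).
  rewrite -[in RHS](tlift_tens (trans_l u)) alpha_l_tlift tliftA_lift //.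
  apply: eq_tlift => p q; rewrite alpha_lE tliftA_tens //.
  transitivity (tlift (fun u v : U => lact (eps B u) v) (Delta B p) * q).
    by rewrite eps_counitl.
  rewrite (morph_tlift _ _ (h := fun x : U => x * q)) => [|x y]; last exact: mulrDl.
  by apply: eq_tlift => u1 u2; rewrite lact_mul.
by rewrite trans_lK tliftAE // -src_lact.
Qed.

Section Contract.
Variables (f : U -> A) (fD : {morph f : x y / x + y})
  (fR : forall u a, f (ract u a) = f u * a).

(* $g_f(v, w)$ *)
Definition contract_l (v w : U) : U :=
  tlift (fun p q : U => p * tgt (f (q * w))) (trans_l v).

(** Right linearity gives $f(t(a) q w) = f(q w) a$, and $t$ reverses products, so $t(a)$ may pass
    between the two factors. *)
Lemma contract_l_bal w : balanced (@mul_tgt _ _ B) (@tgt_mul _ _ B)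
  (fun p q : U => p * tgt (f (q * w)) : U).
Proof.
split=> [q x y|p x y|p a q]; first exact: mulrDl.
- by rewrite mulrDl fD tgtD mulrDr.
- by rewrite /mul_tgt /tgt_mul -[tgt a * _ * w]mulrA -ract_tri fR tgtM mulrA.
Qed.

Lemma contract_lDl w : {morph contract_l^~ w : v v' / v + v'}.
Proof. by move=> v v'; rewrite /contract_l trans_lD; exact/tliftD/contract_l_bal. Qed.

Lemma contract_lDr v : {morph contract_l v : w w' / w + w'}.
Proof.
move=> w w'; rewrite /contract_l -tlift_sumf; apply: eq_tlift => p q.
by rewrite mulrDr fD tgtD mulrDr.
Qed.

Lemma contract_l_lact a v w : contract_l (lact a v) w = lact a (contract_l v w).
Proof.
rewrite /contract_l trans_l_lact (tlift_tlift_tens _ _ _ (contract_l_bal w)).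
by rewrite (morph_tlift _ _ (@lactDr _ _ _ a)); apply: eq_tlift => p q; rewrite lact_mul.
Qed.

Lemma contract_l_ract v a w : contract_l (ract v a) w = contract_l v (lact a w).
Proof.
rewrite /contract_l trans_l_ract (tlift_tlift_tens _ _ _ (contract_l_bal w)).
by apply: eq_tlift => p q; rewrite lact_tri mulrA.
Qed.

(** Contract $v_{(1)+} \otimes v_{(1)-} v_{(2)} = v \otimes 1$ by $p \otimes q \mapsto p\, t(f(q
    w))$. *)
Lemma contract_l_Delta v w :
  tlift (fun v1 v2 => contract_l v1 (v2 * w)) (Delta B v) = v * tgt (f w).
Proof.
have bal := contract_l_bal w.
have := congr1 (tlift (fun p q : U => p * tgt (f (q * w)) : U)) (trans_l_Delta v).
rewrite (tliftE _ _ bal) mul1r => <-; rewrite tlift_tlift //; apply: eq_tlift => v1 v2.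
by rewrite tlift_tlift_tens //; apply: eq_tlift => p q; rewrite mulrA.
Qed.

Lemma tens_contract_l_bal w : balanced (@ract _ _ U) (@lact _ _ U)
  (fun u v : U => tensA u (contract_l v w)).
Proof.
split=> [v u u'|u v v'|u a v]; first exact: tensADl.
- by rewrite contract_lDl tensADr.
- by rewrite contract_l_lact tensA_bal.
Qed.

(** The right side is a balanced function [X] of $u \otimes w$, which is rewritten as
    $\alpha_\ell(u_+ \otimes u_- w)$. On $p \otimes q$ coassociativity produces $p_{(1)} \otimes
    g_f(p_{(2)}, p_{(3)} q w)$, which [contract_l_Delta] collapses to $p_{(1)} \otimes p_{(2)} t(f(q
    w)) = \Delta(p\, t(f(q w)))$. *)
Lemma Delta_contract_l u w : Delta B (contract_l u w) =
  tlift (fun u1 u2 : U => tensA u1 (contract_l u2 w)) (Delta B u).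
Proof.
pose X v x : tensorA U U := tlift (fun v1 v2 => tensA v1 (contract_l v2 x)) (Delta B v).
have Xb : balanced (@ract _ _ U) (@lact _ _ U) X.
  split=> [x v v'|v x y|v a x].
  - by rewrite /X raddfD; exact/tliftAD/tens_contract_l_bal.
  - by rewrite -tlift_sumf; apply: eq_tlift => v1 v2; rewrite contract_lDr tensADr.
  - rewrite /X Delta_ract ract_tensorA tliftA_tens; last exact: tens_contract_l_bal.
    by apply: eq_tlift => v1 v2; rewrite contract_l_ract.
transitivity (tlift X (tensA u w)); last exact: tliftAE.
rewrite -alpha_l_trans alpha_l_tlift tliftA_lift //.
rewrite /contract_l (morph_tlift _ _ (@raddfD _ _ (Delta B))); apply: eq_tlift => p q.
rewrite /= Delta_mul_tgt alpha_lE tliftA_tens // /X.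
rewrite (Delta_coassocE (F := fun u v x => tensA u (contract_l v (x * (q * w))))).
- apply: eq_tlift => u1 u2; rewrite -contract_l_Delta.
  exact: (morph_tlift _ _ (tensADr u1)).
- by move=> x; exact: tens_contract_l_bal.
- by move=> u1 u2 x y; rewrite mulrDl contract_lDr tensADr.
- by move=> u1 u2 a x; rewrite contract_l_ract lact_mul.
Qed.
End Contract.
End LeftHopf.

(** * Translation map of a right Hopf algebroid and the mirrored contractions *)

Section RightHopf.
Variables (k : comPzRingType) (A : kalgebra k) (B : left_bialgebroid A).
Local Notation U := (tri B).
Local Notation UoU := (tensor (@mul_src _ _ B) (@src_mul _ _ B)).

Lemma mul_bal1 (N : lmodType (Aenv A)) (w : U) : balanced (@ract _ _ U) (@lact _ _ N)
  (fun (u : U) n => tensA (u * w) n).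
Proof.
split=> [n u v|u m n|u a n]; first by rewrite mulrDl tensADl.
- by rewrite tensADr.
- by rewrite -ract_mul tensA_bal.
Qed.

Lemma ract_bal1 (N : lmodType (Aenv A)) (a : A) : balanced (@ract _ _ U) (@lact _ _ N)
  (fun (u : U) n => tensA u (ract n a)).
Proof.
split=> [n u v|u m n|u b n]; first by rewrite tensADl.
- by rewrite ractDl tensADr.
- by rewrite tensA_bal lact_ract.
Qed.

Lemma alpha_r_bal : balanced (@mul_src _ _ B) (@src_mul _ _ B)
   (fun u v : U => tlift (fun u1 u2 : U => tensA (u1 * v) u2) (Delta B u)).
Proof.
split=> [w x y|x w w'|x a w].
- by rewrite raddfD; exact/tliftAD/mul_bal1.
- by rewrite -tlift_sumf; apply: eq_tlift => u1 u2; rewrite mulrDr tensADl.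
- rewrite Delta_mul_srcE; last exact: mul_bal1.
  by apply: eq_tlift => u1 u2; rewrite /src_mul mulrA.
Qed.

Lemma alpha_rD : {morph @alpha_r _ _ B : x y / x + y}.
Proof. exact/tliftD/alpha_r_bal. Qed.

Lemma alpha_r_tlift (S : Type) (M N : zmodType) (r : M -> S -> M) (l : S -> N -> N)
    (F : M -> N -> UoU) (x : tensor r l) :
  alpha_r (tlift F x) = tlift (fun m n => alpha_r (F m n)) x.
Proof. exact/morph_tlift/alpha_rD. Qed.

Lemma alpha_r_mulr (p q w : U) :
  alpha_r (tens p (q * w)) = tlift (fun u v : U => tensA (u * w) v) (alpha_r (tens p q)).
Proof.
rewrite !alpha_rE tliftA_tens; last exact: mul_bal1.
by apply: eq_tlift => u v; rewrite mulrA.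
Qed.

Hypothesis Br : right_hopf B.

Lemma alpha_r_inj : injective (@alpha_r _ _ B).
Proof. exact: bij_inj. Qed.

Lemma trans_rK (u : U) : alpha_r (trans_r u) = tensA (1 : U) u.
Proof.
have [g _ gK] := Br.
apply: (@xgetPex _ 0 (fun x => alpha_r x = tensA (1 : U) u)).
by exists (g (tensA (1 : U) u)).
Qed.

Lemma trans_rD : {morph @trans_r _ _ B : u v / u + v}.
Proof. by move=> u v; apply: alpha_r_inj; rewrite alpha_rD !trans_rK tensADr. Qed.

Lemma alpha_r_trans (u w : U) :
  alpha_r (tlift (fun p q : U => tens p (q * w)) (trans_r u)) = tensA w u.
Proof.
rewrite alpha_r_tlift.
transitivity (tlift (fun u v : U => tensA (u * w) v) (alpha_r (trans_r u))).
  rewrite -[in RHS](tlift_tens (trans_r u)) alpha_r_tlift tliftA_lift; last exact: mul_bal1.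
  by apply: eq_tlift => p q; rewrite alpha_r_mulr.
by rewrite trans_rK (tliftAE _ _ (mul_bal1 U w)) mul1r.
Qed.

(** Here $1 \otimes s(a) u = t(a) \otimes u$, so the scalar reaches the last factor through the
    target map. *)
Lemma trans_r_lact a (u : U) :
  trans_r (lact a u) = tlift (fun p q : U => tens p (q * tgt a)) (trans_r u).
Proof.
by apply: alpha_r_inj; rewrite alpha_r_trans trans_rK -tensA_bal -tgt_ract.
Qed.

Lemma trans_r_ract (u : U) a :
  trans_r (ract u a) = tlift (fun p q : U => tens (ract p a : U) q) (trans_r u).
Proof.
apply: alpha_r_inj; rewrite trans_rK -ract_tensA -trans_rK.
rewrite -[in LHS](tlift_tens (trans_r u)) !alpha_r_tlift (morph_tlift _ _ (@ractDl _ _ _ a)).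
apply: eq_tlift => p q; rewrite !alpha_rE Delta_ract !ract_tensorA.
by rewrite (tliftA_tens _ _ _ (mul_bal1 U q)) (tliftA_tens _ _ _ (ract_bal1 U a)).
Qed.

Lemma trans_r_Delta (u : U) :
  tlift (fun u1 u2 => tlift (fun p q : U => tens p (q * u1) : UoU) (trans_r u2))
    (Delta B u) = tens u (1 : U).
Proof.
apply: alpha_r_inj; rewrite alpha_r_tlift alpha_rE.
by apply: eq_tlift => u1 u2; rewrite alpha_r_trans mulr1.
Qed.

Lemma trans_r_mul (u : U) : tlift (fun p q : U => p * q) (trans_r u) = tgt (eps B u).
Proof.
have bal := ract_eps_bal0 B.
transitivity (tlift (fun u v : U => ract u (eps B v)) (alpha_r (trans_r u))).
  rewrite -[in RHS](tlift_tens (trans_r u)) alpha_r_tlift tliftA_lift //.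
  apply: eq_tlift => p q; rewrite alpha_rE tliftA_tens //.
  transitivity (tlift (fun u v : U => ract u (eps B v)) (Delta B p) * q).
    by rewrite eps_counitr.
  rewrite (morph_tlift _ _ (h := fun x : U => x * q)) => [|x y]; last exact: mulrDl.
  by apply: eq_tlift => u1 u2; rewrite ract_mul.
by rewrite trans_rK tliftAE // -tgt_ract.
Qed.

Section Contract.
Variables (f : U -> A) (fD : {morph f : x y / x + y})
  (fL : forall a u, f (lact a u) = a * f u).

(** The mirror of $g_f$ for a left linear form. The source map replaces the target map because $u
    s(a) \otimes v = u \otimes s(a) v$ in the domain of $\alpha_r$. *)
Definition contract_r (v w : U) : U :=
  tlift (fun p q : U => p * src (f (q * w))) (trans_r v).

Lemma contract_r_bal w : balanced (@mul_src _ _ B) (@src_mul _ _ B)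
  (fun p q : U => p * src (f (q * w)) : U).
Proof.
split=> [q x y|p x y|p a q]; first exact: mulrDl.
- by rewrite mulrDl fD srcD mulrDr.
- by rewrite /mul_src /src_mul -[src a * _ * w]mulrA -lact_tri fL srcM mulrA.
Qed.

Lemma contract_rDl w : {morph contract_r^~ w : v v' / v + v'}.
Proof. by move=> v v'; rewrite /contract_r trans_rD; exact/tliftD/contract_r_bal. Qed.

Lemma contract_rDr v : {morph contract_r v : w w' / w + w'}.
Proof.
move=> w w'; rewrite /contract_r -tlift_sumf; apply: eq_tlift => p q.
by rewrite mulrDr fD srcD mulrDr.
Qed.

Lemma contract_r_ract v a w : contract_r (ract v a) w = ract (contract_r v w) a.
Proof.
rewrite /contract_r trans_r_ract (tlift_tlift_tens _ _ _ (contract_r_bal w)).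
by rewrite (morph_tlift _ _ (@ractDl _ _ _ a)); apply: eq_tlift => p q; rewrite ract_mul.
Qed.

Lemma contract_r_lact a v w : contract_r (lact a v) w = contract_r v (ract w a).
Proof.
rewrite /contract_r trans_r_lact (tlift_tlift_tens _ _ _ (contract_r_bal w)).
by apply: eq_tlift => p q; rewrite ract_tri mulrA.
Qed.

Lemma contract_r_Delta v w :
  tlift (fun v1 v2 => contract_r v2 (v1 * w)) (Delta B v) = v * src (f w).
Proof.
have bal := contract_r_bal w.
have := congr1 (tlift (fun p q : U => p * src (f (q * w)) : U)) (trans_r_Delta v).
rewrite (tliftE _ _ bal) mul1r => <-; rewrite tlift_tlift //; apply: eq_tlift => v1 v2.
by rewrite tlift_tlift_tens //; apply: eq_tlift => p q; rewrite mulrA.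
Qed.

Lemma tens_contract_r_bal w : balanced (@ract _ _ U) (@lact _ _ U)
  (fun u v : U => tensA (contract_r u w) v).
Proof.
split=> [v u u'|u v v'|u a v]; last by rewrite contract_r_ract tensA_bal.
- by rewrite contract_rDl tensADl.
- exact: tensADr.
Qed.

(** As for [Delta_contract_l], with $w \otimes u$ rewritten as $\alpha_r(u_{[+]} \otimes u_{[-]} w)$
    and coassociativity read in the opposite direction. *)
Lemma Delta_contract_r u w : Delta B (contract_r u w) =
  tlift (fun u1 u2 : U => tensA (contract_r u1 w) u2) (Delta B u).
Proof.
pose X x v : tensorA U U := tlift (fun v1 v2 => tensA (contract_r v1 x) v2) (Delta B v).
have Xb : balanced (@ract _ _ U) (@lact _ _ U) X.
  split=> [v x y|x v v'|x a v].
  - by rewrite -tlift_sumf; apply: eq_tlift => v1 v2; rewrite contract_rDr tensADl.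
  - by rewrite /X raddfD; exact/tliftAD/tens_contract_r_bal.
  - rewrite /X Delta_lact lact_tensorA tliftA_tens; last exact: tens_contract_r_bal.
    by apply: eq_tlift => v1 v2; rewrite contract_r_lact.
transitivity (tlift X (tensA w u)); last exact: tliftAE.
rewrite -alpha_r_trans alpha_r_tlift tliftA_lift //.
rewrite /contract_r (morph_tlift _ _ (@raddfD _ _ (Delta B))); apply: eq_tlift => p q.
rewrite /= Delta_mul_src alpha_rE tliftA_tens // /X.
rewrite -(Delta_coassocE (F := fun u v x => tensA (contract_r v (u * (q * w))) x)).
- apply: eq_tlift => u1 u2; rewrite -contract_r_Delta.
  exact: (morph_tlift _ _ (tensADl u2)).
- move=> x; split=> [z y y'|y z z'|y a z].
  + by rewrite mulrDl contract_rDr tensADl.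
  + by rewrite contract_rDl tensADl.
  + by rewrite contract_r_lact ract_mul.
- by move=> u1 u2 x y; rewrite tensADr.
- by move=> u1 u2 a x; rewrite contract_r_ract tensA_bal.
Qed.
End Contract.
End RightHopf.

(** * The map $\Phi$ of a right comodule and its bijectivity *)

Section RightGalois.
Variables (k : comPzRingType) (A : kalgebra k) (B : left_bialgebroid A).
Local Notation U := (tri B).

Section Map.
Variable M : right_comodule B.
Local Notation rho := (rcoact M).

(* The map $\Phi$; for [M := U] it is $\alpha_\ell$ up to the order of the factors. *)
Definition rgalois (x : tensorA U M) : tensorA M U :=
  tlift (fun (u : U) m => tlift (fun m0 (m1 : U) => tensA m0 (m1 * u)) (rho m)) x.

Lemma rgalois_bal : balanced (@ract _ _ U) (@lact _ _ M)
  (fun (u : U) m => tlift (fun m0 (m1 : U) => tensA m0 (m1 * u)) (rho m)).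
Proof.
split=> [m u v|u m n|u a m].
- by rewrite -tlift_sumf; apply: eq_tlift => m0 m1; rewrite mulrDr tensADr.
- by rewrite rcoactD; exact/tliftAD/mul_bal2.
- rewrite (rco_rho_lactE (rcm_ax M)); last exact: mul_bal2.
  by apply: eq_tlift => m0 m1; rewrite ract_tri mulrA.
Qed.

Lemma rgaloisE (u : U) m :
  rgalois (tensA u m) = tlift (fun m0 (m1 : U) => tensA m0 (m1 * u)) (rho m).
Proof. exact: (tliftAE _ _ rgalois_bal). Qed.

Lemma rgaloisD : {morph rgalois : x y / x + y}.
Proof. exact: (tliftAD rgalois_bal). Qed.

(** Left linearity rests on the Takeuchi property $a m_{(0)} \otimes m_{(1)} = m_{(0)} \otimes
    m_{(1)} s(a)$, right linearity on that of the coaction. *)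
Lemma rgalois_bimod : bimod_map rgalois.
Proof.
have D := rgaloisD; split=> // [a x|x a].
  elim/tensorA_ind: x => [u m|x y IHx IHy]; last by rewrite !(lactDr, D) IHx IHy.
  rewrite lact_tensA !rgaloisE (morph_tlift _ _ (@lactDr _ _ _ a)).
  transitivity (tlift (fun m0 (m1 : U) => tensA (lact a m0) (m1 * u)) (rho m)).
    rewrite (rco_takeuchiE (rcm_ax M) (f := fun m0 m1 => tensA m0 (m1 * u))).
      by apply: eq_tlift => m0 m1; rewrite lact_tri mulrA.
    exact: mul_bal2.
  by apply: eq_tlift => m0 m1; rewrite lact_tensA.
elim/tensorA_ind: x => [u m|x y IHx IHy]; last by rewrite !(ractDl, D) IHx IHy.
rewrite ract_tensA !rgaloisE (morph_tlift _ _ (@ractDl _ _ _ a)).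
rewrite (rco_rho_ractE (rcm_ax M)); last exact: mul_bal2.
by apply: eq_tlift => m0 m1; rewrite ract_tensA ract_mul.
Qed.

(** Compatibility with right multiplication by $U$ lets preimages of the elements $m \otimes 1$
    yield preimages of all $m \otimes u$. *)
Lemma rgalois_mulr (w : U) x :
  rgalois (tlift (fun (u : U) m => tensA (u * w) m) x) =
  tlift (fun m (u : U) => tensA m (u * w)) (rgalois x).
Proof.
have lb := mul_bal1 M w; have rb := mul_bal2 M w.
elim/tensorA_ind: x => [u m|x y IHx IHy]; last first.
  by rewrite (tliftAD lb) !rgaloisD (tliftAD rb) IHx IHy.
rewrite (tliftAE _ _ lb) !rgaloisE tliftA_tens //.
by apply: eq_tlift => m0 m1; rewrite mulrA.
Qed.

Lemma id_epsD : {morph @id_eps _ _ _ M : x y / x + y}.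
Proof.
apply: tliftAD; split=> [u m n|m u v|m a u]; first exact: ractDl.
- by rewrite raddfD ractDr.
- by rewrite eps_lact ractM.
Qed.

Lemma id_epsE m (u : U) : id_eps (tensA m u : tensorA M U) = ract m (eps B u).
Proof.
apply: tliftAE; split=> [v x y|x v w|x a v]; first exact: ractDl.
- by rewrite raddfD ractDr.
- by rewrite eps_lact ractM.
Qed.

Lemma id_eps_rcoact m : id_eps (rho m) = m.
Proof. exact: (rco_counit (rcm_ax M)). Qed.

(** Since $\epsilon(u t(a)) = \epsilon(u s(a))$, the Takeuchi condition converts the factor $t(a)$
    into the left action of $a$. This is what makes $m \otimes u \otimes v \mapsto v \otimes m
    \epsilon(u)$ balanced on the Takeuchi product. *)
Lemma id_eps_mul_tgt (x : tensorA M U) a : rtakeuchi x ->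
  id_eps (id_mul_tgt x a) = lact a (id_eps x).
Proof.
have D := id_epsD.
move=> /(_ a)/(congr1 (@id_eps _ _ _ M)); rewrite /id_mul_tgt !(morph_tlift _ _ D) => e.
transitivity (tlift (fun m (u : U) => id_eps (tensA m (u * src a) : tensorA M U)) x).
  by apply: eq_tlift => m u; rewrite !id_epsE eps_mul_src.
rewrite -e [in RHS]/id_eps (morph_tlift _ _ (@lactDr _ _ _ a)).
by apply: eq_tlift => m u; rewrite id_epsE lact_ract.
Qed.

Lemma id_mul_tgtE m (u : U) a :
  id_mul_tgt (tensA m u : tensorA M U) a = tensA m (u * tgt a).
Proof. exact: (tliftAE _ _ (mul_bal2 M (tgt a))). Qed.

Lemma id_mul_tgtD a : {morph (@id_mul_tgt _ _ _ M)^~ a : x y / x + y}.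
Proof. exact: (tliftAD (mul_bal2 M (tgt a))). Qed.

Lemma id_mul_tgt_addr x : {morph @id_mul_tgt _ _ _ M x : a b / a + b}.
Proof.
move=> a b; rewrite /id_mul_tgt -tlift_sumf; apply: eq_tlift => m u.
by rewrite tgtD mulrDr tensADr.
Qed.

Lemma id_mul_tgtM x a b :
  id_mul_tgt x (b * a) = id_mul_tgt (id_mul_tgt x a : tensorA M U) b.
Proof.
have D := id_mul_tgtD.
elim/tensorA_ind: x => [m u|x y IHx IHy]; last by rewrite !D IHx IHy.
by rewrite !id_mul_tgtE tgtM mulrA.
Qed.

Hypothesis Bl : left_hopf B.

Section Contract.
Variables (f : U -> A) (fD : {morph f : x y / x + y})
  (fR : forall u a, f (ract u a) = f u * a).

(* $\theta_f$ *)
Definition rcontract (x : tensorA M U) : tensorA M U :=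
  tlift (fun m (w : U) => tlift (fun m0 m1 => tensA m0 (contract_l f m1 w)) (rho m)) x.

Lemma rcontract_bal1 w : balanced (@ract _ _ M) (@lact _ _ U)
  (fun m0 m1 => tensA m0 (contract_l f m1 w)).
Proof.
split=> [u m n|m u v|m a u]; first exact: tensADl.
- by rewrite (contract_lDl Bl fD fR) tensADr.
- by rewrite (contract_l_lact Bl fD fR) tensA_bal.
Qed.

Lemma rcontract_bal : balanced (@ract _ _ M) (@lact _ _ U)
  (fun m (w : U) => tlift (fun m0 m1 => tensA m0 (contract_l f m1 w)) (rho m)).
Proof.
split=> [w m n|m u v|m a w].
- by rewrite rcoactD; exact/tliftAD/rcontract_bal1.
- by rewrite -tlift_sumf; apply: eq_tlift => m0 m1; rewrite contract_lDr // tensADr.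
- rewrite (rco_rho_ractE (rcm_ax M)); last exact: rcontract_bal1.
  by apply: eq_tlift => m0 m1; rewrite (contract_l_ract Bl fD fR).
Qed.

Lemma rcontractE m (w : U) :
  rcontract (tensA m w) = tlift (fun m0 m1 => tensA m0 (contract_l f m1 w)) (rho m).
Proof. exact: (tliftAE _ _ rcontract_bal). Qed.

Lemma rcontractD : {morph rcontract : x y / x + y}.
Proof. exact: (tliftAD rcontract_bal). Qed.

(** Coassociativity brings the left side to the form $m_{(0)} \otimes g_f(m_{(1)}, m_{(2)} u)$,
    where [contract_l_Delta] leaves $m_{(0)} \otimes m_{(1)} t(f(u))$, the coaction of $f(u) m$. *)
Lemma rcontract_galois (u : U) m :
  rcontract (rgalois (tensA u m)) = rho (lact (f u) m).
Proof.
rewrite rgaloisE [rcontract _]tliftA_tens; last exact: rcontract_bal.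
rewrite (rco_coassocE (rcm_ax M)
  (F := fun m v w => tensA m (contract_l f v (w * u)))).
- rewrite (rco_rho_lact (rcm_ax M)); apply: eq_tlift => m0 m1.
  rewrite -(contract_l_Delta Bl fD fR); exact/esym/(morph_tlift _ _ (tensADr m0)).
- by move=> w; exact: rcontract_bal1.
- by move=> m0 v w w'; rewrite mulrDl contract_lDr // tensADr.
- by move=> m0 v a w; rewrite (contract_l_ract Bl fD fR) lact_mul.
Qed.

(** By coassociativity and [Delta_contract_l], the left side is $(id \otimes id \otimes \epsilon)$
    applied to $m_{(0)} \otimes \Delta(g_f(m_{(1)}, w))$, and the counit axiom finishes. *)
Lemma rcoact_rcontract m (w : U) :
  rho (id_eps (rcontract (tensA m w))) = rcontract (tensA m w).
Proof.
have D := id_epsD; have rD := @rcoactD _ _ _ M.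
rewrite !rcontractE (morph_tlift _ _ D) (morph_tlift _ _ rD).
transitivity (tlift (fun m0 m1 => tlift (fun m00 m01 =>
    tensA m00 (ract m01 (eps B (contract_l f m1 w)))) (rho m0)) (rho m)).
  by apply: eq_tlift => m0 m1; rewrite id_epsE (rco_ract (rcm_ax M)) ract_tensorA.
rewrite (rco_coassocE (rcm_ax M)
  (F := fun m u v => tensA m (ract u (eps B (contract_l f v w))))).
- apply: eq_tlift => m0 m1; rewrite -[in RHS](eps_counitr (contract_l f m1 w)).
  rewrite (Delta_contract_l Bl fD fR) tliftA_tens; last exact: ract_eps_bal0.
  exact/esym/(morph_tlift _ _ (tensADr m0)).
- move=> v; split=> [u x y|x u u'|x a u]; first exact: tensADl.
  + by rewrite ractDl tensADr.
  + by rewrite tensA_bal lact_ract.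
- by move=> x u v v'; rewrite (contract_lDl Bl fD fR) raddfD ractDr tensADr.
- by move=> x u a v; rewrite (contract_l_lact Bl fD fR) eps_lact ractM.
Qed.

Lemma id_mul_tgt_bal : balanced (@id_mul_tgt _ _ _ M) (@tgt_mul _ _ B)
  (fun x q => id_mul_tgt x (f q) : tensorA M U).
Proof.
split=> [q x y|x p q|x a q]; first exact: id_mul_tgtD.
- by rewrite fD id_mul_tgt_addr.
- by rewrite /tgt_mul -ract_tri fR id_mul_tgtM.
Qed.

(** Allows $\theta_f(m \otimes 1)$ to be computed from any decomposition of $m_{(0)} \otimes
    m_{(1)+} \otimes m_{(1)-}$. *)
Lemma rcontract_trans_l m :
  tlift (fun x q => id_mul_tgt x (f q)) (id_trans_l (rho m)) =
  rcontract (tensA m (1 : U)).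
Proof.
have bal := id_mul_tgt_bal.
rewrite rcontractE tlift_tlift //; apply: eq_tlift => m0 m1.
rewrite tlift_tlift // (morph_tlift _ _ (tensADr m0)); apply: eq_tlift => p q.
by rewrite tliftE // id_mul_tgtE mulr1.
Qed.
End Contract.

Lemma id_mul_bal : balanced (@id_mul_tgt _ _ _ M) (@tgt_mul _ _ B)
  (fun x (q : U) => tlift (fun m (u : U) => tensA m (u * q)) x : tensorA M U).
Proof.
split=> [q x y|x p q|x a q]; first exact/tliftAD/mul_bal2.
- by rewrite -tlift_sumf; apply: eq_tlift => m u; rewrite mulrDr tensADr.
- rewrite tliftA_tens; last exact: mul_bal2.
  by apply: eq_tlift => m u; rewrite /tgt_mul mulrA.
Qed.

(** From $u_+ u_- = s(\epsilon(u))$ one gets $m_{(0)} \otimes s(\epsilon(m_{(1)})) = m_{(0)}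
    \epsilon(m_{(1)}) \otimes 1$. *)
Lemma id_mul_trans_l m :
  tlift (fun x (q : U) => tlift (fun m (u : U) => tensA m (u * q)) x : tensorA M U)
    (id_trans_l (rho m)) = tensA m (1 : U).
Proof.
have bal := id_mul_bal.
rewrite tlift_tlift // -[in RHS](id_eps_rcoact m) /id_eps (morph_tlift _ _ (tensADl (1 : U))).
apply: eq_tlift => m0 m1; rewrite tensA_bal -src_lact -(trans_l_mul Bl).
rewrite tlift_tlift // (morph_tlift _ _ (tensADr m0)); apply: eq_tlift => p q.
by rewrite tliftE // (tliftAE _ _ (mul_bal2 M q)).
Qed.

Hypothesis Bproj : projective (rmodule_of U).

Lemma rgalois_inj : injective rgalois.
Proof.
move=> x y exy.
(* One dual basis covers the chosen representatives of both [x] and [y], so that the recovery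
   formula [inv] depends on the element only through its image. *)
have [e [f [fD fR fE]]] := rmodule_dual_basis (map fst (repr x ++ repr y)) Bproj.
suff inv z : {subset repr z <= repr x ++ repr y} ->
    z = \sum_(q <- e) tensA q (id_eps (rcontract (f q) (rgalois z))).
  rewrite (inv x) => [|p px]; last by rewrite mem_cat px.
  by rewrite exy -inv // => p py; rewrite mem_cat py orbT.
move=> zs; transitivity (\sum_(p <- repr z) \sum_(q <- e) tensA q (lact (f q p.1) p.2)).
  rewrite {1}(tensor_sumE z); apply: eq_big_seq => p pz.
  have p1 : p.1 \in map fst (repr x ++ repr y) by apply: map_f; exact: zs.
  rewrite {1}(fE _ p1) (morphD_sum _ _ (tensDl p.2)).
  by apply: eq_bigr => q _; exact: tensA_bal.
rewrite exchange_big /=; apply: eq_bigr => q _.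
rewrite [in RHS](tensor_sumE z) (morphD_sum _ _ rgaloisD).
rewrite (morphD_sum _ _ (rcontractD (fD q) (fR q))) (morphD_sum _ _ id_epsD).
rewrite -(morphD_sum _ _ (tensADr q)); congr tensA; apply: eq_bigr => p _.
by rewrite [tens _ _]/(tensA p.1 p.2) (rcontract_galois (fD q) (fR q)) id_eps_rcoact.
Qed.

(** The image under $\Phi$ does not depend on the decomposition [c]: after expanding second
    components in a dual basis, [c] enters only through the elements $\theta_{f_q}(m \otimes 1)$. *)
Lemma to_left_spec_rgalois (m : M) y : to_left_spec m y -> rgalois y = tensA m (1 : U).
Proof.
case=> c [cT cE ->]; have bal := id_mul_bal.
have [e [f [fD fR fE]]] := rmodule_dual_basis (map snd c) Bproj.
have sE w : w \in c -> w.2 = \sum_(q <- e) ract q (f q w.2).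
  by move=> wc; apply: fE; exact: map_f.
pose X q := rcontract (f q) (tensA m (1 : U)).
have XE q : X q = \sum_(w <- c) id_mul_tgt w.1 (f q w.2).
  rewrite /X -(rcontract_trans_l (fD q) (fR q)) -cE tlift_fsum //.
  exact: id_mul_tgt_bal.
(* The dual basis puts [f q w.2] to the left of [id_eps w.1]; the Takeuchi condition on [w.1]
   absorbs it, and the sum over [c] becomes [X q]. *)
have -> : \sum_(w <- c) tensA w.2 (id_eps w.1) = \sum_(q <- e) tensA q (id_eps (X q)).
  transitivity (\sum_(w <- c) \sum_(q <- e) tensA q (lact (f q w.2) (id_eps w.1))).
    apply: eq_big_seq => w wc; rewrite {1}(sE w wc) (morphD_sum _ _ (tensADl _)).
    by apply: eq_bigr => q _; rewrite tensA_bal.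
  rewrite exchange_big; apply: eq_bigr => q _ /=.
  rewrite XE (morphD_sum _ _ id_epsD) (morphD_sum _ _ (tensADr q)).
  by apply: eq_big_seq => w wc; rewrite id_eps_mul_tgt //; exact: cT.
(* Because [X q] is the coaction of [id_eps (X q)], $\Phi$ sends the summand at [q] to [X q]
   multiplied by [q]; balancedness then undoes the dual basis expansion. *)
rewrite (morphD_sum _ _ rgaloisD) -(id_mul_trans_l m) -cE tlift_fsum //.
transitivity (\sum_(w <- c) \sum_(q <- e)
    tlift (fun m (u : U) => tensA m (u * q)) (id_mul_tgt w.1 (f q w.2)) : tensorA M U).
  rewrite exchange_big; apply: eq_bigr => q _ /=.
  rewrite rgaloisE (rcoact_rcontract (fD q) (fR q)) -/(X q) XE.
  by rewrite (morphD_sum _ _ (tliftAD (mul_bal2 M q))).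
apply: eq_big_seq => w wc; case: bal => _ bD bB.
rewrite [in RHS](sE w wc) (morphD_sum _ _ (bD _)); apply: eq_bigr => q _.
exact: bB.
Qed.

(** The witness pairs each [q] of a dual basis with $\theta_{f_q}(m \otimes 1)$. This element is a
    coaction value, hence lies in the Takeuchi product. *)
Lemma to_left_spec_ex (m : M) : exists y, to_left_spec m y.
Proof.
set z := id_trans_l (rho m).
have [e [f [fD fR fE]]] := rmodule_dual_basis (map snd (repr z)) Bproj.
pose n q := id_eps (rcontract (f q) (tensA m (1 : U))).
pose c := [seq (rho (n q), q) | q <- e].
exists (\sum_(w <- c) tensA w.2 (id_eps w.1)), c; split=> //.
  by move=> _ /mapP[q _ ->] a; exact: (rco_takeuchi (rcm_ax M)).
rewrite -/z fsumE /c big_map /= [RHS]tensor_sumE.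
transitivity (\sum_(p <- repr z) \sum_(q <- e) tens (id_mul_tgt p.1 (f q p.2)) q
   : tensor (@id_mul_tgt _ _ _ M) (@tgt_mul _ _ B)).
  rewrite exchange_big; apply: eq_bigr => q _ /=.
  rewrite /n (rcoact_rcontract (fD q) (fR q)) -(rcontract_trans_l (fD q) (fR q)).
  by rewrite (morphD_sum _ _ (tensDl q)).
apply: eq_big_seq => p pz.
have p2 : p.2 \in map snd (repr z) by exact: map_f.
rewrite [in RHS](fE _ p2) (morphD_sum _ _ (tensDr p.1)).
by apply: eq_bigr => q _; exact: tens_bal.
Qed.

Lemma to_left_specP (m : M) y : to_left_spec m y <-> rgalois y = tensA m (1 : U).
Proof.
split=> [|e]; first exact: to_left_spec_rgalois.
have [y' y'P] := to_left_spec_ex m.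
by rewrite (_ : y = y') //; apply: rgalois_inj; rewrite e (to_left_spec_rgalois y'P).
Qed.

Lemma to_left_spec_uniq (m : M) : exists! y, to_left_spec m y.
Proof.
have [y yP] := to_left_spec_ex m; exists y; split=> // y' y'P.
by apply: rgalois_inj; rewrite (to_left_spec_rgalois yP) (to_left_spec_rgalois y'P).
Qed.

Lemma rgalois_coact (m : M) : rgalois (to_left_coact m) = tensA m (1 : U).
Proof.
exact/to_left_specP/(@xgetPex _ 0 (fun y => to_left_spec m y))/to_left_spec_ex.
Qed.

(** The form in which injectivity of $\Phi$ is used later: a candidate for the coaction is checked
    after applying $\Phi$. *)
Lemma to_left_coactE (m : M) y : rgalois y = tensA m (1 : U) -> to_left_coact m = y.
Proof. by move=> e; apply: rgalois_inj; rewrite rgalois_coact. Qed.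

(** $m \otimes u$ is the image of the coaction of $m$ multiplied by $u$ on its first factor. A
    two-sided inverse is recorded since, unlike mere injectivity, it passes to tensor products of
    maps. *)
Lemma rgalois_bij : exists2 g, cancel rgalois g & cancel g rgalois.
Proof.
have surj z : exists x, rgalois x = z.
  elim/tensorA_ind: z => [m u|z z' [x <-] [x' <-]]; last first.
    by exists (x + x'); rewrite rgaloisD.
  exists (tlift (fun (v : U) n => tensA (v * u) n) (to_left_coact m)).
  rewrite rgalois_mulr rgalois_coact (tliftAE _ _ (mul_bal2 M u)) mul1r //.
have [g gK] := choice surj; exists g => // x.
by apply: rgalois_inj; rewrite gK.
Qed.

End Map.
End RightGalois.

(** * The mirrored map $\Phi'$ of a left comodule and its bijectivity *)

Section LeftGalois.
Variables (k : comPzRingType) (A : kalgebra k) (B : left_bialgebroid A).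
Local Notation U := (tri B).

Section Map.
Variable N : left_comodule B.
Local Notation delta := (lcoact N).

Definition lgalois (x : tensorA N U) : tensorA U N :=
  tlift (fun n (u : U) => tlift (fun (n1 : U) n0 => tensA (n1 * u) n0) (delta n)) x.

Lemma lgalois_bal : balanced (@ract _ _ N) (@lact _ _ U)
  (fun n (u : U) => tlift (fun (n1 : U) n0 => tensA (n1 * u) n0) (delta n)).
Proof.
split=> [u m n|n u v|n a u].
- by rewrite lcoactD; exact/tliftAD/mul_bal1.
- by rewrite -tlift_sumf; apply: eq_tlift => n1 n0; rewrite mulrDr tensADl.
- rewrite (lco_delta_ractE (lcm_ax N)); last exact: mul_bal1.
  by apply: eq_tlift => n1 n0; rewrite lact_tri mulrA.
Qed.

Lemma lgaloisE n (u : U) :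
  lgalois (tensA n u) = tlift (fun (n1 : U) n0 => tensA (n1 * u) n0) (delta n).
Proof. exact: (tliftAE _ _ lgalois_bal). Qed.

Lemma lgaloisD : {morph lgalois : x y / x + y}.
Proof. exact: (tliftAD lgalois_bal). Qed.

(** In contrast to $\Phi$, it is right linearity that rests on the Takeuchi property. *)
Lemma lgalois_bimod : bimod_map lgalois.
Proof.
have D := lgaloisD; split=> // [a x|x a].
  elim/tensorA_ind: x => [n u|x y IHx IHy]; last by rewrite !(lactDr, D) IHx IHy.
  rewrite lact_tensA !lgaloisE (morph_tlift _ _ (@lactDr _ _ _ a)).
  rewrite (lco_delta_lactE (lcm_ax N)); last exact: mul_bal1.
  by apply: eq_tlift => n1 n0; rewrite lact_tensA lact_mul.
elim/tensorA_ind: x => [n u|x y IHx IHy]; last by rewrite !(ractDl, D) IHx IHy.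
rewrite ract_tensA !lgaloisE (morph_tlift _ _ (@ractDl _ _ _ a)).
transitivity (tlift (fun (n1 : U) n0 => tensA (n1 * u) (ract n0 a)) (delta n)).
  rewrite -(lco_takeuchiE (lcm_ax N) (f := fun n1 n0 => tensA (n1 * u) n0)).
    by apply: eq_tlift => n1 n0; rewrite ract_tri mulrA.
  exact: mul_bal1.
by apply: eq_tlift => n1 n0; rewrite ract_tensA.
Qed.

Lemma lgalois_mulr (w : U) x :
  lgalois (tlift (fun n (u : U) => tensA n (u * w)) x) =
  tlift (fun (u : U) n => tensA (u * w) n) (lgalois x).
Proof.
have lb := mul_bal2 N w; have rb := mul_bal1 N w.
elim/tensorA_ind: x => [n u|x y IHx IHy]; last first.
  by rewrite (tliftAD lb) !lgaloisD (tliftAD rb) IHx IHy.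
rewrite (tliftAE _ _ lb) !lgaloisE tliftA_tens //.
by apply: eq_tlift => n1 n0; rewrite mulrA.
Qed.

Lemma lact_eps_bal2 : balanced (@ract _ _ U) (@lact _ _ N) (fun u n => lact (eps B u) n).
Proof.
split=> [n u v|u m n|u a n]; last by rewrite eps_ract lactM.
- by rewrite raddfD lactDl.
- exact: lactDr.
Qed.

Lemma eps_idD : {morph @eps_id _ _ _ N : x y / x + y}.
Proof. exact/tliftAD/lact_eps_bal2. Qed.

Lemma eps_idE (u : U) n : eps_id (tensA u n : tensorA U N) = lact (eps B u) n.
Proof. exact/tliftAE/lact_eps_bal2. Qed.

Lemma eps_id_lcoact n : eps_id (delta n) = n.
Proof. exact: (lco_counit (lcm_ax N)). Qed.

Lemma eps_id_mul_src (x : tensorA U N) a : ltakeuchi x ->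
  eps_id (mul_src_id x a) = ract (eps_id x) a.
Proof.
have D := eps_idD.
move=> /(_ a)/(congr1 (@eps_id _ _ _ N)); rewrite /mul_src_id !(morph_tlift _ _ D) => e.
transitivity (tlift (fun (u : U) n => eps_id (tensA (u * tgt a) n : tensorA U N)) x).
  by apply: eq_tlift => u n; rewrite !eps_idE eps_mul_src.
rewrite e [in RHS]/eps_id (morph_tlift _ _ (@ractDl _ _ _ a)).
by apply: eq_tlift => u n; rewrite eps_idE lact_ract.
Qed.

Lemma mul_src_idE (u : U) n a :
  mul_src_id (tensA u n : tensorA U N) a = tensA (u * src a) n.
Proof. exact: (tliftAE _ _ (mul_bal1 N (src a))). Qed.

Lemma mul_src_idD a : {morph (@mul_src_id _ _ _ N)^~ a : x y / x + y}.
Proof. exact: (tliftAD (mul_bal1 N (src a))). Qed.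

Lemma mul_src_id_addr x : {morph @mul_src_id _ _ _ N x : a b / a + b}.
Proof.
move=> a b; rewrite /mul_src_id -tlift_sumf; apply: eq_tlift => u n.
by rewrite srcD mulrDr tensADl.
Qed.

Lemma mul_src_idM x a b :
  mul_src_id x (a * b) = mul_src_id (mul_src_id x a : tensorA U N) b.
Proof.
have D := mul_src_idD.
elim/tensorA_ind: x => [u n|x y IHx IHy]; last by rewrite !D IHx IHy.
by rewrite !mul_src_idE srcM mulrA.
Qed.

Hypothesis Br : right_hopf B.

Section Contract.
Variables (f : U -> A) (fD : {morph f : x y / x + y})
  (fL : forall a u, f (lact a u) = a * f u).

(** The mirror of $\theta_f$ for left linear forms. *)
Definition lcontract (x : tensorA U N) : tensorA U N :=
  tlift (fun (w : U) n => tlift (fun n1 n0 => tensA (contract_r f n1 w) n0) (delta n)) x.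

Lemma lcontract_bal1 w : balanced (@ract _ _ U) (@lact _ _ N)
  (fun n1 n0 => tensA (contract_r f n1 w) n0).
Proof.
split=> [n u v|u m n|u a n].
- by rewrite (contract_rDl Br fD fL) tensADl.
- exact: tensADr.
- by rewrite (contract_r_ract Br fD fL) tensA_bal.
Qed.

Lemma lcontract_bal : balanced (@ract _ _ U) (@lact _ _ N)
  (fun (w : U) n => tlift (fun n1 n0 => tensA (contract_r f n1 w) n0) (delta n)).
Proof.
split=> [n u v|w m n|w a n].
- by rewrite -tlift_sumf; apply: eq_tlift => n1 n0; rewrite contract_rDr // tensADl.
- by rewrite lcoactD; exact/tliftAD/lcontract_bal1.
- rewrite (lco_delta_lactE (lcm_ax N)); last exact: lcontract_bal1.
  by apply: eq_tlift => n1 n0; rewrite (contract_r_lact Br fD fL).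
Qed.

Lemma lcontractE (w : U) n :
  lcontract (tensA w n) = tlift (fun n1 n0 => tensA (contract_r f n1 w) n0) (delta n).
Proof. exact: (tliftAE _ _ lcontract_bal). Qed.

Lemma lcontractD : {morph lcontract : x y / x + y}.
Proof. exact: (tliftAD lcontract_bal). Qed.

(** Coassociativity and [contract_r_Delta] leave $n_{(-1)} s(f(u)) \otimes n_{(0)}$, the coaction of
    $n f(u)$. *)
Lemma lcontract_galois n (u : U) :
  lcontract (lgalois (tensA n u)) = delta (ract n (f u)).
Proof.
rewrite lgaloisE [lcontract _]tliftA_tens; last exact: lcontract_bal.
rewrite (lco_coassocE (lcm_ax N)
  (F := fun v w n => tensA (contract_r f w (v * u)) n)).
- rewrite (lco_delta_ract (lcm_ax N)); apply: eq_tlift => n1 n0.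
  rewrite -(contract_r_Delta Br fD fL); exact/esym/(morph_tlift _ _ (tensADl n0)).
- by move=> v; exact: lcontract_bal1.
- by move=> w n0 v v'; rewrite mulrDl contract_rDr // tensADl.
- by move=> v a w n0; rewrite (contract_r_lact Br fD fL) ract_mul.
Qed.

Lemma lcoact_lcontract (w : U) n :
  delta (eps_id (lcontract (tensA w n))) = lcontract (tensA w n).
Proof.
have D := eps_idD; have dD := @lcoactD _ _ _ N.
rewrite !lcontractE (morph_tlift _ _ D) (morph_tlift _ _ dD).
transitivity (tlift (fun n1 n0 => tlift (fun n01 n00 =>
    tensA (lact (eps B (contract_r f n1 w)) n01) n00) (delta n0)) (delta n)).
  by apply: eq_tlift => n1 n0; rewrite eps_idE (lco_lact (lcm_ax N)) lact_tensorA.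
rewrite (lco_coassocE (lcm_ax N)
  (F := fun u v n => tensA (lact (eps B (contract_r f u w)) v) n)).
- apply: eq_tlift => n1 n0; rewrite -[in RHS](eps_counitl (contract_r f n1 w)).
  rewrite (Delta_contract_r Br fD fL) tliftA_tens; last exact: lact_eps_bal0.
  exact/esym/(morph_tlift _ _ (tensADl n0)).
- move=> u; split=> [x v v'|v x y|v a x].
  + by rewrite lactDr tensADl.
  + exact: tensADr.
  + by rewrite lact_ract tensA_bal.
- by move=> v x u u'; rewrite (contract_rDl Br fD fL) raddfD lactDl tensADl.
- by move=> u a v x; rewrite (contract_r_ract Br fD fL) eps_ract lactM.
Qed.

Lemma mul_src_id_bal : balanced (@mul_src_id _ _ _ N) (@src_mul _ _ B)
  (fun x q => mul_src_id x (f q) : tensorA U N).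
Proof.
split=> [q x y|x p q|x a q]; first exact: mul_src_idD.
- by rewrite fD mul_src_id_addr.
- by rewrite /src_mul -lact_tri fL mul_src_idM.
Qed.

Lemma lcontract_trans_r n :
  tlift (fun x q => mul_src_id x (f q)) (trans_r_id (delta n)) =
  lcontract (tensA (1 : U) n).
Proof.
have bal := mul_src_id_bal.
rewrite lcontractE tlift_tlift //; apply: eq_tlift => n1 n0.
rewrite tlift_tlift // (morph_tlift _ _ (tensADl n0)); apply: eq_tlift => p q.
by rewrite tliftE // mul_src_idE mulr1.
Qed.
End Contract.

Lemma mul_id_bal : balanced (@mul_src_id _ _ _ N) (@src_mul _ _ B)
  (fun x (q : U) => tlift (fun (u : U) n => tensA (u * q) n) x : tensorA U N).
Proof.
split=> [q x y|x p q|x a q]; first exact/tliftAD/mul_bal1.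
- by rewrite -tlift_sumf; apply: eq_tlift => u n; rewrite mulrDr tensADl.
- rewrite tliftA_tens; last exact: mul_bal1.
  by apply: eq_tlift => u n; rewrite /src_mul mulrA.
Qed.

Lemma mul_id_trans_r n :
  tlift (fun x (q : U) => tlift (fun (u : U) n => tensA (u * q) n) x : tensorA U N)
    (trans_r_id (delta n)) = tensA (1 : U) n.
Proof.
have bal := mul_id_bal.
rewrite tlift_tlift // -[in RHS](eps_id_lcoact n) /eps_id (morph_tlift _ _ (tensADr (1 : U))).
apply: eq_tlift => n1 n0; rewrite -tensA_bal -tgt_ract -(trans_r_mul Br).
rewrite tlift_tlift // (morph_tlift _ _ (tensADl n0)); apply: eq_tlift => p q.
by rewrite tliftE // (tliftAE _ _ (mul_bal1 N q)).
Qed.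

Hypothesis Bproj : projective (lmodule_of U).

(** Second components are now expanded in a dual basis of ${}_\triangleright U$, and
    [lcontract_galois] recovers an element from its image under $\Phi'$. *)
Lemma lgalois_inj : injective lgalois.
Proof.
move=> x y exy.
have [e [f [fD fL fE]]] := lmodule_dual_basis (map snd (repr x ++ repr y)) Bproj.
suff inv z : {subset repr z <= repr x ++ repr y} ->
    z = \sum_(q <- e) tensA (eps_id (lcontract (f q) (lgalois z))) q.
  rewrite (inv x) => [|p px]; last by rewrite mem_cat px.
  by rewrite exy -inv // => p py; rewrite mem_cat py orbT.
move=> zs; transitivity (\sum_(p <- repr z) \sum_(q <- e) tensA (ract p.1 (f q p.2)) q).
  rewrite {1}(tensor_sumE z); apply: eq_big_seq => p pz.
  have p2 : p.2 \in map snd (repr x ++ repr y) by apply: map_f; exact: zs.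
  rewrite {1}(fE _ p2) (morphD_sum _ _ (tensDr p.1)).
  by apply: eq_bigr => q _; rewrite tensA_bal.
rewrite exchange_big /=; apply: eq_bigr => q _.
rewrite [in RHS](tensor_sumE z) (morphD_sum _ _ lgaloisD).
rewrite (morphD_sum _ _ (lcontractD (fD q) (fL q))) (morphD_sum _ _ eps_idD).
rewrite -(morphD_sum _ _ (tensADl q)); congr tensA; apply: eq_bigr => p _.
by rewrite [tens _ _]/(tensA p.1 p.2) (lcontract_galois (fD q) (fL q)) eps_id_lcoact.
Qed.

Lemma to_right_spec_lgalois (n : N) y : to_right_spec n y -> lgalois y = tensA (1 : U) n.
Proof.
case=> c [cT cE ->]; have bal := mul_id_bal.
have [e [f [fD fL fE]]] := lmodule_dual_basis (map snd c) Bproj.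
have sE w : w \in c -> w.2 = \sum_(q <- e) lact (f q w.2) q.
  by move=> wc; apply: fE; exact: map_f.
pose X q := lcontract (f q) (tensA (1 : U) n).
have XE q : X q = \sum_(w <- c) mul_src_id w.1 (f q w.2).
  rewrite /X -(lcontract_trans_r (fD q) (fL q)) -cE tlift_fsum //.
  exact: mul_src_id_bal.
have -> : \sum_(w <- c) tensA (eps_id w.1) w.2 = \sum_(q <- e) tensA (eps_id (X q)) q.
  transitivity (\sum_(w <- c) \sum_(q <- e) tensA (ract (eps_id w.1) (f q w.2)) q).
    apply: eq_big_seq => w wc; rewrite {1}(sE w wc) (morphD_sum _ _ (tensADr _)).
    by apply: eq_bigr => q _; rewrite tensA_bal.
  rewrite exchange_big; apply: eq_bigr => q _ /=.
  rewrite XE (morphD_sum _ _ eps_idD) (morphD_sum _ _ (tensADl q)).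
  by apply: eq_big_seq => w wc; rewrite eps_id_mul_src //; exact: cT.
rewrite (morphD_sum _ _ lgaloisD) -(mul_id_trans_r n) -cE tlift_fsum //.
transitivity (\sum_(w <- c) \sum_(q <- e)
    tlift (fun (u : U) n => tensA (u * q) n) (mul_src_id w.1 (f q w.2)) : tensorA U N).
  rewrite exchange_big; apply: eq_bigr => q _ /=.
  rewrite lgaloisE (lcoact_lcontract (fD q) (fL q)) -/(X q) XE.
  by rewrite (morphD_sum _ _ (tliftAD (mul_bal1 N q))).
apply: eq_big_seq => w wc; case: bal => _ bD bB.
rewrite [in RHS](sE w wc) (morphD_sum _ _ (bD _)); apply: eq_bigr => q _.
exact: bB.
Qed.

(** The contractions of $1 \otimes n$ by the dual basis forms are coaction values, hence Takeuchi;
    paired with the basis they form the required decomposition. *)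
Lemma to_right_spec_ex (n : N) : exists y, to_right_spec n y.
Proof.
set z := trans_r_id (delta n).
have [e [f [fD fL fE]]] := lmodule_dual_basis (map snd (repr z)) Bproj.
pose m q := eps_id (lcontract (f q) (tensA (1 : U) n)).
pose c := [seq (delta (m q), q) | q <- e].
exists (\sum_(w <- c) tensA (eps_id w.1) w.2), c; split=> //.
  by move=> _ /mapP[q _ ->] a; exact: (lco_takeuchi (lcm_ax N)).
rewrite -/z fsumE /c big_map /= [RHS]tensor_sumE.
transitivity (\sum_(p <- repr z) \sum_(q <- e) tens (mul_src_id p.1 (f q p.2)) q
   : tensor (@mul_src_id _ _ _ N) (@src_mul _ _ B)).
  rewrite exchange_big; apply: eq_bigr => q _ /=.
  rewrite /m (lcoact_lcontract (fD q) (fL q)) -(lcontract_trans_r (fD q) (fL q)).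
  by rewrite (morphD_sum _ _ (tensDl q)).
apply: eq_big_seq => p pz.
have p2 : p.2 \in map snd (repr z) by exact: map_f.
rewrite [in RHS](fE _ p2) (morphD_sum _ _ (tensDr p.1)).
by apply: eq_bigr => q _; exact: tens_bal.
Qed.

Lemma to_right_specP (n : N) y : to_right_spec n y <-> lgalois y = tensA (1 : U) n.
Proof.
split=> [|e]; first exact: to_right_spec_lgalois.
have [y' y'P] := to_right_spec_ex n.
by rewrite (_ : y = y') //; apply: lgalois_inj; rewrite e (to_right_spec_lgalois y'P).
Qed.

Lemma to_right_spec_uniq (n : N) : exists! y, to_right_spec n y.
Proof.
have [y yP] := to_right_spec_ex n; exists y; split=> // y' y'P.
by apply: lgalois_inj; rewrite (to_right_spec_lgalois yP) (to_right_spec_lgalois y'P).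
Qed.

Lemma lgalois_coact (n : N) : lgalois (to_right_coact n) = tensA (1 : U) n.
Proof.
exact/to_right_specP/(@xgetPex _ 0 (fun y => to_right_spec n y))/to_right_spec_ex.
Qed.

Lemma to_right_coactE (n : N) y : lgalois y = tensA (1 : U) n -> to_right_coact n = y.
Proof. by move=> e; apply: lgalois_inj; rewrite lgalois_coact. Qed.

Lemma lgalois_bij : exists2 g, cancel lgalois g & cancel g lgalois.
Proof.
have surj z : exists x, lgalois x = z.
  elim/tensorA_ind: z => [u n|z z' [x <-] [x' <-]]; last first.
    by exists (x + x'); rewrite lgaloisD.
  exists (tlift (fun m (v : U) => tensA m (v * u)) (to_right_coact n)).
  by rewrite lgalois_mulr lgalois_coact (tliftAE _ _ (mul_bal1 N u)) mul1r.
have [g gK] := choice surj; exists g => // x.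
by apply: lgalois_inj; rewrite gK.
Qed.

End Map.
End LeftGalois.

(** * From right to left comodules: axioms, morphisms, tensor products *)

Section ToLeft.
Variables (k : comPzRingType) (A : kalgebra k) (B : left_bialgebroid A).
Local Notation U := (tri B).
Hypotheses (Bl : left_hopf B) (Bproj : projective (rmodule_of U)).

Section Object.
Variable M : right_comodule B.
Local Notation rho := (rcoact M).
Local Notation delta := (@to_left_coact _ _ B M).
Local Notation gal := (@rgalois _ _ B M).

Let gal_delta m : gal (delta m) = tensA m (1 : U).
Proof. exact: rgalois_coact. Qed.

Lemma to_left_coactD : {morph delta : m n / m + n}.
Proof.
by move=> m n; apply: (to_left_coactE Bl Bproj); rewrite rgaloisD !gal_delta tensADl.
Qed.

Lemma to_left_coact_lact a m : delta (lact a m) = lact a (delta m).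
Proof.
have [_ gl _] := rgalois_bimod M.
by apply: (to_left_coactE Bl Bproj); rewrite gl gal_delta lact_tensA.
Qed.

(** Apply $m \otimes u \mapsto m \epsilon(u p)$ to $\Phi(\delta(m)) = m \otimes 1$. The case $p = 1$
    is the counit axiom, and $p = s(a)$ identifies the induced right action. *)
Lemma to_left_coact_eps (p : U) m :
  tlift (fun (u : U) n => lact (eps B (u * p)) n) (delta m) = ract m (eps B p).
Proof.
have bal := @ract_eps_bal _ _ B M p.
have <- : tlift (fun m0 (m1 : U) => ract m0 (eps B (m1 * p))) (gal (delta m)) =
    ract m (eps B p) by rewrite gal_delta tliftAE // mul1r.
rewrite tliftA_lift //; apply: eq_tlift => u n.
rewrite tliftA_tens // (rco_lact (rcm_ax M)); apply: eq_tlift => n0 n1.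
by rewrite -mulrA -eps_tgt.
Qed.

Let E (y : M) (p q : U) : tensorA (tensorA M U) U := tensA (tensA y p) q.
Let E_bal y : balanced (@ract _ _ U) (@lact _ _ U) (E y).
Proof. exact: assocV_bal1. Qed.

Let E_Delta_bal : balanced (@ract _ _ M) (@lact _ _ U)
  (fun m w => tlift (E m) (Delta B w)).
Proof.
split=> [w m n|m u v|m a w].
- by rewrite -tlift_sumf; apply: eq_tlift => p q; rewrite /E !tensADl.
- by rewrite raddfD; exact/tliftAD/E_bal.
- rewrite Delta_lact lact_tensorA tliftA_tens //.
  by apply: eq_tlift => p q; rewrite /E tensA_bal.
Qed.

(** Applying $id \otimes \Phi$, reassociating and applying $\Phi \otimes id$ is injective and sends
    both sides to $m \otimes 1 \otimes 1$. *)
Lemma to_left_coassoc m :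
  tlift (fun u n => tensA u (delta n)) (delta m) =
  tlift (fun w n => tlift (fun u v => tensA u (tensA v n)) (Delta B w)) (delta m).
Proof.
have [g galK gK] := rgalois_bij M Bl Bproj.
have gb := rgalois_bimod M; have iU := bimod_id U.
have g'b : bimod_map g.
  case: gb => gD gl gr.
  by split=> [x y|a x|x a]; apply: (can_inj galK); rewrite ?(gD, gl, gr) !gK.
have inj2 : injective (tmap id gal : tensorA U (tensorA U M) -> _).
  apply: (can_inj (g := tmap id g)) => x; rewrite -tmap_comp //.
  by rewrite -[RHS]tmap_id; apply: eq_tlift => u y /=; rewrite galK.
have inj1 : injective (tmap gal id : tensorA (tensorA U M) U -> _).
  apply: (can_inj (g := tmap g id)) => x; rewrite -tmap_comp //.
  by rewrite -[RHS]tmap_id; apply: eq_tlift => y u /=; rewrite galK.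
apply/inj2/(can_inj (@assocVK _ _ U M U))/inj1.
have [D1 _ _] := tmap_bimod gb iU; have [D2 _ _] := tmap_bimod iU gb.
have DV := @assocVD _ _ U M U; have iUU := bimod_id (tensorA U U).
rewrite !(morph_tlift _ _ D2) !(morph_tlift _ _ DV) !(morph_tlift _ _ D1).
have lhs : tlift (fun u n => tmap gal id (assocV (tmap id gal (tensA u (delta n)))))
    (delta m) = E m 1 1.
  transitivity (tlift (fun u n => tensA (gal (tensA u n)) (1 : U)) (delta m)).
    by apply: eq_tlift => u n; rewrite tmapE // gal_delta assocVE tmapE.
  rewrite -(morph_tlift _ _ (tensADl (1 : U))) -(morph_tlift _ _ (@rgaloisD _ _ B M)).
  by rewrite (tlift_tens (delta m)) gal_delta.
rewrite [LHS]lhs.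
(* For the right side, $m \otimes 1 \otimes 1$ is seen as $(id \otimes \Delta)(\Phi(\delta(m)))$;
   multiplicativity of $\Delta$ and coassociativity of the given coaction then match it with the two
   applications of $\Phi$. *)
transitivity (tlift (fun m w => tlift (E m) (Delta B w)) (gal (delta m))).
  by rewrite gal_delta (tliftAE _ _ E_Delta_bal) Delta1 (tliftAE _ _ (E_bal m)).
rewrite tliftA_lift //; apply: eq_tlift => w n; rewrite tliftA_tens //.
rewrite (morph_tlift _ _ D2) (morph_tlift _ _ DV) (morph_tlift _ _ D1).
transitivity (tlift (fun n0 n1 => tlift (fun u1 u2 => tlift (fun v1 v2 : U =>
    E n0 (v1 * u1) (v2 * u2)) (Delta B n1)) (Delta B w)) (rho n)).
  apply: eq_tlift => n0 n1; rewrite (Delta_mulE _ _ (E_bal n0)) tlift_exch //.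
rewrite tlift_exch; apply: eq_tlift => u1 u2; rewrite tmapE // rgaloisE.
rewrite (morph_tlift _ _ (tensADr u1)) (morph_tlift _ _ DV) (morph_tlift _ _ D1).
rewrite -(rco_coassocE (rcm_ax M) (F := fun n v1 v2 => E n (v1 * u1) (v2 * u2))).
- apply: eq_tlift => n0 n1; rewrite assocVE tmapE // rgaloisE.
  by rewrite (morph_tlift _ _ (tensADl (n1 * u2))).
- move=> v; split=> [u x y|x u u'|x a u]; first by rewrite /E !tensADl.
  + by rewrite mulrDl /E tensADr tensADl.
  + by rewrite -lact_mul /E tensA_bal.
- by move=> x u v v'; rewrite mulrDl /E tensADr.
- by move=> x u a v; rewrite -ract_mul -lact_mul; case: (E_bal x).
Qed.

Lemma to_left_ax : left_comodule_axioms delta.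
Proof.
split; [exact: to_left_coactD | exact: to_left_coact_lact | exact: to_left_coassoc | |].
- move=> m; rewrite -[RHS]ract1 -[in RHS](eps1 B) -to_left_coact_eps.
  by apply: eq_tlift => u n; rewrite mulr1.
- by move=> m a; rewrite to_left_coact_eps eps_s.
Qed.
End Object.

(** Colinearity of $f$ gives $\Phi_N(u \otimes f(n)) = (f \otimes id)(\Phi_M(u \otimes n))$, so both
    sides have image $f(m) \otimes 1$. *)
Lemma to_left_hom_ax
    (ax : forall M : right_comodule B, left_comodule_axioms (@to_left_coact _ _ B M))
    (M N : right_comodule B) (f : rcomod_hom M N) :
  is_lcomod_hom (M := LeftComodule (ax M)) (N := LeftComodule (ax N)) f.
Proof.
have [fD fl fr] := rcomod_hom_bimod (rch_ax f); have [_ _ fc] := rch_ax f.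
split=> // m; apply: (to_left_coactE Bl Bproj).
have bal := @rhom_bal _ _ B M N f (rcomod_hom_bimod (rch_ax f)).
have <- : tlift (fun m0 (m1 : U) => tensA (f m0) m1) (rgalois (to_left_coact m)) =
    tensA (f m) (1 : U) by rewrite (rgalois_coact Bl Bproj) tliftAE.
rewrite (morph_tlift _ _ (@rgaloisD _ _ B N)) tliftA_lift //; apply: eq_tlift => u n.
rewrite rgaloisE fc !tliftA_tens //; exact: mul_bal2.
Qed.

Lemma to_left_coact_tens (M N : right_comodule B)
    (axM : left_comodule_axioms (@to_left_coact _ _ B M))
    (axN : left_comodule_axioms (@to_left_coact _ _ B N)) :
  @to_left_coact _ _ B (rcomod_tens M N) =
  @ltens_coact _ _ B (LeftComodule axM) (LeftComodule axN).
Proof.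
apply/funext => x; set M' := LeftComodule _; set N' := LeftComodule _.
have gD := @rgaloisD _ _ B (rcomod_tens M N).
apply: (to_left_coactE Bl Bproj); elim/tensorA_ind: x => [m n|x y IHx IHy]; last first.
  by rewrite (@ltens_coactD _ _ B M' N') gD IHx IHy tensADl.
rewrite (@ltens_coactE _ _ B M' N') (morph_tlift _ _ gD) /=.
(* Summing over the coaction of [m] first: $\Phi(\delta(m)) = m \otimes 1$ reduces the map for $M
   \otimes_A N$ to $m \otimes \Phi_N(n_1 \otimes n_0)$. Summing over the coaction of [n] then gives
   $m \otimes n \otimes 1$. *)
have step (n1 : U) n0 : rgalois (tlift (@ltens_pre _ _ B M' N' n1 n0) (to_left_coact m)
      : tensorA U (rcomod_tens M N)) =
    tlift (fun b0 (b1 : U) => tensA (tensA m b0) (b1 * n1)) (rcoact N n0).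
  have pre := @rtens_pre_bal1 _ _ B M N n0.
  have mulb := mul_bal1 (rcomod_tens M N) n1.
  transitivity (rgalois (tlift (fun (v : U) x => tensA (v * n1) x : tensorA U (rcomod_tens M N))
      (tlift (fun m1 m0 => tensA m1 (tensA m0 n0)) (to_left_coact m)))).
    by rewrite tliftA_tens.
  rewrite rgalois_mulr (morph_tlift _ _ gD).
  have -> : tlift (fun m1 m0 => rgalois (tensA m1 (tensA m0 n0)
        : tensorA U (rcomod_tens M N))) (to_left_coact m) =
      tlift (fun a0 a1 => tlift (@rtens_pre _ _ B M N a0 a1) (rcoact N n0))
        (rgalois (to_left_coact m)).
    rewrite tliftA_lift //; apply: eq_tlift => m1 m0.
    rewrite rgaloisE [LHS](rtens_coact_lift _ _ (mul_bal2 (tensorA M N) m1)) tliftA_tens //.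
    apply: eq_tlift => a0 a1; apply: eq_tlift => b0 b1.
    by rewrite /rtens_pre mulrA.
  rewrite (rgalois_coact Bl Bproj) tliftAE // tliftA_tens; last exact: mul_bal2.
  by apply: eq_tlift => b0 b1; rewrite mulr1.
have Eb := @assocV_bal1 _ _ M N U m.
have <- : tlift (fun b0 b1 => tensA (tensA m b0) b1) (rgalois (to_left_coact n)) =
    tensA (tensA m n) (1 : U) by rewrite (rgalois_coact Bl Bproj) tliftAE.
rewrite tliftA_lift //; apply: eq_tlift => n1 n0.
by rewrite step tliftA_tens.
Qed.

Lemma to_left_coact_unit : @to_left_coact _ _ B (rcomod_unit B) = @lunit_coact _ _ B.
Proof.
apply/funext => a; apply: (to_left_coactE Bl Bproj).
rewrite /lunit_coact rgaloisE tliftAE; last exact: mul_bal2.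
by rewrite tgt1 mul1r src_lact -tensA_bal ract_regular mul1r.
Qed.
End ToLeft.

(** * From left to right comodules: axioms, morphisms, tensor products *)

Section ToRight.
Variables (k : comPzRingType) (A : kalgebra k) (B : left_bialgebroid A).
Local Notation U := (tri B).
Hypotheses (Br : right_hopf B) (Bproj : projective (lmodule_of U)).

Section Object.
Variable N : left_comodule B.
Local Notation delta := (lcoact N).
Local Notation rho := (@to_right_coact _ _ B N).
Local Notation gal := (@lgalois _ _ B N).

Let gal_rho n : gal (rho n) = tensA (1 : U) n.
Proof. exact: lgalois_coact. Qed.

Lemma to_right_coactD : {morph rho : m n / m + n}.
Proof.
by move=> m n; apply: (to_right_coactE Br Bproj); rewrite lgaloisD !gal_rho tensADr.
Qed.

Lemma to_right_coact_ract n a : rho (ract n a) = ract (rho n) a.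
Proof.
have [_ _ gr] := lgalois_bimod N.
by apply: (to_right_coactE Br Bproj); rewrite gr gal_rho ract_tensA.
Qed.

(** The case $p = 1$ is the counit axiom, and $p = t(a)$ identifies the induced left action. *)
Lemma to_right_coact_eps (p : U) n :
  tlift (fun m (u : U) => ract m (eps B (u * p))) (rho n) = lact (eps B p) n.
Proof.
have bal := @lact_eps_bal _ _ B N p.
have <- : tlift (fun (n1 : U) n0 => lact (eps B (n1 * p)) n0) (gal (rho n)) =
    lact (eps B p) n by rewrite gal_rho tliftAE // mul1r.
rewrite tliftA_lift //; apply: eq_tlift => m u.
rewrite tliftA_tens // (lco_ract (lcm_ax N)); apply: eq_tlift => m1 m0.
by rewrite -mulrA -eps_src.
Qed.

Let E (y : N) (p q : U) : tensorA U (tensorA U N) := tensA p (tensA q y).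
Let E_bal y : balanced (@ract _ _ U) (@lact _ _ U) (E y).
Proof. exact: assocA_bal1. Qed.

Let E_Delta_bal : balanced (@ract _ _ U) (@lact _ _ N)
  (fun w n => tlift (E n) (Delta B w)).
Proof.
split=> [n u v|w m n|w a n].
- by rewrite raddfD; exact/tliftAD/E_bal.
- by rewrite -tlift_sumf; apply: eq_tlift => p q; rewrite /E !tensADr.
- rewrite Delta_ract ract_tensorA tliftA_tens //.
  by apply: eq_tlift => p q; rewrite /E tensA_bal.
Qed.

(** Now $\Phi' \otimes id$ comes first and $id \otimes \Phi'$ second; both sides are sent to $1
    \otimes 1 \otimes n$. *)
Lemma to_right_coassoc n :
  tlift (fun m u => tensA (rho m) u) (rho n) =
  tlift (fun m w => tlift (fun u v => tensA (tensA m u) v) (Delta B w)) (rho n).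
Proof.
have [g galK gK] := lgalois_bij N Br Bproj.
have gb := lgalois_bimod N; have iU := bimod_id U.
have g'b : bimod_map g.
  case: gb => gD gl gr.
  by split=> [x y|a x|x a]; apply: (can_inj galK); rewrite ?(gD, gl, gr) !gK.
have inj1 : injective (tmap gal id : tensorA (tensorA N U) U -> _).
  apply: (can_inj (g := tmap g id)) => x; rewrite -tmap_comp //.
  by rewrite -[RHS]tmap_id; apply: eq_tlift => y u /=; rewrite galK.
have inj2 : injective (tmap id gal : tensorA U (tensorA N U) -> _).
  apply: (can_inj (g := tmap id g)) => x; rewrite -tmap_comp //.
  by rewrite -[RHS]tmap_id; apply: eq_tlift => u y /=; rewrite galK.
apply/inj1/(can_inj (@assocAK _ _ U N U))/inj2.
have [D1 _ _] := tmap_bimod gb iU; have [D2 _ _] := tmap_bimod iU gb.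
have DA := @assocAD _ _ U N U; have iUU := bimod_id (tensorA U U).
rewrite !(morph_tlift _ _ D1) !(morph_tlift _ _ DA) !(morph_tlift _ _ D2).
have lhs : tlift (fun m u => tmap id gal (assocA (tmap gal id (tensA (rho m) u))))
    (rho n) = E n 1 1.
  transitivity (tlift (fun m u => tensA (1 : U) (gal (tensA m u))) (rho n)).
    by apply: eq_tlift => m u; rewrite tmapE // gal_rho assocAE tmapE.
  rewrite -(morph_tlift _ _ (tensADr (1 : U))) -(morph_tlift _ _ (@lgaloisD _ _ B N)).
  by rewrite (tlift_tens (rho n)) gal_rho.
rewrite [LHS]lhs.
transitivity (tlift (fun w m => tlift (E m) (Delta B w)) (gal (rho n))).
  by rewrite gal_rho (tliftAE _ _ E_Delta_bal) Delta1 (tliftAE _ _ (E_bal n)).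
rewrite tliftA_lift //; apply: eq_tlift => m w; rewrite tliftA_tens //.
rewrite (morph_tlift _ _ D1) (morph_tlift _ _ DA) (morph_tlift _ _ D2).
transitivity (tlift (fun n1 n0 => tlift (fun u1 u2 => tlift (fun v1 v2 : U =>
    E n0 (v1 * u1) (v2 * u2)) (Delta B n1)) (Delta B w)) (delta m)).
  apply: eq_tlift => n1 n0; rewrite (Delta_mulE _ _ (E_bal n0)) tlift_exch //.
rewrite tlift_exch; apply: eq_tlift => u1 u2; rewrite tmapE // lgaloisE.
rewrite (morph_tlift _ _ (tensADl u2)) (morph_tlift _ _ DA) (morph_tlift _ _ D2).
rewrite -(lco_coassocE (lcm_ax N) (F := fun v1 v2 n => E n (v1 * u1) (v2 * u2))).
- apply: eq_tlift => n1 n0; rewrite assocAE tmapE // lgaloisE.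
  by rewrite (morph_tlift _ _ (tensADr (n1 * u1))).
- move=> v; split=> [x u u'|u x y|u a x]; last by rewrite -ract_mul /E tensA_bal.
  + by rewrite mulrDl /E tensADl tensADr.
  + by rewrite /E !tensADr.
- by move=> v x u u'; rewrite mulrDl /E tensADl.
- by move=> u a v x; rewrite -ract_mul -lact_mul; case: (E_bal x).
Qed.

Lemma to_right_ax : right_comodule_axioms rho.
Proof.
split; [exact: to_right_coactD | exact: to_right_coact_ract | exact: to_right_coassoc | |].
- move=> n; rewrite -[RHS]lact1 -[in RHS](eps1 B) -to_right_coact_eps.
  by apply: eq_tlift => m u; rewrite mulr1.
- by move=> a n; rewrite to_right_coact_eps eps_t.
Qed.
End Object.

Lemma to_right_hom_ax
    (ax : forall N : left_comodule B, right_comodule_axioms (@to_right_coact _ _ B N))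
    (M N : left_comodule B) (f : lcomod_hom M N) :
  is_rcomod_hom (M := RightComodule (ax M)) (N := RightComodule (ax N)) f.
Proof.
have [fD fl fr] := lcomod_hom_bimod (lch_ax f); have [_ _ fc] := lch_ax f.
split=> // m; apply: (to_right_coactE Br Bproj).
have bal := @lhom_bal _ _ B M N f (lcomod_hom_bimod (lch_ax f)).
have <- : tlift (fun (m1 : U) m0 => tensA m1 (f m0)) (lgalois (to_right_coact m)) =
    tensA (1 : U) (f m) by rewrite (lgalois_coact Br Bproj) tliftAE.
rewrite (morph_tlift _ _ (@lgaloisD _ _ B N)) tliftA_lift //; apply: eq_tlift => n u.
rewrite lgaloisE fc !tliftA_tens //; exact: mul_bal1.
Qed.

Lemma to_right_coact_tens (M N : left_comodule B)
    (axM : right_comodule_axioms (@to_right_coact _ _ B M))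
    (axN : right_comodule_axioms (@to_right_coact _ _ B N)) :
  @to_right_coact _ _ B (lcomod_tens M N) =
  @rtens_coact _ _ B (RightComodule axM) (RightComodule axN).
Proof.
apply/funext => x; set M' := RightComodule _; set N' := RightComodule _.
have gD := @lgaloisD _ _ B (lcomod_tens M N).
apply: (to_right_coactE Br Bproj); elim/tensorA_ind: x => [m n|x y IHx IHy]; last first.
  by rewrite (@rtens_coactD _ _ B M' N') gD IHx IHy tensADr.
rewrite (@rtens_coactE _ _ B M' N') (morph_tlift _ _ gD) /=.
(* The coaction of [n] is summed first and leaves $\Phi'_M(m_0 \otimes m_1) \otimes n$. *)
have step m0 (m1 : U) : lgalois (tlift (@rtens_pre _ _ B M' N' m0 m1) (to_right_coact n)
      : tensorA (lcomod_tens M N) U) =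
    tlift (fun (a1 : U) a0 => tensA (a1 * m1) (tensA a0 n)) (lcoact M m0).
  have pre := @ltens_pre_bal1 _ _ B M N m0.
  have mulb := mul_bal2 (lcomod_tens M N) m1.
  transitivity (lgalois (tlift (fun x (v : U) => tensA x (v * m1) : tensorA (lcomod_tens M N) U)
      (tlift (fun n0 n1 => tensA (tensA m0 n0) n1) (to_right_coact n)))).
    by rewrite tliftA_tens.
  rewrite lgalois_mulr (morph_tlift _ _ gD).
  have -> : tlift (fun n0 n1 => lgalois (tensA (tensA m0 n0) n1
        : tensorA (lcomod_tens M N) U)) (to_right_coact n) =
      tlift (fun b1 b0 => tlift (@ltens_pre _ _ B M N b1 b0) (lcoact M m0))
        (lgalois (to_right_coact n)).
    rewrite tliftA_lift //; apply: eq_tlift => n0 n1.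
    rewrite lgaloisE [LHS](ltens_coact_lift _ _ (mul_bal1 (tensorA M N) n1)) tliftA_tens //.
    apply: eq_tlift => b1 b0; apply: eq_tlift => a1 a0.
    by rewrite /ltens_pre mulrA.
  rewrite (lgalois_coact Br Bproj) tliftAE // tliftA_tens; last exact: mul_bal1.
  by apply: eq_tlift => a1 a0; rewrite mulr1.
have Eb := @assocA_bal1 _ _ U M N n.
have <- : tlift (fun a1 a0 => tensA a1 (tensA a0 n)) (lgalois (to_right_coact m)) =
    tensA (1 : U) (tensA m n) by rewrite (lgalois_coact Br Bproj) tliftAE.
rewrite tliftA_lift //; apply: eq_tlift => m0 m1.
by rewrite step tliftA_tens.
Qed.

Lemma to_right_coact_unit : @to_right_coact _ _ B (lcomod_unit B) = @runit_coact _ _ B.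
Proof.
apply/funext => a; apply: (to_right_coactE Br Bproj).
rewrite /runit_coact lgaloisE tliftAE; last exact: mul_bal1.
by rewrite src1 mul1r tgt_ract tensA_bal lact_regular mulr1.
Qed.
End ToRight.

(** * The two passages between coactions undo each other *)

Section MutuallyInverse.
Variables (k : comPzRingType) (A : kalgebra k) (B : left_bialgebroid A).
Local Notation U := (tri B).
Hypotheses (Bl : left_hopf B) (Br : right_hopf B).
Hypotheses (Bprojr : projective (rmodule_of U)) (Bprojl : projective (lmodule_of U)).

(** It suffices that $\Phi'(\rho(m)) = 1 \otimes m$, which is checked after $\Phi$: one has $\Phi(1
    \otimes m) = \rho(m)$, while $\Phi(\Phi'(m_{(0)} \otimes m_{(1)}))$ is $\Phi(\delta(m_{(0)})) =
    m_{(0)} \otimes 1$ multiplied by $m_{(1)}$. *)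
Lemma to_left_coactK (M : right_comodule B)
    (ax : left_comodule_axioms (@to_left_coact _ _ B M)) :
  @to_right_coact _ _ B (LeftComodule ax) = rcoact M.
Proof.
apply/funext => m; apply: (to_right_coactE Br Bprojl).
apply: (@rgalois_inj _ _ B M Bl Bprojr).
rewrite rgaloisE (morph_tlift _ _ (@rgaloisD _ _ B M)).
apply: eq_tlift => m0 m1; rewrite /= rgalois_mulr (rgalois_coact Bl Bprojr).
by rewrite (tliftAE _ _ (mul_bal2 M m1)) mul1r mulr1.
Qed.

Lemma to_right_coactK (N : left_comodule B)
    (ax : right_comodule_axioms (@to_right_coact _ _ B N)) :
  @to_left_coact _ _ B (RightComodule ax) = lcoact N.
Proof.
apply/funext => n; apply: (to_left_coactE Bl Bprojr).
apply: (@lgalois_inj _ _ B N Br Bprojl).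
rewrite lgaloisE (morph_tlift _ _ (@lgaloisD _ _ B N)).
apply: eq_tlift => n1 n0; rewrite /= lgalois_mulr (lgalois_coact Br Bprojl).
by rewrite (tliftAE _ _ (mul_bal1 N n1)) mul1r mulr1.
Qed.
End MutuallyInverse.

(** * Comodules with equal coactions: identity isomorphisms and casts *)

Section IdentityIso.
Variables (k : comPzRingType) (A : kalgebra k) (B : left_bialgebroid A).

Section Right.
Variables (M : right_comodule B) (d : M -> tensorA M (tri B)).
Variables (ax : right_comodule_axioms d) (dE : rcoact M = d).
Local Notation N := (RightComodule ax).

Lemma rcomod_id_hom : is_rcomod_hom (M := M) (N := N) id.
Proof. by split=> //= m; rewrite -dE -[LHS]tlift_tens. Qed.

(** Its underlying maps compute to [id], unlike the cast [eq_hom] along an equality of objects. *)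
Definition rcomod_id_iso : @iso (RComod B) M N :=
  @rcomod_iso _ _ B M N id id (fun _ => erefl) (fun _ => erefl) rcomod_id_hom.

Lemma rcomod_id_eq : M = N.
Proof.
case: M d ax dE => V rho rhoP d' ax' /= E; case: _ / E ax' => ax'.
congr RightComodule; exact: Prop_irrelevance.
Qed.

(** Once the coactions and their axioms are identified, [e] is an equality of an object with itself,
    hence reflexivity by proof irrelevance. *)
Lemma rcomod_eq_homE (e : M = N :> RComod B) : eq_hom e = rcomod_id_iso :> Defs.hom _ _.
Proof.
apply: rcomod_hom_eq => x /=.
case: M d ax dE x e => V rho rhoP d' ax' /= E; case: _ / E ax' => ax' x.
have eax : rhoP = ax' by exact: Prop_irrelevance.
by case: _ / eax => e; rewrite (Prop_irrelevance e erefl).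
Qed.
End Right.

Section Left.
Variables (M : left_comodule B) (d : M -> tensorA (tri B) M).
Variables (ax : left_comodule_axioms d) (dE : lcoact M = d).
Local Notation N := (LeftComodule ax).

Lemma lcomod_id_hom : is_lcomod_hom (M := M) (N := N) id.
Proof. by split=> //= m; rewrite -dE -[LHS]tlift_tens. Qed.

Definition lcomod_id_iso : @iso (LComod B) M N :=
  @lcomod_iso _ _ B M N id id (fun _ => erefl) (fun _ => erefl) lcomod_id_hom.

Lemma lcomod_id_eq : M = N.
Proof.
case: M d ax dE => V delta deltaP d' ax' /= E; case: _ / E ax' => ax'.
congr LeftComodule; exact: Prop_irrelevance.
Qed.

Lemma lcomod_eq_homE (e : M = N :> LComod B) : eq_hom e = lcomod_id_iso :> Defs.hom _ _.
Proof.
apply: lcomod_hom_eq => x /=.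
case: M d ax dE x e => V delta deltaP d' ax' /= E; case: _ / E ax' => ax' x.
have eax : deltaP = ax' by exact: Prop_irrelevance.
by case: _ / eax => e; rewrite (Prop_irrelevance e erefl).
Qed.
End Left.
End IdentityIso.

(** * Strict monoidal structure on the functor to left comodules *)

Section MonoidalToLeft.
Variables (k : comPzRingType) (A : kalgebra k) (B : left_bialgebroid A).
Local Notation U := (tri B).
Hypotheses (Bl : left_hopf B) (Bproj : projective (rmodule_of U)).
Variables (ob_ax : forall M : right_comodule B,
    left_comodule_axioms (N := M) (@to_left_coact k A B M))
  (hom_ax : forall (M N : right_comodule B) (f : rcomod_hom M N),
    is_lcomod_hom (M := LeftComodule (ob_ax M)) (N := LeftComodule (ob_ax N)) f).
Local Notation F := (to_left hom_ax).

Definition to_left_tens (M N : RComod B) : iso (mtens (F M) (F N)) (F (mtens M N)) :=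
  @lcomod_id_iso _ _ B (lcomod_tens (LeftComodule (ob_ax M)) (LeftComodule (ob_ax N)))
    _ (ob_ax (rcomod_tens M N)) (esym (to_left_coact_tens Bl Bproj (ob_ax M) (ob_ax N))).

Definition to_left_unit : iso munit (F munit) :=
  @lcomod_id_iso _ _ B (lcomod_unit B) _ (ob_ax (rcomod_unit B))
    (esym (to_left_coact_unit Bl Bproj)).

(** The structure maps are identities on elements, so the coherence laws hold pointwise, up to
    [tmap_id]. *)
Program Definition to_left_monoidal : monoidal_structure F :=
  @MonoidalStructure _ _ F to_left_tens to_left_unit _ _ _ _.
Next Obligation. exact: lcomod_hom_eq. Qed.
Next Obligation. by apply: lcomod_hom_eq => x /=; rewrite !tmap_id. Qed.
Next Obligation. by apply: lcomod_hom_eq => x /=; rewrite tmap_id. Qed.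
Next Obligation. by apply: lcomod_hom_eq => x /=; rewrite tmap_id. Qed.

Lemma to_left_monoidal_strict : strict to_left_monoidal.
Proof.
split=> [M N|].
  exists (@lcomod_id_eq _ _ B (lcomod_tens (LeftComodule (ob_ax M)) (LeftComodule (ob_ax N)))
    _ (ob_ax (rcomod_tens M N)) (esym (to_left_coact_tens Bl Bproj (ob_ax M) (ob_ax N)))).
  exact/esym/lcomod_eq_homE.
exists (@lcomod_id_eq _ _ B (lcomod_unit B) _ (ob_ax (rcomod_unit B))
  (esym (to_left_coact_unit Bl Bproj))).
exact/esym/lcomod_eq_homE.
Qed.

Variables (phi : monoidal_structure F) (phiS : strict phi).

(** Reduces an arbitrary strict structure to the explicit one, whose maps compute. *)
Lemma strict_to_left_tens (M N : RComod B) :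
  mf_tens phi M N = to_left_tens M N :> Defs.hom _ _.
Proof. by have [/(_ M N)[e ->] _] := phiS; exact: lcomod_eq_homE. Qed.

Lemma strict_to_left_unit : mf_unit phi = to_left_unit :> Defs.hom _ _.
Proof. by have [_ [e ->]] := phiS; exact: lcomod_eq_homE. Qed.
End MonoidalToLeft.

(** * Strict monoidal structure on the functor to right comodules *)

Section MonoidalToRight.
Variables (k : comPzRingType) (A : kalgebra k) (B : left_bialgebroid A).
Local Notation U := (tri B).
Hypotheses (Br : right_hopf B) (Bproj : projective (lmodule_of U)).
Variables (ob_ax : forall N : left_comodule B,
    right_comodule_axioms (M := N) (@to_right_coact k A B N))
  (hom_ax : forall (M N : left_comodule B) (f : lcomod_hom M N),
    is_rcomod_hom (M := RightComodule (ob_ax M)) (N := RightComodule (ob_ax N)) f).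
Local Notation F := (to_right hom_ax).

Definition to_right_tens (M N : LComod B) : iso (mtens (F M) (F N)) (F (mtens M N)) :=
  @rcomod_id_iso _ _ B (rcomod_tens (RightComodule (ob_ax M)) (RightComodule (ob_ax N)))
    _ (ob_ax (lcomod_tens M N)) (esym (to_right_coact_tens Br Bproj (ob_ax M) (ob_ax N))).

Definition to_right_unit : iso munit (F munit) :=
  @rcomod_id_iso _ _ B (rcomod_unit B) _ (ob_ax (lcomod_unit B))
    (esym (to_right_coact_unit Br Bproj)).

Program Definition to_right_monoidal : monoidal_structure F :=
  @MonoidalStructure _ _ F to_right_tens to_right_unit _ _ _ _.
Next Obligation. exact: rcomod_hom_eq. Qed.
Next Obligation. by apply: rcomod_hom_eq => x /=; rewrite !tmap_id. Qed.
Next Obligation. by apply: rcomod_hom_eq => x /=; rewrite tmap_id. Qed.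
Next Obligation. by apply: rcomod_hom_eq => x /=; rewrite tmap_id. Qed.

Lemma to_right_monoidal_strict : strict to_right_monoidal.
Proof.
split=> [M N|].
  exists (@rcomod_id_eq _ _ B (rcomod_tens (RightComodule (ob_ax M)) (RightComodule (ob_ax N)))
    _ (ob_ax (lcomod_tens M N)) (esym (to_right_coact_tens Br Bproj (ob_ax M) (ob_ax N)))).
  exact/esym/rcomod_eq_homE.
exists (@rcomod_id_eq _ _ B (rcomod_unit B) _ (ob_ax (lcomod_unit B))
  (esym (to_right_coact_unit Br Bproj))).
exact/esym/rcomod_eq_homE.
Qed.

Variables (psi : monoidal_structure F) (psiS : strict psi).

Lemma strict_to_right_tens (M N : LComod B) :
  mf_tens psi M N = to_right_tens M N :> Defs.hom _ _.
Proof. by have [/(_ M N)[e ->] _] := psiS; exact: rcomod_eq_homE. Qed.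

Lemma strict_to_right_unit : mf_unit psi = to_right_unit :> Defs.hom _ _.
Proof. by have [_ [e ->]] := psiS; exact: rcomod_eq_homE. Qed.
End MonoidalToRight.

(** * Inverses of monoidal natural isomorphisms *)

Section NatIsoInverse.
Variables (C D : monoidal_category) (F G : functor C D) (theta : nat_iso F G).

Lemma nat_iso_inv_nat (X Y : C) (f : Defs.hom X Y) :
  compc (fhom F f) (iso_inv (theta X)) = compc (iso_inv (theta Y)) (fhom G f).
Proof.
rewrite -[LHS]comp1c -(iso_funK (theta Y)) -compcA.
by rewrite [compc (theta Y) _]compcA -niso_nat -compcA iso_invK compc1.
Qed.

Definition nat_iso_inv : nat_iso G F :=
  @NatIso _ _ G F (fun X => Iso (iso_invK (theta X)) (iso_funK (theta X)))
    nat_iso_inv_nat.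

Lemma monoidal_nat_inv (phi : monoidal_structure F) (psi : monoidal_structure G) :
  is_monoidal_nat phi psi theta -> is_monoidal_nat psi phi nat_iso_inv.
Proof.
case=> thetaT theta1; split=> [X Y|] /=; last first.
  by rewrite -theta1 compcA iso_funK comp1c.
rewrite -[LHS]compc1 -mtensh1 -(iso_invK (theta X)) -(iso_invK (theta Y)) mtenshM.
rewrite -compcA [compc (mf_tens psi X Y) _]compcA -thetaT !compcA iso_funK.
by rewrite comp1c.
Qed.
End NatIsoInverse.

(** * Monoidal quasi-inverses *)

Section QuasiInverse.
Variables (k : comPzRingType) (A : kalgebra k) (B : left_bialgebroid A).
Local Notation U := (tri B).
Hypotheses (Bl : left_hopf B) (Br : right_hopf B).
Hypotheses (Bprojr : projective (rmodule_of U)) (Bprojl : projective (lmodule_of U)).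
Variables (lob_ax : forall M : right_comodule B,
    left_comodule_axioms (N := M) (@to_left_coact k A B M))
  (lhom_ax : forall (M N : right_comodule B) (f : rcomod_hom M N),
    is_lcomod_hom (M := LeftComodule (lob_ax M)) (N := LeftComodule (lob_ax N)) f)
  (rob_ax : forall N : left_comodule B,
    right_comodule_axioms (M := N) (@to_right_coact k A B N))
  (rhom_ax : forall (M N : left_comodule B) (f : lcomod_hom M N),
    is_rcomod_hom (M := RightComodule (rob_ax M)) (N := RightComodule (rob_ax N)) f).
Local Notation F := (to_left lhom_ax).
Local Notation G := (to_right rhom_ax).
Variables (phi : monoidal_structure F) (psi : monoidal_structure G).
Hypotheses (phiS : strict phi) (psiS : strict psi).


Definition rcomod_roundtrip (M : RComod B) : iso M (G (F M)) :=
  @rcomod_id_iso _ _ B M _ (rob_ax (LeftComodule (lob_ax M)))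
    (esym (to_left_coactK Bl Br Bprojr Bprojl (lob_ax M))).

Definition lcomod_roundtrip (N : LComod B) : iso N (F (G N)) :=
  @lcomod_id_iso _ _ B N _ (lob_ax (RightComodule (rob_ax N)))
    (esym (to_right_coactK Bl Br Bprojr Bprojl (rob_ax N))).

Program Definition rcomod_roundtrip_nat : nat_iso (functor_id (RComod B)) (functor_comp G F) :=
  @NatIso _ _ (functor_id (RComod B)) (functor_comp G F) rcomod_roundtrip _.
Next Obligation. exact: rcomod_hom_eq. Qed.

Program Definition lcomod_roundtrip_nat : nat_iso (functor_id (LComod B)) (functor_comp F G) :=
  @NatIso _ _ (functor_id (LComod B)) (functor_comp F G) lcomod_roundtrip _.
Next Obligation. exact: lcomod_hom_eq. Qed.

Lemma rcomod_roundtrip_monoidal :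
  is_monoidal_nat (monoidal_id (RComod B)) (monoidal_comp psi phi) rcomod_roundtrip_nat.
Proof.
split=> [M N|].
  rewrite [mf_tens (monoidal_comp _ _) M N : Defs.hom _ _]/=.
  rewrite (strict_to_left_tens Bl Bprojr phiS) (strict_to_right_tens Br Bprojl psiS).
  by apply: rcomod_hom_eq => x /=; rewrite tmap_id.
rewrite [mf_unit (monoidal_comp _ _) : Defs.hom _ _]/=.
rewrite (strict_to_left_unit Bl Bprojr phiS) (strict_to_right_unit Br Bprojl psiS).
exact: rcomod_hom_eq.
Qed.

Lemma lcomod_roundtrip_monoidal :
  is_monoidal_nat (monoidal_id (LComod B)) (monoidal_comp phi psi) lcomod_roundtrip_nat.
Proof.
split=> [M N|].
  rewrite [mf_tens (monoidal_comp _ _) M N : Defs.hom _ _]/=.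
  rewrite (strict_to_left_tens Bl Bprojr phiS) (strict_to_right_tens Br Bprojl psiS).
  by apply: lcomod_hom_eq => x /=; rewrite tmap_id.
rewrite [mf_unit (monoidal_comp _ _) : Defs.hom _ _]/=.
rewrite (strict_to_left_unit Bl Bprojr phiS) (strict_to_right_unit Br Bprojl psiS).
exact: lcomod_hom_eq.
Qed.

(** A quasi-inverse requires isomorphisms $Id \to GF$ and $FG \to Id$. Both round trips are built
    out of the identity functor, so each order uses one of them directly and the inverse of the
    other. *)
Lemma to_left_right_quasi_inverse :
  monoidal_quasi_inverse phi psi /\ monoidal_quasi_inverse psi phi.
Proof.
have rm := rcomod_roundtrip_monoidal; have lm := lcomod_roundtrip_monoidal.
have rm' := monoidal_nat_inv rm; have lm' := monoidal_nat_inv lm.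
by split; split; do ?[by exists rcomod_roundtrip_nat | by exists lcomod_roundtrip_nat];
  eexists; eassumption.
Qed.
End QuasiInverse.

(** Unique existence for the specifications ensures that the coactions selected by [xget] are the
    intended ones. The third part ranges over all proofs of the axioms and all strict structures, so
    it applies to whichever ones witness the first two parts. *)
Theorem theoremA (k : comPzRingType) (A : kalgebra k) (B : left_bialgebroid A) :
  (left_hopf B -> projective (rmodule_of (tri B)) ->
     (forall (M : right_comodule B) (m : M), exists! y, to_left_spec m y) /\
     exists (ob_ax : forall M : right_comodule B,
               left_comodule_axioms (N := M) (@to_left_coact k A B M))
            (hom_ax : forall (M N : right_comodule B) (f : rcomod_hom M N),
               is_lcomod_hom (M := LeftComodule (ob_ax M))
                 (N := LeftComodule (ob_ax N)) f)
            (phi : monoidal_structure (to_left hom_ax)),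
       strict phi)
  /\
  (right_hopf B -> projective (lmodule_of (tri B)) ->
     (forall (N : left_comodule B) (n : N), exists! y, to_right_spec n y) /\
     exists (ob_ax : forall N : left_comodule B,
               right_comodule_axioms (M := N) (@to_right_coact k A B N))
            (hom_ax : forall (M N : left_comodule B) (f : lcomod_hom M N),
               is_rcomod_hom (M := RightComodule (ob_ax M))
                 (N := RightComodule (ob_ax N)) f)
            (psi : monoidal_structure (to_right hom_ax)),
       strict psi)
  /\
  (left_hopf B -> right_hopf B ->
   projective (rmodule_of (tri B)) -> projective (lmodule_of (tri B)) ->
     (forall (lob_ax : forall M : right_comodule B,
                left_comodule_axioms (N := M) (@to_left_coact k A B M))
             (lhom_ax : forall (M N : right_comodule B) (f : rcomod_hom M N),
                is_lcomod_hom (M := LeftComodule (lob_ax M))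
                  (N := LeftComodule (lob_ax N)) f)
             (rob_ax : forall N : left_comodule B,
                right_comodule_axioms (M := N) (@to_right_coact k A B N))
             (rhom_ax : forall (M N : left_comodule B) (f : lcomod_hom M N),
                is_rcomod_hom (M := RightComodule (rob_ax M))
                  (N := RightComodule (rob_ax N)) f)
             (phi : monoidal_structure (to_left lhom_ax))
             (psi : monoidal_structure (to_right rhom_ax)),
        strict phi -> strict psi -> monoidal_quasi_inverse phi psi) /\
     monoidally_equivalent (LComod B) (RComod B)).
Proof.
split=> [Bl Bproj|].
  split; first by move=> M; exact: to_left_spec_uniq.
  exists (to_left_ax Bl Bproj), (to_left_hom_ax Bl Bproj (to_left_ax Bl Bproj)).
  by exists (to_left_monoidal Bl Bproj _); exact: to_left_monoidal_strict.
split=> [Br Bproj|Bl Br Bprojr Bprojl].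
  split; first by move=> N; exact: to_right_spec_uniq.
  exists (to_right_ax Br Bproj), (to_right_hom_ax Br Bproj (to_right_ax Br Bproj)).
  by exists (to_right_monoidal Br Bproj _); exact: to_right_monoidal_strict.
split=> [lob_ax lhom_ax rob_ax rhom_ax phi psi phiS psiS|].
  by have [] := to_left_right_quasi_inverse Bl Br Bprojr Bprojl phiS psiS.
have lhom := to_left_hom_ax Bl Bprojr (to_left_ax Bl Bprojr).
have rhom := to_right_hom_ax Br Bprojl (to_right_ax Br Bprojl).
have phiS := to_left_monoidal_strict Bl Bprojr lhom.
have psiS := to_right_monoidal_strict Br Bprojl rhom.
exists (to_right rhom), (to_left lhom),
  (to_right_monoidal Br Bprojl rhom), (to_left_monoidal Bl Bprojr lhom).
by have [] := to_left_right_quasi_inverse Bl Br Bprojr Bprojl phiS psiS.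
Qed.
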